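(* Let $p,q\in\mathbb{N}$ be positive integers with greatest common divisor $1$, and suppose that $\theta\in(0,\frac{\pi}{3})$ satisfies $\tan\theta=\frac{\sqrt{3}\,p}{2q+p}$. Let $\alpha(\theta)$ be the common value of $\dim_B E_{\theta,a}=\dim_H E_{\theta,a}$ for Lebesgue almost every $a\in\Delta_\theta$. Then: (1) Let $\Gamma(\delta)=\dim_H\{a\in\Delta_\theta:\dim_H E_{\theta,a}\ge\delta\}$. Then $$\Gamma(\delta)=\inf_{t>0}\left\{-\delta t+\frac{P(t)}{\log 2}\right\}\quad\text{if } \alpha(\theta)<\delta\le b_{\max},$$ and $\Gamma(\delta)=1$ if $\delta\le\alpha(\theta)$. The function $\Gamma$ is decreasing and continuous. (2) For every $\alpha(\theta)\le\delta\le b_{\max}$, $$\chi(\delta):=\dim_H\{a\in\Delta_\theta:\dim_H E_{\theta,a}=\delta\}=\inf_{t>0}\left\{-\delta t+\frac{P(t)}{\log 2}\right\}.$$ The function $\chi$ is decreasing and continuous.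
   Context: $\Delta\subset\mathbb{R}^2$ is the Sierpiński gasket: the unique non-empty compact set with $\Delta=S_0(\Delta)\cup S_1(\Delta)\cup S_2(\Delta)$, where $S_0(x,y)=(\frac x2,\frac y2)$, $S_1(x,y)=(\frac x2+\frac12,\frac y2)$, $S_2(x,y)=(\frac x2+\frac14,\frac y2+\frac{\sqrt3}{4})$. For $a\in\mathbb{R}$ let $L_{\theta,a}=\{(x,a+x\tan\theta):x\in\mathbb{R}\}$, $\mathrm{proj}_\theta(x,y)=y-x\tan\theta$, $\Delta_\theta=\mathrm{proj}_\theta(\Delta)$, $E_{\theta,a}=L_{\theta,a}\cap\Delta$. $\dim_H$, $\dim_B$ are Hausdorff and box dimension. For these $\theta$ the box and Hausdorff dimensions of $E_{\theta,a}$ exist, coincide and are equal to a constant $\alpha(\theta)$ for Lebesgue a.e. $a\in\Delta_\theta$ (so $\alpha(\theta)$ is well defined). Matrices: let $f_0(t)=\frac t2$, $f_1(t)=\frac t2+\frac12$, $f_2(t)=\frac t2-\frac{p}{2q}$. For $k=1,\dots,p+q$ let $I_k=[1-\frac kq,1-\frac{k-1}q]$, $I_k^0=[1-\frac{2k-1}{2q},1-\frac{k-1}{q}]$ (upper half), $I_k^1=[1-\frac kq,1-\frac{2k-1}{2q}]$ (lower half). For $n\in\{0,1\}$ let $A_n$ be the $(p+q)\times(p+q)$ matrix with entries $(A_n)_{i,j}=\sharp\{k\in\{0,1,2\}: f_k(I_j)=I_i^n\}$. Let $\underline e=(1,\dots,1)\in\mathbb{R}^{p+q}$ (used as row or column vector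 as appropriate). The pressure is $$P(t)=\lim_{n\to\infty}\frac1n\log\sum_{\xi_1,\dots,\xi_n=0}^1\left(\underline e A_{\xi_1}\cdots A_{\xi_n}\underline e\right)^t,\qquad t\in\mathbb{R},$$ and $b_{\max}=\lim_{t\to\infty}\frac{P(t)}{t\log 2}$. *)

(* Defs.v *)
From mathcomp Require Import all_boot all_order all_algebra.
From mathcomp Require Import all_classical all_reals all_analysis.
Set Implicit Arguments.
Unset Strict Implicit.
Unset Printing Implicit Defensive.
Import Order.TTheory GRing.Theory Num.Theory.
Import numFieldNormedType.Exports.

Local Open Scope classical_set_scope.
Local Open Scope ring_scope.

Section Dimensions.
Context {R : realType} {T : Type}.
(* The distance is an explicit parameter because the library equips [R * R]
   with the sup norm, whereas the plane is used here with Euclidean distance. *)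
Variable d : T -> T -> R.
Implicit Types (U E : set T) (s r : R).

(* 0 is added so that the empty set has diameter 0 rather than -oo. *)
Definition diam U : \bar R :=
  ereal_sup (0%E |` [set (d x y)%:E | x in U & y in U]).

(* At s = 0 a non-empty set has gauge 1 (as 0 `^ 0 = 1) and the empty set 0. *)
Definition gauge s U : \bar R :=
  if `[< U = set0 >] then 0%E else (diam U `^ s)%E.

Definition hausdorff_content s r E : \bar R :=
  ereal_inf [set (\sum_(0 <= k <oo) gauge s (U k))%E | U in
    [set U : nat -> set T |
      E `<=` \bigcup_k U k /\ forall k, (diam (U k) <= r%:E)%E]].

Definition hausdorff_measure s E : \bar R :=
  ereal_sup [set hausdorff_content s r E | r in [set r | 0 < r]].

Definition hausdorff_dim E : \bar R :=
  ereal_inf [set s%:E | s in [set s | 0 <= s /\ hausdorff_measure s E = 0%E]].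

(* +oo when no finite cover exists. *)
Definition covering_number r E : \bar R :=
  ereal_inf [set n%:R%:E | n in
    [set n : nat | exists U : 'I_n -> set T,
      E `<=` \bigcup_i U i /\ forall i, (diam (U i) <= r%:E)%E]].

(* The box dimension of [E] exists and equals [b]. *)
Definition has_box_dim E (b : \bar R) : Prop :=
  (lne (covering_number r E) * ((- ln r)^-1)%:E)%E @[r --> 0^'+] --> b.

End Dimensions.

Section Gasket.
Context {R : realType}.
Implicit Types (D : set (R * R)) (theta a alpha delta : R).

Definition dist1 (x y : R) : R := `|x - y|.

Definition dist2 (z w : R * R) : R :=
  Num.sqrt ((z.1 - w.1) ^+ 2 + (z.2 - w.2) ^+ 2).

Definition S0 (z : R * R) : R * R := (z.1 / 2, z.2 / 2).
Definition S1 (z : R * R) : R * R := (z.1 / 2 + 1 / 2, z.2 / 2).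
Definition S2 (z : R * R) : R * R :=
  (z.1 / 2 + 1 / 4, z.2 / 2 + Num.sqrt 3 / 4).

(* These conditions determine a unique set, by Hutchinson's theorem. *)
Definition is_sierpinski_gasket D : Prop :=
  [/\ D !=set0, compact D & D = S0 @` D `|` S1 @` D `|` S2 @` D].

Definition line theta a : set (R * R) := range (fun x => (x, a + x * tan theta)).

Definition proj theta (z : R * R) : R := z.2 - z.1 * tan theta.

Definition shadow D theta : set R := proj theta @` D.

Definition slice D theta a : set (R * R) := line theta a `&` D.

Definition is_typical_slice_dim D theta alpha : Prop :=
  \forall a \ae (@lebesgue_measure R), shadow D theta a ->
    has_box_dim dist2 (slice D theta a) alpha%:E /\
    hausdorff_dim dist2 (slice D theta a) = alpha%:E.

Definition Gamma D theta delta : \bar R :=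
  hausdorff_dim dist1 [set a | shadow D theta a /\
    (delta%:E <= hausdorff_dim dist2 (slice D theta a))%E].

Definition chi D theta delta : \bar R :=
  hausdorff_dim dist1 [set a | shadow D theta a /\
    hausdorff_dim dist2 (slice D theta a) = delta%:E].

End Gasket.

Section Pressure.
Context {R : realType}.
Variables p q : nat.

Definition ifs_map (k : 'I_3) (t : R) : R :=
  match val k with
  | 0%N => t / 2
  | 1%N => t / 2 + 1 / 2
  | _ => t / 2 - p%:R / (2 * q%:R)
  end.

(* [itvI k] and [halfI n k] are meant for 1 <= k <= p + q. *)
Definition itvI (k : nat) : set R :=
  `[1 - k%:R / q%:R, 1 - (k%:R - 1) / q%:R]%classic.

(* n = 0 is the upper half of [itvI k], n = 1 the lower half. *)
Definition halfI (n : 'I_2) (k : nat) : set R :=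
  if val n == 0%N
  then `[1 - (2 * k%:R - 1) / (2 * q%:R), 1 - (k%:R - 1) / q%:R]%classic
  else `[1 - k%:R / q%:R, 1 - (2 * k%:R - 1) / (2 * q%:R)]%classic.

(* Ordinals start at 0, hence the shift to the interval indices 1, ..., p + q. *)
Definition Amx (n : 'I_2) : 'M[R]_(p + q) :=
  \matrix_(i, j)
    #|[pred k : 'I_3 | `[< ifs_map k @` itvI j.+1 = halfI n i.+1 >] ]|%:R.

Definition word_mx n (xi : n.-tuple 'I_2) : 'M[R]_(p + q) :=
  \big[mulmx/1%:M]_(i < n) Amx (tnth xi i).

Definition word_norm n (xi : n.-tuple 'I_2) : R :=
  ((const_mx 1 : 'rV[R]_(p + q)) *m word_mx xi
    *m (const_mx 1 : 'cV[R]_(p + q))) 0 0.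

Definition pressure (t : R) : R :=
  lim ((n%:R^-1 * ln (\sum_(xi : n.-tuple 'I_2) word_norm xi `^ t))
       @[n --> \oo]).

Definition bmax : R := lim ((pressure t / (t * ln 2)) @[t --> +oo]).

Definition pressure_transform (delta : R) : \bar R :=
  ereal_inf [set (- delta * t + pressure t / ln 2)%:E | t in [set t | 0 < t]].

End Pressure.

Arguments pressure {R} p q t.
Arguments bmax {R} p q.
Arguments pressure_transform {R} p q delta.

(* Main.v *)
Require Import Defs.
From mathcomp Require Import all_boot all_order all_algebra.
From mathcomp Require Import all_classical all_reals all_analysis.
From mathcomp Require Import ring lra zify.
Import Order.TTheory GRing.Theory Num.Theory.
Import numFieldNormedType.Exports.

(* Write [N = p + q]. In the coordinate [q * (1 - t)] the gasket projects onto [[0, N]] by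
   the digits [q, 0, N] in base 2, and the slice at level [x] is coded by the expansions of [x]
   in these digits. The entry [(i, j)] of [A_xi] counts the words [c] of digits with
   [val3 c + j = 2^n i + val2 xi], so the norms count the gasket triangles met by a slice.

   Upper bound: covering a slice by these triangles shows that a slice of dimension at least
   [delta] has large norms at all large scales, and Chebyshev's inequality with exponent [t]
   bounds the number of such words by the pressure.

   Lower bound: the number of loops at state 0 is supermultiplicative, the norm is
   submultiplicative, and connecting words make them comparable. Call [(x, s)] achievable if about
   [exp (n s)] words of length [n] have both weights about [exp (n x)]. Concatenation makes the
   achievable pairs a convex set, its support function is the pressure, and box counting at typical
   levels puts a pair [(x, ln 2)] with [x <= alpha ln 2] in it. Hence its upper boundary to
   the right of [alpha] is the Legendre transform over [t > 0] alone. Concatenating blocks of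
   length 0, 1, 2, ... of a prescribed rate gives homogeneous Moran sets, both of levels and inside
   the slices; since the block lengths tend to infinity, the connecting constants disappear and the
   slices have dimension exactly [delta]. Lower bounds for dimensions use the image of Lebesgue
   outer measure on [[0, 1[] under a mixed radix coding. *)

Set Implicit Arguments.
Unset Strict Implicit.
Unset Printing Implicit Defensive.

Local Open Scope classical_set_scope.
Local Open Scope ring_scope.

(** * Lebesgue outer measure and Hausdorff measure *)

Section OuterLebesgue.
Context {R : realType}.
Local Notation lam := (@lebesgue_measure R).

(** Differentiability of the pressure is not established, and no Gibbs measure is used: convexity of
    the set of achievable pairs carries the variational argument. Nor is [alpha] computed; it enters
    only through the typical levels, and the transform equals 1 up to [alpha] because it is squeezed
    between [Gamma] and 1. The block lengths 0, 1, 2, ... are a compromise. If each block loses a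
    constant factor, k blocks of total length of order k^2 lose only a subexponential one; at the
    same time the lengths of consecutive prefixes have ratio tending to 1, so that covers and masses
    need to be controlled at these scales only. A level that is a dyadic endpoint at some scale
    touches two cells there, and a single count no longer bounds the number of triangles over it.
    The upper bound therefore looks at two neighbouring cells, while the construction avoids such
    levels. Points are assigned to codes by choice, hence without any measurability; this is why
    masses are images of an outer measure. *)

Lemma lebesgue_le (A B : set R) : A `<=` B -> (lam A <= lam B)%E.
Proof. by move=> AB; exact: (@le_outer_measure _ _ ((wlength idfun)^*)%mu). Qed.

(** [lebesgue_measure] is by conversion the outer measure generated by interval lengths, so this and
    its neighbours hold for arbitrary sets. *)
Lemma lebesgue_bigcup (F : (set R)^nat) :
  (lam (\bigcup_n F n) <= \sum_(0 <= n <oo) lam (F n))%E.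
Proof. exact: (@outer_measure_sigma_subadditive _ _ ((wlength idfun)^*)%mu). Qed.

Lemma lebesgueU (A B : set R) : (lam (A `|` B) <= lam A + lam B)%E.
Proof. exact: (@outer_measureU2 _ _ ((wlength idfun)^*)%mu). Qed.

Lemma lebesgue_ge0 (A : set R) : (0 <= lam A)%E.
Proof. exact: (@outer_measure_ge0 _ _ ((wlength idfun)^*)%mu). Qed.

Lemma lebesgue_itvcc (a b : R) : a <= b -> lam `[a, b] = (b - a)%:E.
Proof.
move=> ab; rewrite lebesgue_measure_itv /= lte_fin.
by case: ltP => // ba; rewrite (@le_anti _ _ a b) ?subrr// ab.
Qed.

Lemma lebesgue_seq_le (I : eqType) (J : seq I) (A : set R) (F : I -> set R) (r : R) :
  0 <= r -> (forall x, A x -> exists2 i, i \in J & F i x) ->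
  (forall i, (lam (F i) <= r%:E)%E) -> (lam A <= ((size J)%:R * r)%:E)%E.
Proof.
move=> r0; elim: J A => [|i J IH] A AF Fr.
  rewrite mul0r (_ : A = set0) ?measure0//.
  by apply/seteqP; split => x // /AF[].
have /lebesgue_le : A `<=` F i `|` (A `\` F i).
  by move=> x Ax; have [|] := pselect (F i x); [left|right].
move/le_trans; apply; apply: le_trans (lebesgueU _ _) _.
rewrite /= -natr1 mulrDl mul1r addrC EFinD; apply: leeD => //.
apply: IH => // x [/AF[j]]; rewrite in_cons => /orP[/eqP->//|jJ Fjx _].
by exists j.
Qed.

End OuterLebesgue.

Section Hausdorff.
Context {R : realType} {T : Type}.
Variable d : T -> T -> R.
Implicit Types (U E F : set T) (s r : R).

Lemma le_diam U x y : U x -> U y -> ((d x y)%:E <= diam d U)%E.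
Proof.
by move=> Ux Uy; apply: ereal_sup_ubound; right; exists x => //; exists y.
Qed.

Lemma diam_ge0 U : (0 <= diam d U)%E.
Proof. by apply: ereal_sup_ubound; left. Qed.

Lemma diam_le U r : 0 <= r -> (forall x y, U x -> U y -> d x y <= r) ->
  (diam d U <= r%:E)%E.
Proof.
move=> r0 Ur; apply: ge_ereal_sup => _ [->|[x Ux [y Uy <-]]]; rewrite lee_fin//.
exact: Ur.
Qed.

Lemma gauge_ge0 s U : (0 <= gauge d s U)%E.
Proof. by rewrite /gauge; case: asboolP => // _; exact: poweR_ge0. Qed.

Lemma gauge_diam s U r : U !=set0 -> diam d U = r%:E -> gauge d s U = (r `^ s)%:E.
Proof.
move=> U0 dU; rewrite /gauge; case: asboolP => [U0'|_].
  by move/set0P: U0; rewrite U0' eqxx.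
by rewrite dU poweR_EFin.
Qed.

Lemma gauge_set0 s : gauge d s set0 = 0%E.
Proof. by rewrite /gauge; case: asboolP. Qed.

Lemma diam_fin U r : (diam d U <= r%:E)%E ->
  exists2 c, 0 <= c <= r & diam d U = c%:E.
Proof.
move=> Ur; have := diam_ge0 U; case: (diam d U) Ur => [c||]//.
by rewrite !lee_fin => cr c0; exists c; rewrite ?c0.
Qed.

Lemma gauge_le s U r : 0 <= s -> (diam d U <= r%:E)%E ->
  (gauge d s U <= (r `^ s)%:E)%E.
Proof.
move=> s0 /diam_fin[c /andP[c0 cr] dU].
have [->|/set0P U0] := eqVneq U set0; first by rewrite gauge_set0 lee_fin powR_ge0.
rewrite (gauge_diam _ U0 dU) lee_fin; apply: ge0_ler_powR => //; rewrite nnegrE//.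
exact: le_trans cr.
Qed.

Lemma hausdorff_content_ge0 s r E : (0 <= hausdorff_content d s r E)%E.
Proof.
by apply: le_ereal_inf_tmp => _ [U _ <-]; apply: nneseries_ge0 => k _ _; exact: gauge_ge0.
Qed.

Lemma hausdorff_measure_ge0 s E : (0 <= hausdorff_measure d s E)%E.
Proof.
apply: le_trans (hausdorff_content_ge0 s 1 E) _.
by apply: ereal_sup_ubound; exists 1 => //=.
Qed.

Lemma hausdorff_nullP s E : hausdorff_measure d s E = 0%E <->
  forall r e, 0 < r -> 0 < e -> exists U : nat -> set T,
    [/\ E `<=` \bigcup_k U k, forall k, (diam d (U k) <= r%:E)%E &
        (\sum_(0 <= k <oo) gauge d s (U k) <= e%:E)%E].
Proof.
split=> [H0 r e r0 e0|H].
  have : (hausdorff_content d s r E < e%:E)%E.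
    apply: (@le_lt_trans _ _ 0%E); last by rewrite lte_fin.
    by rewrite -H0; apply: ereal_sup_ubound; exists r.
  by move=> /ereal_inf_lt[_ [U [EU Ur] <-] /ltW Ue]; exists U.
apply/eqP; rewrite eq_le hausdorff_measure_ge0 andbT.
apply: ge_ereal_sup => _ [r /= r0 <-]; apply/lee_addgt0Pr => e e0; rewrite add0e.
have [U [EU Ur Ue]] := H r e r0 e0.
by apply: le_trans Ue; apply: ereal_inf_lbound; exists U.
Qed.

Lemma hausdorff_null_sub s E F : E `<=` F ->
  hausdorff_measure d s F = 0%E -> hausdorff_measure d s E = 0%E.
Proof.
move=> EF /hausdorff_nullP F0; apply/hausdorff_nullP => r e r0 e0.
have [U [FU Ur Ue]] := F0 r e r0 e0; exists U; split => //.
exact: subset_trans FU.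
Qed.

Lemma hausdorff_null_bigcup s (E : nat -> set T) :
  (forall n, hausdorff_measure d s (E n) = 0%E) ->
  hausdorff_measure d s (\bigcup_n E n) = 0%E.
Proof.
move=> E0; apply/hausdorff_nullP => r e r0 e0.
have /choice[U HU] n : exists U : nat -> set T,
    [/\ E n `<=` \bigcup_k U k, forall k, (diam d (U k) <= r%:E)%E &
        (\sum_(0 <= k <oo) gauge d s (U k) <= (e / (2 ^ n.+1)%:R)%:E)%E].
  by have /hausdorff_nullP := E0 n; apply => //; rewrite divr_gt0// ltr0n expn_gt0.
(* The bijection [f] from [nat] to pairs enumerates all the covers in one sequence; the weights
   [e / 2 ^ n.+1] sum to at most [e]. *)
have /card_esym/ppcard_eqP[f] := card_nat2.
exists (fun k => U (f k).1 (f k).2); split.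
- move=> x [n _ Enx]; have [/(_ _ Enx)[k _ Ukx] _ _] := HU n.
  by exists (f^-1%FUN (n, k)) => //=; rewrite invK ?inE.
- by move=> k; have [_ + _] := HU (f k).1; exact.
rewrite nneseries_esum; last by move=> *; exact: gauge_ge0.
rewrite (_ : [set x | true] = setT); last by apply/seteqP.
rewrite -(@reindex_esum _ _ _ setT setT f (fun ij => gauge d s (U ij.1 ij.2))); last first.
  by split => [x|x y _ _ /(@inj _ _ _ f)|y _]; [|apply; rewrite inE|exists (f^-1%FUN y); rewrite ?invK ?inE].
rewrite (_ : setT = [set: nat] `*`` (fun=> [set: nat])); last by apply/seteqP; split.
rewrite -(@esum_esum _ _ _ setT (fun=> setT) (fun i j => gauge d s (U i j))); last first.
  by move=> *; exact: gauge_ge0.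
apply: (@le_trans _ _ (\esum_(i in [set: nat]) (e / (2 ^ i.+1)%:R)%:E)%E).
  apply: le_esum => i _; have [_ _] := HU i.
  rewrite nneseries_esum; last by move=> *; exact: gauge_ge0.
  by rewrite (_ : [set x | true] = setT)//; apply/seteqP.
rewrite (_ : setT = [set x : nat | xpredT x]); last by apply/seteqP.
rewrite -(@nneseries_esum _ (fun i => (e / (2 ^ i.+1)%:R)%:E) xpredT); last first.
  by move=> *; rewrite lee_fin divr_ge0// ltW.
exact: (@epsilon_trick0 R e xpredT (ltW e0)).
Qed.

Lemma hausdorff_null_finite s E : 0 <= s ->
  (forall r e, 0 < r -> 0 < e -> exists (c : R) (J : seq (set T)),
    [/\ 0 <= c <= r, forall x, E x -> exists2 U, U \in J & U x,
        forall U, U \in J -> (diam d U <= c%:E)%E & (size J)%:R * c `^ s <= e]) ->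
  hausdorff_measure d s E = 0%E.
Proof.
move=> s0 H; apply/hausdorff_nullP => r e r0 e0.
have [c [J [/andP[c0 cr] EJ Jc Je]]] := H r e r0 e0.
(* The finite list is continued by empty sets, whose gauge is 0 even for [s = 0]. *)
have diamJ i : (diam d (nth set0 J i) <= c%:E)%E.
  have [iJ|iJ] := ltnP i (size J); first by apply: Jc; exact: mem_nth.
  by rewrite nth_default//; apply: diam_le.
exists (nth set0 J); split => [x /EJ[U UJ Ux]|k|].
- by exists (index U J) => //; rewrite nth_index.
- by apply: le_trans (diamJ k) _; rewrite lee_fin.
rewrite (nneseries_split _ (size J)); last by move=> *; exact: gauge_ge0.
rewrite add0n eseries0; last first.
  by move=> i iJ _; rewrite nth_default// gauge_set0.
rewrite adde0; apply: le_trans (_ : _ <= ((size J)%:R * c `^ s)%:E)%E _; last by rewrite lee_fin.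
apply: (@le_trans _ _ (\sum_(0 <= i < size J) (c `^ s)%:E)%E).
  by apply: lee_sum => i _; exact: gauge_le.
by rewrite sumEFin big_const_nat subn0 iter_addr addr0 mulr_natl.
Qed.

Lemma hausdorff_dim_ge0 E : (0 <= hausdorff_dim d E)%E.
Proof. by apply: le_ereal_inf_tmp => _ [s [s0 _] <-]; rewrite lee_fin. Qed.

Lemma hausdorff_dim_le s E : 0 <= s -> hausdorff_measure d s E = 0%E ->
  (hausdorff_dim d E <= s%:E)%E.
Proof. by move=> s0 H; apply: ereal_inf_lbound; exists s. Qed.

Lemma hausdorff_dim_sub E F : E `<=` F -> (hausdorff_dim d E <= hausdorff_dim d F)%E.
Proof.
move=> EF; apply: le_ereal_inf_tmp => _ [s [s0 F0] <-].
by apply: hausdorff_dim_le => //; exact: hausdorff_null_sub F0.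
Qed.

Lemma hausdorff_dim_ge b E :
  (forall s, 0 <= s -> s < b -> hausdorff_measure d s E <> 0%E) ->
  (b%:E <= hausdorff_dim d E)%E.
Proof.
move=> H; apply: le_ereal_inf_tmp => _ [s [s0 E0] <-]; rewrite lee_fin leNgt.
by apply/negP => /(H s s0).
Qed.

(* The mass distribution principle for the image under [g] of Lebesgue outer
   measure on [Y]; no measurability of [g] or of the covering sets is needed. *)
Lemma mass_distribution (g : R -> T) (Y : set R) E s c C :
  0 < c -> 0 <= C -> (0 < lebesgue_measure Y)%E -> (forall y, Y y -> E (g y)) ->
  (forall U, U !=set0 -> (diam d U <= c%:E)%E ->
     (lebesgue_measure (Y `&` g @^-1` U) <= C%:E * gauge d s U)%E) ->
  hausdorff_measure d s E <> 0%E.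
Proof.
move=> c0 C0 Y0 YE H /hausdorff_nullP E0.
(* A finite positive lower bound, since the measure of [Y] may be infinite. *)
have [y y0 yY] : exists2 y, 0 < y & (y%:E <= lebesgue_measure Y)%E.
  case: (lebesgue_measure Y) Y0 => [y||]//; last by exists 1; rewrite ?leey.
  by rewrite lte_fin; exists y.
have e0 : 0 < y / (C + 1) / 2 by rewrite !divr_gt0// ltr_wpDl.
have [U [EU Uc Ue]] := E0 c _ c0 e0.
have : (lebesgue_measure Y <= \sum_(0 <= k <oo) C%:E * gauge d s (U k))%E.
  apply: (@le_trans _ _ (lebesgue_measure (\bigcup_k (Y `&` g @^-1` U k)))).
    by apply: lebesgue_le => x Yx; have [k _ Uk] := EU _ (YE _ Yx); exists k.
  apply: le_trans (lebesgue_bigcup _) _; apply: lee_nneseries => [*|k _]; first exact: lebesgue_ge0.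
  have [->|/set0P Uk0] := eqVneq (U k) set0; last exact: H.
  by rewrite preimage_set0 setI0 measure0 gauge_set0 mule0.
rewrite nneseriesZl//; last by move=> *; exact: gauge_ge0.
move/(le_trans yY) => yC.
have : (y%:E <= C%:E * (y / (C + 1) / 2)%:E)%E.
  by apply: le_trans yC _; apply: lee_pmul => //; apply: nneseries_ge0 => *; exact: gauge_ge0.
rewrite -EFinM lee_fin leNgt => /negP; apply.
have C1 : 0 < C + 1 by rewrite ltr_wpDl.
have -> : C * (y / (C + 1) / 2) = y * (C / (C + 1) / 2).
  by field; lra.
rewrite -[ltRHS]mulr1 ltr_pM2l// -mulrA -invfM ltr_pdivrMr ?mul1r//; nra.
Qed.

End Hausdorff.

(** * Words and transition matrices *)

Section Words.
Local Open Scope nat_scope.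

(* The integer with (possibly redundant) binary digits [g a], [a] running
   through [s], most significant first. *)
Definition wval (A : Type) (g : A -> nat) (s : seq A) : nat :=
  foldl (fun x a => 2 * x + g a) 0 s.

Lemma wval_cat (A : Type) (g : A -> nat) s t :
  wval g (s ++ t) = 2 ^ size t * wval g s + wval g t.
Proof.
rewrite /wval foldl_cat; move: (foldl _ 0 s) => x.
elim/last_ind: t => [|t a IH]; first by rewrite expn0 mul1n addn0.
by rewrite -!cats1 !foldl_cat /= IH size_cat addn1 expnS; lia.
Qed.

Lemma wval_rcons (A : Type) (g : A -> nat) s a :
  wval g (rcons s a) = 2 * wval g s + g a.
Proof. by rewrite -cats1 wval_cat /= /wval /=; lia. Qed.

Lemma wval_cons (A : Type) (g : A -> nat) a s :
  wval g (a :: s) = 2 ^ size s * g a + wval g s.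
Proof. by rewrite -cat1s wval_cat /wval /=; lia. Qed.

Lemma wval_lt (A : Type) (g : A -> nat) s :
  (forall a, g a < 2) -> wval g s < 2 ^ size s.
Proof.
move=> g2; elim/last_ind: s => [|s a IH]; first by rewrite /wval.
by rewrite wval_rcons size_rcons expnS; have := g2 a; lia.
Qed.

Lemma wval_nseq (A : Type) (g : A -> nat) n a : g a = 0 -> wval g (nseq n a) = 0.
Proof. by move=> g0; elim: n => //= n IH; rewrite wval_cons g0 IH muln0. Qed.

Lemma wval_inj (A : Type) (g : A -> nat) s t :
  injective g -> (forall a, g a < 2) -> size s = size t ->
  wval g s = wval g t -> s = t.
Proof.
move=> gI g2; elim/last_ind: s t => [|s a IH] t.
  by case: t.
elim/last_ind: t => [|t b _]; rewrite !size_rcons// => -[st].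
rewrite !wval_rcons => E; have := g2 a; have := g2 b => b2 a2.
have [Es /gI <-] : wval g s = wval g t /\ g a = g b by lia.
by rewrite (IH _ st Es).
Qed.

Definition words (A : finType) n : seq (seq A) := map val (enum {: n.-tuple A}).

Lemma mem_words (A : finType) n s : (s \in words A n) = (size s == n).
Proof.
apply/mapP/idP => [[t _ ->]|/eqP sn]; first by rewrite size_tuple.
by exists (Tuple (introT eqP sn)) => //; rewrite mem_enum.
Qed.

Lemma words_uniq (A : finType) n : uniq (words A n).
Proof. by rewrite map_inj_uniq ?enum_uniq//; exact: val_inj. Qed.

Lemma size_words (A : finType) n : size (words A n) = #|A| ^ n.
Proof. by rewrite size_map -cardE card_tuple. Qed.

Lemma words0 (A : finType) : words A 0 = [:: [::]].
Proof.
have := words_uniq A 0; have := size_words A 0; rewrite expn0.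
have := mem_words 0 ([::] : seq A); case: (words A 0) => // s [|//].
by rewrite inE eqxx => /eqP<-.
Qed.

Lemma perm_wordsS (A : finType) n :
  perm_eq (words A n.+1) [seq rcons s a | s <- words A n, a <- enum A].
Proof.
apply: uniq_perm; first exact: words_uniq.
  apply: allpairs_uniq; [exact: words_uniq|exact: enum_uniq|].
  by move=> [s a] [t b] _ _ /= /rcons_inj[-> ->].
move=> s; rewrite mem_words; apply/idP/allpairsP => [|[[t a] /= []]].
  elim/last_ind: s => [//|s a _]; rewrite size_rcons => /eqP[sn].
  by exists (s, a); rewrite /= mem_words sn mem_enum.
by rewrite mem_words => /eqP tn _ ->; rewrite size_rcons tn.
Qed.

Lemma big_tuple_words (V : nmodType) (A : finType) n (f : seq A -> V) :
  (\sum_(t : n.-tuple A) f t = \sum_(s <- words A n) f s)%R.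
Proof. by rewrite /words big_map big_enum. Qed.

Definition bit (b : 'I_2) : nat := b.

Lemma bit_lt b : bit b < 2. Proof. exact: ltn_ord. Qed.

Lemma bit_inj : injective bit. Proof. exact: val_inj. Qed.

Lemma bit_word n x : x < 2 ^ n -> exists2 s, size s = n & wval bit s = x.
Proof.
elim: n x => [|n IH] x; first by rewrite expn0; case: x => // _; exists [::].
rewrite expnS => xn; have [|s sn sx] := IH (x %/ 2).
  by rewrite ltn_divLR// mulnC.
exists (rcons s (inord (x %% 2))); first by rewrite size_rcons sn.
rewrite wval_rcons sx /bit inordK ?ltn_mod//.
by rewrite [RHS](divn_eq x 2); lia.
Qed.

End Words.

(** * Entries of matrix products as counts of digit words *)

Section Matrices.
Context {R : realType}.
Variables p q : nat.
Hypotheses (p_gt0 : (0 < p)%N) (q_gt0 : (0 < q)%N).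
Local Notation A := (@Amx R p q).

(* In the coordinate [q * (1 - t)] the interval [itvI j] becomes [[j - 1, j]]
   and [ifs_map k] becomes the map [x |-> (x + digit k) / 2]. *)
Definition digit (k : 'I_3) : nat :=
  match val k with 0%N => q | 1%N => 0%N | _ => (p + q)%N end.

Lemma itvcc_inj (a b c e : R) : a <= b -> c <= e ->
  `[a, b]%classic = `[c, e]%classic -> a = c.
Proof.
move=> ab ce E; apply/eqP; rewrite eq_le; apply/andP; split.
  have : `[c, e]%classic c by rewrite /= in_itv /= lexx.
  by rewrite -E /= in_itv /= => /andP[].
have : `[a, b]%classic a by rewrite /= in_itv /= lexx.
by rewrite E /= in_itv /= => /andP[].
Qed.

Let q_neq0 : q%:R != 0 :> R. Proof. by rewrite pnatr_eq0 -lt0n. Qed.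

Lemma ifs_map_itv k (a b : R) :
  ifs_map p q k @` `[a, b]%classic = `[ifs_map p q k a, ifs_map p q k b]%classic.
Proof.
apply/seteqP; split => [_ [x + <-]|x]; rewrite /= !in_itv /=.
  by rewrite /ifs_map; case: (val k) => [|[|?]] /andP[ax xb]; apply/andP; split; lra.
set f := ifs_map p q k => /andP[ax xb].
suff [y fy] : exists y, f y = x.
  exists y => //; rewrite in_itv /=; move: ax xb; rewrite -fy /f /ifs_map.
  by case: (val k) => [|[|?]] ? ?; apply/andP; split; lra.
rewrite /f /ifs_map; case: (val k) => [|[|?]].
- by exists (2 * x); field.
- by exists (2 * x - 1); field.
- by exists (2 * x + p%:R / q%:R); field.
Qed.

(** In the coordinate [q * (1 - t)] the image of the interval of index [j.+1] is
    [[(j + digit k) / 2, (j + digit k + 1) / 2]] and the half interval is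
    [[(2 i + n) / 2, (2 i + n + 1) / 2]]. Both have length 1/2, so they coincide as soon as one end
    does, which is an equation between integers. *)
Lemma AmxE n i j :
  A n i j = (\sum_(k : 'I_3) (j + digit k == 2 * i + n)%N)%:R.
Proof.
rewrite mxE; congr (_%:R); rewrite -sum1_card [LHS]big_mkcond; apply: eq_bigr => k _ /=.
rewrite !inE; set b := `[< _ >].
suff -> : b = (j + digit k == 2 * i + n)%N by case: eqP.
rewrite {}/b; set a := 1 - j.+1%:R / q%:R : R; set a' := 1 - (j.+1%:R - 1) / q%:R : R.
have q0 : 0 < q%:R :> R by rewrite ltr0n.
have aa' : a <= a' by rewrite /a /a' lerD2l lerN2 ler_pM2r ?invr_gt0//; lra.
set c : R := 1 - (2 * i + 1 + n)%:R / (2 * q%:R).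
set c' : R := 1 - (2 * i + n)%:R / (2 * q%:R).
have cc' : c <= c'.
  by rewrite /c /c' lerD2l lerN2 ler_pM2r ?invr_gt0 ?mulr_gt0// ler_nat; lia.
have -> : itvI q j.+1 = `[a, a']%classic by [].
have -> : halfI q n i.+1 = `[c, c']%classic :> set R.
  have nE : nat_of_ord n = 0%N \/ nat_of_ord n = 1%N.
    by case: (nat_of_ord n) (ltn_ord n) => [|[|//]]; [left|right].
  rewrite /halfI /c /c'; case: nE => nE; rewrite [val n]nE nE ?eqxx ?[(1 == 0)%N]/(false) ?(natrD _ (_ + 1)%N) !(natrD _ (2 * i)%N) !natrM -!(@natr1 _ i).
    have -> : 1 - (i%:R + 1 - 1) / q%:R = 1 - (2 * i%:R + 0) / (2 * q%:R) :> R by field.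
    by have -> : 2 * (i%:R + 1) - 1 = 2 * i%:R + 1 + 0 :> R by ring.
  have -> : 1 - (i%:R + 1) / q%:R = 1 - (2 * i%:R + 1 + 1) / (2 * q%:R) :> R by field.
  by have -> : 2 * (i%:R + 1) - 1 = 2 * i%:R + 1 :> R by ring.
rewrite ifs_map_itv; set f := ifs_map p q k.
have fE x : f x = x / 2 + f 0.
  by rewrite /f /ifs_map; case: (val k) => [|[|?]]; field.
have ff : f a <= f a' by rewrite (fE a) (fE a'); lra.
have fa : f a = 1 - (j + digit k + 1)%:R / (2 * q%:R).
  rewrite /f /ifs_map /digit /a -natr1; case: (val k) => [|[|?]]; rewrite ?natrD;
  by field.
have fa' : f a' = f a + 1 / (2 * q%:R).
  by rewrite (fE a) (fE a') /a /a'; field.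
have c'E : c' = c + 1 / (2 * q%:R).
  by rewrite /c /c' !natrD; field.
apply/asboolP/eqP => [/(itvcc_inj ff cc')|E]; last first.
  by rewrite fa' c'E; suff -> : f a = c by []; rewrite fa E /c; do ?congr (_ - _ / _ ); congr (_%:R); lia.
rewrite fa /c => /(addrI 1)/oppr_inj/(mulIf _) E.
have : (j + digit k + 1)%:R == (2 * i + 1 + n)%:R :> R.
  by apply/eqP/E; rewrite invr_neq0// mulf_neq0.
by rewrite eqr_nat => /eqP; lia.
Qed.

Definition wmx (s : seq 'I_2) : 'M[R]_(p + q) := \big[mulmx/1%:M]_(b <- s) A b.

Lemma word_mxE n (xi : n.-tuple 'I_2) : @word_mx R p q n xi = wmx xi.
Proof. by rewrite /word_mx /wmx big_tuple. Qed.

Lemma wmx_cat s t : wmx (s ++ t) = wmx s *m wmx t.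
Proof.
rewrite /wmx; elim: s => [|b s IH]; first by rewrite big_nil mul1mx.
by rewrite /= !big_cons IH mulmxA.
Qed.

Lemma wmx1 b : wmx [:: b] = A b.
Proof. by rewrite /wmx big_cons big_nil mulmx1. Qed.

Lemma wmxE s i j : wmx s i j =
  (count (fun c => wval digit c + j == 2 ^ size s * i + wval bit s)%N
     (words 'I_3 (size s)))%:R.
Proof.
elim/last_ind: s j => [|s b IH] j.
  rewrite /wmx big_nil mxE words0 /= /wval /= mul1n !addn0 add0n eq_sym.
  by rewrite -val_eqE.
rewrite -cats1 wmx_cat wmx1 cats1 mxE size_rcons wval_rcons.
rewrite (permP (perm_wordsS _ _)).
set M := (2 ^ size s * i + wval bit s)%N.
have -> : (2 ^ (size s).+1 * i + (2 * wval bit s + bit b) = 2 * M + bit b)%N.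
  by rewrite expnS /M; lia.
under eq_bigr do rewrite IH AmxE -natrM.
rewrite -natr_sum; congr (_%:R).
rewrite -[RHS]sum1_count [RHS]big_mkcond [RHS]big_allpairs_dep.
under eq_bigr => k _.
  rewrite -sum1_count big_mkcond big_distrl /=.
  over.
rewrite exchange_big; apply: eq_bigr => c _ /=.
under eq_bigr do rewrite big_distrr /=.
rewrite exchange_big [RHS]big_enum /=; apply: eq_big => // a _.
rewrite wval_rcons; case: eqP => E; last first.
  apply: big1 => k _; case: eqP => // E1; case: eqP => //= E2.
  by case: E; rewrite -/M in E1; rewrite -E1 /bit; lia.
(* For given [c] the intermediate state can only be [M - wval digit c]; the equation for the last
   letter shows that it is a valid state. *)
have kN : (M - wval digit c < p + q)%N.
  have := ltn_ord j; have := bit_lt b; rewrite /digit in E *.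
  by case: (val a) E => [|[|?]]; lia.
have Mc : (wval digit c <= M)%N by have := bit_lt b; lia.
rewrite (bigD1 (Ordinal kN)) //= big1 => [|k].
  rewrite subnKC// eqxx mul1n addn0.
  by case: eqP => //; rewrite /bit in E *; lia.
rewrite -val_eqE /= => /eqP kM; case: eqP => // E1.
by rewrite -/M in E1; lia.
Qed.

End Matrices.

(** * Row sums, norms, and loops at state 0 *)

Section Counting.
Context {R : realType}.
Variables p q : nat.
Hypotheses (p_gt0 : (0 < p)%N) (q_gt0 : (0 < q)%N).
Local Notation N := (p + q)%N.
Local Notation val3 := (wval (digit p q)).
Local Notation val2 := (wval bit).

Definition zero2 : 'I_2 := ord0.
Definition one2 : 'I_2 := lift ord0 ord0.
(* [digit p q one3 = 0] *)
Definition one3 : 'I_3 := lift ord0 ord0.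

(* Counts the words [c] of length [n] whose interval [[val3 c, val3 c + N]]
   contains [[x, x + 1]]. *)
Definition tot n x : nat :=
  count (fun c => val3 c <= x < val3 c + N)%N (words 'I_3 n).

(** By [wmxE] these words are counted by the entry [(0, 0)] of [wmx s]. *)
Definition loops (s : seq 'I_2) : seq (seq 'I_3) :=
  [seq c <- words 'I_3 (size s) | val3 c == val2 s].

Definition wnorm (s : seq 'I_2) : R := \sum_i \sum_j wmx p q s i j.

(** The digits 0 and [N] suffice: they turn a window [[S, S + N[] into [[2 S, 2 S + N[] and [[2 S +
    N, 2 S + 2 N[], which tile its double. *)
Lemma gap m Y : (Y < N * 2 ^ m)%N ->
  exists2 c, size c = m & (val3 c <= Y < val3 c + N)%N.
Proof.
elim: m Y => [|m IH] Y; first by rewrite expn0 muln1 => YN; exists [::].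
rewrite expnS => YN; have [|c cm /andP[c1 c2]] := IH (Y %/ 2)%N.
  by rewrite ltn_divLR// -mulnA (mulnC _ 2%N).
have Y2 := divn_eq Y 2; have Y3 : (Y %% 2 < 2)%N by rewrite ltn_mod.
have [h|h] := ltnP Y (2 * val3 c + N).
  exists (rcons c one3); rewrite ?size_rcons ?cm// wval_rcons (_ : digit p q one3 = 0%N)//.
  by apply/andP; split; lia.
exists (rcons c ord_max); rewrite ?size_rcons ?cm// wval_rcons (_ : digit p q ord_max = N)%N//.
by apply/andP; split; lia.
Qed.

Lemma sum_eq_lt (S x : nat) : (\sum_(j < N) (S + j == x)%N = (S <= x < S + N))%N.
Proof.
case: (boolP (S <= x < S + N)%N) => [/andP[Sx xS]|H].
  have xN : (x - S < N)%N by lia.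
  rewrite (bigD1 (Ordinal xN)) //= subnKC// eqxx big1 ?addn0// => j.
  by rewrite -val_eqE /= => /eqP jx; case: eqP => //; lia.
apply: big1 => j _; case: eqP => // E; case/negP: H; apply/andP.
by have := ltn_ord j; lia.
Qed.

Lemma wmx_rowE s i :
  \sum_j wmx p q s i j = (tot (size s) (2 ^ size s * i + val2 s))%:R :> R.
Proof.
under eq_bigr do rewrite wmxE//.
rewrite -natr_sum; congr (_%:R); rewrite /tot -[RHS]sum1_count [RHS]big_mkcond /=.
under eq_bigr do rewrite -sum1_count big_mkcond /=.
rewrite exchange_big /=; apply: eq_bigr => c _.
rewrite -[RHS]/(nat_of_bool _) -sum_eq_lt; apply: eq_bigr => j _.
by case: eqP.
Qed.

Lemma wnormE s : wnorm s = \sum_(i < N) (tot (size s) (2 ^ size s * i + val2 s))%:R.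
Proof. by apply: eq_bigr => i _; exact: wmx_rowE. Qed.

Lemma word_normE n (xi : n.-tuple 'I_2) : word_norm p q xi = wnorm xi.
Proof.
rewrite /word_norm word_mxE// !mxE /wnorm exchange_big /=; apply: eq_bigr => j _.
rewrite !mxE mulr1; apply: eq_bigr => i _.
by rewrite !mxE mul1r.
Qed.

Lemma wmx_ge0 s i j : 0 <= wmx p q s i j :> R.
Proof. by rewrite wmxE. Qed.

Lemma tot_le_wnorm s i : (i < N)%N ->
  (tot (size s) (2 ^ size s * i + val2 s))%:R <= wnorm s.
Proof.
move=> iN; rewrite wnormE (bigD1 (Ordinal iN)) //= lerDl sumr_ge0// => j _.
Qed.

Lemma tot_out n x : (N * 2 ^ n <= x)%N -> tot n x = 0%N.
Proof.
move=> xN; apply/eqP; rewrite -leqn0 leqNgt -has_count; apply/hasPn => c.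
rewrite mem_words => /eqP cn; apply/negP => /andP[_].
suff : (val3 c + N <= N * 2 ^ n)%N by lia.
elim/last_ind: c n cn {xN} => [|c a IH] n <-; first by rewrite muln1.
rewrite size_rcons wval_rcons expnS.
by have := IH _ erefl; rewrite /digit; case: (val a) => [|[|?]]; lia.
Qed.

Lemma tot_le n x : (tot n x <= 3 ^ n)%N.
Proof. by rewrite (leq_trans (count_size _ _))// size_words card_ord. Qed.

Lemma wnorm_ge1 s : 1 <= wnorm s.
Proof.
have N0 : (0 < N)%N by rewrite addn_gt0 p_gt0.
apply: le_trans (tot_le_wnorm s N0); rewrite ler1n -has_count.
rewrite muln0 add0n; have [|c cs h] := @gap (size s) (val2 s).
  by have := wval_lt s bit_lt; have := leq_pmull (2 ^ size s) N0; lia.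
by apply/hasP; exists c => //; rewrite mem_words cs.
Qed.

Lemma wnorm_gt0 s : 0 < wnorm s.
Proof. exact: lt_le_trans (wnorm_ge1 s). Qed.

Lemma wnorm_le s : wnorm s <= N%:R * 3 ^+ size s.
Proof.
rewrite wnormE; apply: (@le_trans _ _ (\sum_(i < N) 3 ^+ size s)).
  by apply: ler_sum => i _; rewrite -natrX ler_nat tot_le.
by rewrite big_const_ord iter_addr addr0 mulr_natl.
Qed.

Lemma wnorm_cat s t : wnorm (s ++ t) <= wnorm s * wnorm t.
Proof.
rewrite /wnorm mulr_suml; apply: ler_sum => i _.
rewrite mulr_suml; under eq_bigr do rewrite wmx_cat mxE.
rewrite exchange_big /=; apply: ler_sum => k _.
rewrite -mulr_sumr; apply: ler_wpM2l; first exact: wmx_ge0.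
rewrite [leRHS](bigD1 k) //= lerDl.
by apply: sumr_ge0 => ? _; apply: sumr_ge0 => ? _; exact: wmx_ge0.
Qed.

Lemma mem_loops s c : (c \in loops s) = (size c == size s) && (val3 c == val2 s).
Proof. by rewrite mem_filter mem_words andbC. Qed.

Lemma loops_uniq s : uniq (loops s).
Proof. by rewrite filter_uniq// words_uniq. Qed.

Lemma loops_cat s t : (size (loops s) * size (loops t) <= size (loops (s ++ t)))%N.
Proof.
rewrite -(size_allpairs cat); apply: uniq_leq_size.
  apply: allpairs_uniq; try exact: loops_uniq.
  move=> [a b] [a' b'] /allpairsP[[x y] /= [+ + [-> ->]]] /allpairsP[[z t'] /= [+ + [-> ->]]].
  rewrite !mem_loops => /andP[/eqP sx _] _ /andP[/eqP sz _] _.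
  by move/eqP; rewrite eqseq_cat ?sx ?sz// => /andP[/eqP-> /eqP->].
move=> _ /allpairsP[[x y] /= [+ + ->]]; rewrite !mem_loops.
move=> /andP[/eqP sx /eqP wx] /andP[/eqP sy /eqP wy].
by rewrite !size_cat !wval_cat sx sy wx wy !eqxx.
Qed.

Lemma loops_zeros n : (0 < size (loops (nseq n zero2)))%N.
Proof.
have : nseq n one3 \in loops (nseq n zero2).
  by rewrite mem_loops !size_nseq !wval_nseq// eqxx.
by case: loops.
Qed.

(** Length of the connecting words: since [N < 2 ^ mixlen], this many binary digits lead from state
    0 to any state and from any state back to 0. *)
Definition mixlen : nat := (trunc_log 2 N).+1.

Lemma mixlen_lt : (N < 2 ^ mixlen)%N.
Proof. by rewrite /mixlen trunc_log_ltn. Qed.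

(** Together with the word of digits 0 this makes the entry [(0, i)] of [wmx u] positive. *)
Lemma word_from0 i : (i < N)%N ->
  exists u, [/\ size u = mixlen & val2 u = i].
Proof.
by move=> iN; have [u su iu] := bit_word (ltn_trans iN mixlen_lt); exists u.
Qed.

(** This makes the entry [(j, 0)] of [wmx v] positive. The window around [2 ^ r * j + N - 1] starts
    between [2 ^ r * j] and [2 ^ r * j + N - 1], and [N < 2 ^ r] makes the excess a binary word of
    length [r]. *)
Lemma word_to0 j : (j < N)%N -> exists v c,
  [/\ size v = mixlen, size c = mixlen & val3 c = (2 ^ mixlen * j + val2 v)%N].
Proof.
move=> jN; have N1 := mixlen_lt; set r := mixlen in N1 *.
have [|c cr /andP[h1 h2]] := @gap r (2 ^ r * j + N - 1)%N.
  by have : (2 ^ r * j.+1 <= N * 2 ^ r)%N; [rewrite mulnC leq_mul2r jN orbT|rewrite mulnS; lia].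
have [|v vr vE] := @bit_word r (val3 c - 2 ^ r * j)%N; first by lia.
by exists v, c; split => //; rewrite vE; lia.
Qed.

(** By averaging, some entry [(i, j)] is at least the norm divided by [N ^ 2]. With [u] leading from
    0 to [i] and [v] from [j] to 0, the words counted by this entry extend injectively to loops. *)
Lemma loops_connect s : exists u v, [/\ size u = mixlen, size v = mixlen &
  wnorm s <= N%:R ^+ 2 * (size (loops (u ++ s ++ v)))%:R].
Proof.
have [i [j ij]] : exists i j, wnorm s <= N%:R ^+ 2 * wmx p q s i j.
  apply: contrapT => H.
  have lt_entry i j : N%:R ^+ 2 * wmx p q s i j < wnorm s.
    by rewrite ltNge; apply/negP => h; apply: H; exists i, j.
  have N0 : (0 < N)%N by rewrite addn_gt0 p_gt0.
  have : \sum_(i < N) \sum_(j < N) N%:R ^+ 2 * wmx p q s i j <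
      \sum_(i < N) \sum_(j < N) wnorm s.
    apply: ltr_sum; first by apply/hasP; exists (Ordinal N0); rewrite ?mem_index_enum.
    move=> i _; apply: ltr_sum => //.
    by apply/hasP; exists (Ordinal N0); rewrite ?mem_index_enum.
  under eq_bigr do rewrite -mulr_sumr.
  rewrite -mulr_sumr -/(wnorm s) !big_const_ord !iter_addr !addr0 -mulrnA.
  by rewrite -[ltRHS]mulr_natl natrM expr2 ltxx.
have [u [su uE]] := word_from0 (ltn_ord i).
have [v [c [sv sc cE]]] := word_to0 (ltn_ord j).
exists u, v; split => //; apply: le_trans ij _; apply: ler_wpM2l; first exact: exprn_ge0.
rewrite wmxE// ler_nat -size_filter; set L := seq.filter _ _.
rewrite -(size_map (fun x => nseq mixlen one3 ++ x ++ c)); apply: uniq_leq_size.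
  rewrite map_inj_in_uniq; first by rewrite filter_uniq ?words_uniq.
  move=> x y; rewrite !mem_filter !mem_words => /andP[_ /eqP sx] /andP[_ /eqP sy].
  move/eqP; rewrite eqseq_cat// eqxx /= eqseq_cat ?sx ?sy//.
  by move=> /andP[/eqP].
move=> _ /mapP[x + ->]; rewrite mem_filter mem_words => /andP[/eqP Ex /eqP sx].
rewrite mem_loops !size_cat size_nseq su sv sc sx eqxx andTb.
rewrite !wval_cat wval_nseq// muln0 add0n cE !size_cat sv sc uE expnD.
by move: Ex; set a := (2 ^ size s)%N; set b := (2 ^ mixlen)%N => Ex; apply/eqP; nia.
Qed.

(** The word 01 leads from state 0 to state 1, which exists because [N] is at least 2, and [v] leads
    back. *)
Lemma loops_pad : exists2 v, size v = mixlen &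
  (0 < size (loops ([:: zero2; one2] ++ v)))%N.
Proof.
have N1 : (1 < N)%N by lia.
have [v [c [sv sc cE]]] := word_to0 N1.
exists v => //.
have : [:: one3; one3] ++ c \in loops ([:: zero2; one2] ++ v).
  rewrite mem_loops !size_cat sv sc eqxx andTb !wval_cat cE sv sc.
  rewrite (_ : val3 [:: one3; one3] = 0%N)// (_ : val2 [:: zero2; one2] = 1%N)//.
  by apply/eqP; lia.
by case: loops.
Qed.

End Counting.

(** * Pressure *)

Section Limits.
Context {R : realType}.

Lemma exists_natr_gt (x : R) : exists n : nat, x < n%:R.
Proof. by exists (Num.trunc x).+1; exact: truncnS_gt. Qed.

(** Fekete's lemma. The limit is the infimum of [u n / n], whence a bound valid for every positive
    [n] and not only asymptotically. *)
Lemma subadditive_cvg (u : nat -> R) :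
  (forall n, 0 <= u n) -> (forall n m, u (n + m)%N <= u n + u m) ->
  exists2 L, (forall n, (0 < n)%N -> n%:R * L <= u n) &
    n%:R^-1 * u n @[n --> \oo] --> L.
Proof.
move=> u0 uD; pose E := [set n%:R^-1 * u n | n in [set n | (0 < n)%N]].
have lbE : has_lbound E by exists 0 => _ [n n0 <-]; rewrite mulr_ge0// invr_ge0.
have E0 : E !=set0 by exists (1%:R^-1 * u 1%N), 1%N.
exists (inf E) => [n n0|].
  rewrite -ler_pdivlMl ?ltr0n//; apply: ge_inf => //; by exists n.
apply/cvgrPdist_lt => e e0.
have e2 : 0 < e / 2 by rewrite divr_gt0.
have [_ [m m0 <-]] := inf_adherent e2 (conj E0 lbE).
set L := inf E => mL.
pose C := \sum_(r < m) u r.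
have uC k r : (r < m)%N -> u (k * m + r)%N <= k%:R * u m + C.
  move=> rm; elim: k => [|k IH].
    rewrite mul0n add0n mul0r add0r /C (bigD1 (Ordinal rm)) //= lerDl.
    by apply: sumr_ge0 => *.
  rewrite mulSn -addnA; apply: le_trans (uD _ _) _.
  by rewrite -natr1 mulrDl mul1r; lra.
have [n0 Cn0] := exists_natr_gt (C / (e / 2)).
exists n0.+1 => // n /= n0n.
have n_gt0 : 0 < n%:R :> R by rewrite ltr0n; lia.
have Ln : n%:R * L <= u n.
  rewrite -ler_pdivlMl//; apply: ge_inf => //; exists n => //=; lia.
have un : u n <= n%:R * (m%:R^-1 * u m) + C.
  rewrite {1}(divn_eq n m); apply: le_trans (uC _ _ _) _; first by rewrite ltn_mod.
  rewrite lerD2r mulrA ler_wpM2r// ler_pdivlMr ?ltr0n// -natrM ler_nat.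
  exact: leq_trunc_div.
have Cn : C < n%:R * (e / 2).
  rewrite -ltr_pdivrMr//; apply: lt_le_trans Cn0 _; rewrite ler_nat; lia.
have h1 : L <= n%:R^-1 * u n by rewrite ler_pdivlMl.
have h2 : n%:R^-1 * u n < L + e.
  rewrite ltr_pdivrMl//; nra.
by rewrite distrC ger0_norm ?subr_ge0//; lra.
Qed.

(** The limit is the infimum over [t > 0]. This turns [bmax], which is defined by a limit, into a
    lower bound for the pressure at each [t]. *)
Lemma lim_nonincreasing_pinfty (f : R -> R) :
  (forall t, 0 < t -> 0 <= f t) ->
  (forall s t, 0 < s -> s <= t -> f t <= f s) ->
  forall t, 0 < t -> lim (f t @[t --> +oo]) <= f t.
Proof.
move=> f0 fle; pose E := [set f t | t in [set t | 0 < t]].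
have lbE : has_lbound E by exists 0 => _ [n n0 <-]; exact: f0.
have E0 : E !=set0 by exists (f 1), 1 => //=.
have cv : f t @[t --> +oo] --> inf E; last first.
  move=> t t0; rewrite (cvg_lim _ cv)//.
  by apply: ge_inf => //; exists t.
apply/cvgrPdist_lt => e e0.
have [_ [m m0 <-] mL] := inf_adherent e0 (conj E0 lbE).
exists m; split; first exact: num_real.
move=> t mt; have h1 := fle m t m0 (ltW mt).
have h2 : inf E <= f t by apply: ge_inf => //; exists t => //=; exact: lt_trans mt.
by rewrite distrC ger0_norm ?subr_ge0//; lra.
Qed.

(** With [S] the sum, each [y i ^ r] equals [y i * y i ^ (r - 1)], which is at most
    [y i * S ^ (r - 1)]. *)
Lemma sum_powR_le (I : eqType) (J : seq I) (y : I -> R) (r : R) :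
  (forall i, 0 < y i) -> 1 <= r ->
  \sum_(i <- J) y i `^ r <= (\sum_(i <- J) y i) `^ r.
Proof.
move=> y0 r1; case: J => [|i0 J0]; first by rewrite !big_nil powR_ge0.
set J := i0 :: J0; set S := \sum_(i <- J) y i.
have S0 : 0 < S.
  by rewrite /S big_cons ltr_wpDr ?y0// sumr_ge0// => i _; exact: ltW.
have yr (x : R) : 0 < x -> x `^ r = x * x `^ (r - 1).
  move=> x0; rewrite -{2}(powRr1 (ltW x0)) -powRD; first by congr (_ `^ _); lra.
  by apply/implyP => _; rewrite gt_eqF.
rewrite (yr _ S0) {1}/S mulr_suml big_seq [leRHS]big_seq; apply: ler_sum => i iJ.
rewrite yr//; apply: ler_wpM2l; first exact: ltW.
apply: ge0_ler_powR; rewrite ?nnegrE ?subr_ge0//; try exact: ltW.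
rewrite /S (perm_big _ (perm_to_rem iJ)) big_cons lerDl.
by apply: sumr_ge0 => j _; exact: ltW.
Qed.

End Limits.

Section Pressure.
Context {R : realType}.
Variables p q : nat.
Hypotheses (p_gt0 : (0 < p)%N) (q_gt0 : (0 < q)%N).
Local Notation N := (p + q)%N.
Local Notation wn := (@wnorm R p q).
Local Notation P := (@pressure R p q).

Definition psum n (t : R) : R := \sum_(s <- words 'I_2 n) wn s `^ t.

Lemma psum_ge n t : 0 <= t -> 2 ^+ n <= psum n t.
Proof.
move=> t0; rewrite /psum.
apply: (@le_trans _ _ (\sum_(s <- words 'I_2 n) 1)).
  by rewrite big_const_seq count_predT size_words card_ord iter_addr addr0 natrX.
apply: ler_sum => s _; rewrite -(powRr0 (wn s)); apply: ler_powR => //.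
exact: wnorm_ge1.
Qed.

Lemma psum_gt0 n t : 0 <= t -> 0 < psum n t.
Proof. by move=> t0; apply: lt_le_trans (psum_ge n t0); rewrite exprn_gt0. Qed.

Lemma perm_wordsD (A : finType) n m :
  perm_eq (words A (n + m)) [seq s ++ t | s <- words A n, t <- words A m].
Proof.
apply: uniq_perm; first exact: words_uniq.
  apply: allpairs_uniq; try exact: words_uniq.
  move=> [a b] [a' b'] /allpairsP[[x y] /= [+ + [-> ->]]] /allpairsP[[z t'] /= [+ + [-> ->]]].
  rewrite !mem_words => /eqP sx _ /eqP sz _.
  by move/eqP; rewrite eqseq_cat ?sx ?sz// => /andP[/eqP-> /eqP->].
move=> s; rewrite mem_words; apply/idP/allpairsP => [/eqP sn|[[t a] /= []]].
  exists (take n s, drop n s); rewrite /= !mem_words cat_take_drop size_drop.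
  by rewrite size_takel ?sn ?leq_addr// addKn !eqxx.
by rewrite !mem_words => /eqP tn /eqP an ->; rewrite size_cat tn an.
Qed.

Lemma psumD n m t : 0 <= t -> psum (n + m) t <= psum n t * psum m t.
Proof.
move=> t0; rewrite /psum (perm_big _ (perm_wordsD _ n m)) big_allpairs_dep mulr_suml.
apply: ler_sum => s _; rewrite mulr_sumr; apply: ler_sum => u _.
have w0 x : 0 <= wn x by apply: ltW; exact: wnorm_gt0.
rewrite -powRM//; apply: ge0_ler_powR; rewrite ?nnegrE ?mulr_ge0//.
exact: wnorm_cat.
Qed.

Lemma pressure_cvg t : 0 <= t ->
  (forall n, (0 < n)%N -> n%:R * P t <= ln (psum n t)) /\
  n%:R^-1 * ln (psum n t) @[n --> \oo] --> P t.
Proof.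
move=> t0; pose u n := ln (psum n t).
have [||L uL cL] := @subadditive_cvg R u.
- move=> n; rewrite ln_ge0//; apply: le_trans (psum_ge n t0).
  by rewrite exprn_ege1// ler1n.
- by move=> n m; rewrite /u -lnM ?posrE ?psum_gt0// ler_ln ?posrE ?mulr_gt0 ?psum_gt0// psumD.
suff -> : P t = L by split.
rewrite /pressure; under eq_fun => n.
  under eq_bigr do rewrite word_normE//.
  rewrite (big_tuple_words n (fun s => wn s `^ t)).
  over.
exact: cvg_lim.
Qed.

Lemma pressure_le_psum n t : 0 <= t -> (0 < n)%N -> n%:R * P t <= ln (psum n t).
Proof. by move=> /pressure_cvg[+ _]; apply. Qed.

Lemma psum_le_pressure t e : 0 <= t -> 0 < e -> exists M, forall n, (M <= n)%N ->
  ln (psum n t) <= n%:R * (P t + e).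
Proof.
move=> /pressure_cvg[_ /cvgrPdist_lt H] e0; have [M _ HM] := H e e0.
exists M.+1 => n nM; have := HM n (ltnW nM).
rewrite distrC ltr_distl => /andP[_ /ltW].
by rewrite ler_pdivrMl// ltr0n; lia.
Qed.

Lemma pressure_ge_ln2 t : 0 <= t -> ln 2 <= P t.
Proof.
move=> t0; apply/ler_addgt0Pr => e e0; have [M HM] := psum_le_pressure t0 e0.
have n0 : 0 < M.+1%:R :> R by [].
rewrite -(ler_pM2l n0); apply: le_trans (HM _ (leqnSn M)).
by rewrite mulr_natl -lnXn// ler_ln ?posrE ?psum_gt0 ?exprn_gt0// psum_ge.
Qed.

(** Exponential rate of the norms: for words of length [n >= 1] they are at most
    [N * 3 ^ n <= (3 N) ^ n]. *)
Definition normbound : R := ln N%:R + ln 3.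

Lemma normbound_ge0 : 0 <= normbound.
Proof. by rewrite addr_ge0// ln_ge0// ler1n// addn_gt0 p_gt0. Qed.

Lemma ln_wnorm_le s : (0 < size s)%N -> ln (wn s) <= (size s)%:R * normbound.
Proof.
move=> s0; have N0 : (0 < N)%N by rewrite addn_gt0 p_gt0.
have N0' : 0 < N%:R :> R by rewrite ltr0n.
apply: (@le_trans _ _ (ln (N%:R * 3 ^+ size s))).
  by rewrite ler_ln ?posrE ?wnorm_gt0 ?mulr_gt0 ?exprn_gt0// wnorm_le.
rewrite lnM ?posrE ?exprn_gt0// lnXn// -[ln 3 *+ _]mulr_natl mulrDr lerD2r.
by apply: ler_peMl; rewrite ?ler1n// ln_ge0// ler1n.
Qed.

Lemma pressure_le_affine t : 0 <= t -> P t <= ln 2 + t * normbound.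
Proof.
move=> t0; have := pressure_le_psum t0 (ltn0Sn 0); rewrite mul1r => /le_trans; apply.
have K0 : 0 < expR (t * normbound) by exact: expR_gt0.
have -> : ln 2 + t * normbound = ln (2 * expR (t * normbound)).
  by rewrite lnM ?posrE// expRK.
rewrite ler_ln ?posrE ?psum_gt0 ?mulr_gt0//.
apply: (@le_trans _ _ (\sum_(s <- words 'I_2 1) expR (t * normbound))).
  rewrite /psum big_seq [leRHS]big_seq; apply: ler_sum => s; rewrite mem_words => /eqP s1.
  rewrite -[leLHS]lnK ?posrE ?powR_gt0 ?wnorm_gt0// ler_expR ln_powR ler_wpM2l//.
  by have := @ln_wnorm_le s; rewrite s1 mul1r; apply.
by rewrite big_const_seq count_predT size_words card_ord iter_addr addr0 mulr_natl.
Qed.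

(** As for l^p norms, [psum n t] is at most [psum n s] to the power [t / s]. So [P t / t] is
    nonincreasing and the limit defining [bmax] is an infimum. *)
Lemma pressure_ratio s t : 0 < s -> s <= t -> P t <= t / s * P s.
Proof.
move=> s0 st; have t0 : 0 < t by exact: lt_le_trans st.
have ts : 0 < t / s by rewrite divr_gt0.
apply/ler_addgt0Pr => e e0.
have e'0 : 0 < e / (t / s) by rewrite divr_gt0.
have [M HM] := psum_le_pressure (ltW s0) e'0.
have n0 : 0 < M.+1%:R :> R by [].
rewrite -(ler_pM2l n0); apply: le_trans (pressure_le_psum (ltW t0) (ltn0Sn M)) _.
apply: (@le_trans _ _ (t / s * ln (psum M.+1 s))); last first.
  have -> : t / s * P s + e = t / s * (P s + e / (t / s)).
    by rewrite mulrDr [t / s * (_ / _)]mulrC divfK// gt_eqF.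
  by rewrite mulrCA ler_pM2l// HM.
have s0' := ltW s0; have t0' := ltW t0.
rewrite -ln_powR ler_ln ?posrE ?powR_gt0 ?psum_gt0//.
have -> : psum M.+1 t = \sum_(x <- words 'I_2 M.+1) (wn x `^ s) `^ (t / s).
  apply: eq_bigr => x _; rewrite -powRrM; congr (_ `^ _).
  by rewrite mulrC divfK// gt_eqF.
rewrite [psum _ s]/psum; apply: (@sum_powR_le _ _ _ (fun x => wn x `^ s)) => [x|]; first by rewrite powR_gt0 ?wnorm_gt0.
by rewrite ler_pdivlMr// mul1r.
Qed.

Lemma bmax_le_pressure t : 0 < t -> t * ln 2 * bmax p q <= P t.
Proof.
have l2 : 0 < ln 2 :> R by rewrite ln_gt0// ltr1n.
move=> t0; rewrite mulrC -ler_pdivlMr ?mulr_gt0//.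
apply: (@lim_nonincreasing_pinfty R (fun t => P t / (t * ln 2))) => // [{}t|s {}t] {}t0.
  by rewrite divr_ge0 ?mulr_ge0 ?(ltW t0) ?(ltW l2)// (le_trans (ltW l2))// pressure_ge_ln2// ltW.
move=> st; have t1 : 0 < t by exact: lt_le_trans st.
rewrite ler_pdivrMr ?mulr_gt0//; apply: le_trans (pressure_ratio t0 st) _.
by rewrite le_eqVlt; apply/orP; left; apply/eqP; field; rewrite !gt_eqF.
Qed.

(** Real form of [pressure_transform]. The two agree for [delta <= bmax p q], where the set is
    bounded below by 0; beyond, [inf] carries no such guarantee. *)
Definition legendre (delta : R) : R :=
  inf [set - delta * t + P t / ln 2 | t in [set t | 0 < t]].

Local Notation b := (@bmax R p q).

Let l2 : 0 < ln 2 :> R. Proof. by rewrite ln_gt0// ltr1n. Qed.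

Lemma legendre_lb delta : delta <= b ->
  lbound [set - delta * t + P t / ln 2 | t in [set t | 0 < t]] 0.
Proof.
move=> db _ [t /= t0 <-]; rewrite mulNr addrC subr_ge0.
rewrite ler_pdivlMr//; apply: le_trans (bmax_le_pressure t0).
by rewrite -[leLHS]mulrA [leRHS]mulrC ler_pM2r ?mulr_gt0.
Qed.

Lemma legendre_nonempty delta :
  [set - delta * t + P t / ln 2 | t in [set t | 0 < t]] !=set0.
Proof. by exists (- delta * 1 + P 1 / ln 2), 1 => //=. Qed.

Lemma pressure_transformE delta : delta <= b ->
  pressure_transform p q delta = (legendre delta)%:E.
Proof.
move=> db; rewrite /pressure_transform /legendre -ereal_inf_EFin; last 2 first.
- by exists 0; exact: legendre_lb.
- exact: legendre_nonempty.
congr ereal_inf; apply/seteqP; split => [_ [t t0 <-]|_ [_ [t t0 <-] <-]]; last by exists t.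
by exists (- delta * t + P t / ln 2) => //; exists t.
Qed.

Lemma legendre_ge0 delta : delta <= b -> 0 <= legendre delta.
Proof.
by move=> db; apply: lb_le_inf; [exact: legendre_nonempty|exact: legendre_lb].
Qed.

Lemma legendre_le delta t : delta <= b -> 0 < t ->
  legendre delta <= - delta * t + P t / ln 2.
Proof.
move=> db t0; apply: ge_inf; last by exists t.
by exists 0; exact: legendre_lb.
Qed.

Lemma le_legendre delta x : (forall t, 0 < t -> x <= - delta * t + P t / ln 2) ->
  x <= legendre delta.
Proof.
move=> H; apply: lb_le_inf; first exact: legendre_nonempty.
by move=> _ [t t0 <-]; exact: H.
Qed.

(** Let [t] tend to 0: by [pressure_le_affine] the expression is at most
    [1 + t * (|delta| + normbound / ln 2)]. The final [+ 1] in [K] only keeps the divisor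
    positive. *)
Lemma legendre_le1 delta : delta <= b -> legendre delta <= 1.
Proof.
move=> db; apply/ler_addgt0Pr => e e0.
pose K := `|delta| + normbound / ln 2 + 1.
have K0 : 0 < K.
  by rewrite ltr_wpDl// addr_ge0// divr_ge0 ?normbound_ge0 ?ltW.
have t0 : 0 < e / K by rewrite divr_gt0.
apply: le_trans (legendre_le db t0) _.
have h : P (e / K) / ln 2 <= 1 + e / K * (normbound / ln 2).
  rewrite ler_pdivrMr// mulrDl mul1r -!mulrA mulVf ?gt_eqF// mulr1.
  by have := pressure_le_affine (ltW t0); rewrite -!mulrA.
have h2 : - delta * (e / K) <= `|delta| * (e / K).
  by rewrite ler_pM2r// -normrN ler_norm.
have h3 : e / K * K = e by rewrite divfK// gt_eqF.
have : e / K * (`|delta| + normbound / ln 2) <= e.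
  by rewrite -[leRHS]h3 ler_pM2l// /K; lra.
by lra.
Qed.

Lemma legendre_ge1 delta : delta <= 0 -> 1 <= legendre delta.
Proof.
move=> d0; apply: le_legendre => t t0.
have : 1 <= P t / ln 2 by rewrite ler_pdivlMr// mul1r pressure_ge_ln2// ltW.
have : 0 <= - delta * t by rewrite mulr_ge0// ?oppr_ge0// ltW.
lra.
Qed.

Lemma legendre_nonincr x y : x <= y -> y <= b -> legendre y <= legendre x.
Proof.
move=> xy yb; apply: le_legendre => t t0; apply: le_trans (legendre_le yb t0) _.
by rewrite lerD2r ler_pM2r// lerN2.
Qed.

Lemma legendre_concave x y l : x <= b -> y <= b -> 0 <= l -> l <= 1 ->
  (1 - l) * legendre x + l * legendre y <= legendre ((1 - l) * x + l * y).
Proof.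
move=> xb yb l0 l1; apply: le_legendre => t t0.
have hx := legendre_le xb t0; have hy := legendre_le yb t0.
have : (1 - l) * legendre x <= (1 - l) * (- x * t + P t / ln 2).
  by apply: ler_wpM2l => //; lra.
have : l * legendre y <= l * (- y * t + P t / ln 2) by apply: ler_wpM2l.
lra.
Qed.

(** For [y <= x] a nearly optimal [t] at [x] bounds the value at [y] from above. For [x < y <= b]
    concavity on [[x, b]] and the bounds 0 and 1 give [legendre y >= (1 - l) * legendre x] with
    [l = (y - x) / (b - x)]. Monotonicity supplies the other inequality in each case. *)
Lemma legendre_continuous : {within `]-oo, b], continuous legendre}.
Proof.
apply/subspace_continuousP => x /=; rewrite in_itv /= => xb.
apply/cvgrPdist_lt => e e0.
have e2 : 0 < e / 2 by rewrite divr_gt0.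
have hasinf : has_inf [set - x * t + P t / ln 2 | t in [set t | 0 < t]].
  by split; [exact: legendre_nonempty|exists 0; exact: legendre_lb].
have [_ [t t0 <-]] := inf_adherent e2 hasinf; rewrite -/(legendre x) /= in t0 * => tx.
(* The first bound gives [(x - y) * t < e / 2], the second [l < e / 2]; at [x = b] there is no [y]
   to the right and 1 is a dummy. *)
pose r := Num.min (e / 2 / t) (if x < b then e / 2 * (b - x) else 1).
have r0 : 0 < r.
  rewrite /r lt_min divr_gt0//=; case: ifP => // xb'.
  by rewrite mulr_gt0// subr_gt0.
exists r => //= y /=; rewrite in_itv /= ltr_distl => /andP[xy yx] yb.
rewrite /r !ltrBDr in xy yx.
have [ylex|xlty] := leP y x.
  have h1 := legendre_nonincr ylex xb.
  have h2 := legendre_le yb t0.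
  have h3 : (x - y) * t < e / 2.
    rewrite -ltr_pdivlMr//.
    have : r <= e / 2 / t by rewrite /r ge_min lexx.
    rewrite /r; lra.
  rewrite ltr_distl; lra.
have xb' : x < b by exact: lt_le_trans yb.
have h1 := legendre_nonincr (ltW xlty) yb.
pose l := (y - x) / (b - x).
have bx : 0 < b - x by rewrite subr_gt0.
have l0 : 0 <= l by rewrite divr_ge0 ?ltW// subr_gt0.
have l1 : l <= 1 by rewrite ler_pdivrMr// mul1r lerB.
have := legendre_concave xb (lexx b) l0 l1.
have -> : (1 - l) * x + l * b = y by rewrite /l; field; rewrite gt_eqF.
have h2 := legendre_ge0 (lexx b); have h3 := legendre_le1 xb; have h4 := legendre_ge0 xb.
have h5 : l < e / 2.
  rewrite /l ltr_pdivrMr//.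
  have : r <= e / 2 * (b - x) by rewrite /r xb' ge_min lexx orbT.
  rewrite /r; lra.
move=> h6; have : 0 <= l * legendre b by rewrite mulr_ge0.
have : l * legendre x <= l by rewrite ler_piMr.
rewrite ltr_distl; lra.
Qed.

End Pressure.

(** * Achievable pairs *)

Section Families.
Context {R : realType}.
Variables p q : nat.
Hypotheses (p_gt0 : (0 < p)%N) (q_gt0 : (0 < q)%N).
Local Notation N := (p + q)%N.
Local Notation wn := (@wnorm R p q).
Local Notation P := (@pressure R p q).
Local Notation K := (@normbound R p q).
Local Notation lps := (loops p q).
Implicit Types (L U S x s t e : R) (F : seq (seq 'I_2)).

(** The lower weight is measured by loops, which are supermultiplicative, the upper one by norms,
    which are submultiplicative: both bounds survive concatenation, and the exponents add up. *)
Definition word_family n L U S F :=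
  [/\ uniq F, forall w, w \in F -> size w = n,
      forall w, w \in F -> expR L <= (size (lps w))%:R,
      forall w, w \in F -> wn w <= expR U & expR S <= (size F)%:R].

Lemma word_family_weaken n L U S L' U' S' F :
  L' <= L -> U <= U' -> S' <= S -> word_family n L U S F -> word_family n L' U' S' F.
Proof.
move=> hL hU hS [uF nF lF nF' sF]; split => //.
- by move=> w wF; apply: le_trans (lF w wF); rewrite ler_expR.
- by move=> w wF; apply: le_trans (nF' w wF) _; rewrite ler_expR.
- by apply: le_trans sF; rewrite ler_expR.
Qed.

Lemma word_family_cat n L U S F n' L' U' S' F' :
  word_family n L U S F -> word_family n' L' U' S' F' ->
  word_family (n + n') (L + L') (U + U') (S + S') [seq v ++ w | v <- F, w <- F'].
Proof.
move=> [u1 s1 l1 w1 c1] [u2 s2 l2 w2 c2]; split.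
- apply: allpairs_uniq => //.
  move=> [a b] [a' b'] /allpairsP[[x y] /= [xF yF [-> ->]]] /allpairsP[[z t] /= [zF tF [-> ->]]].
  by move/eqP; rewrite eqseq_cat ?(s1 _ xF) ?(s1 _ zF)// => /andP[/eqP-> /eqP->].
- by move=> _ /allpairsP[[v w] /= [vF wF ->]]; rewrite size_cat (s1 _ vF) (s2 _ wF).
- move=> _ /allpairsP[[v w] /= [vF wF ->]]; rewrite expRD.
  apply: (@le_trans _ _ (size (lps v) * size (lps w))%:R); last by rewrite ler_nat loops_cat.
  by rewrite natrM; apply: ler_pM; rewrite ?expR_ge0 ?l1 ?l2.
- move=> _ /allpairsP[[v w] /= [vF wF ->]]; rewrite expRD.
  apply: le_trans (wnorm_cat p_gt0 q_gt0 _ _) _.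
  by apply: ler_pM; rewrite ?w1 ?w2// ltW// wnorm_gt0.
- by rewrite size_allpairs natrM expRD; apply: ler_pM; rewrite ?expR_ge0.
Qed.

Lemma word_family_pow k n L U S F : word_family n L U S F ->
  exists F', word_family (k.+1 * n) (k.+1%:R * L) (k.+1%:R * U) (k.+1%:R * S) F'.
Proof.
move=> H; elim: k => [|k [F' IH]]; first by exists F; rewrite mul1n !mul1r.
exists [seq v ++ w | v <- F, w <- F']; rewrite mulSn -(@natr1 R k.+1) !mulrDl !mul1r.
by rewrite [_ + L]addrC [_ + U]addrC [_ + S]addrC; exact: word_family_cat.
Qed.

Lemma word_family_size n L U S F : word_family n L U S F -> S <= n%:R * ln 2.
Proof.
move=> [uF sF _ _ cF]; rewrite mulr_natl -lnXn// -ler_expR lnK ?posrE ?exprn_gt0//.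
apply: le_trans cF _; rewrite -natrX ler_nat -[X in (_ <= X ^ _)%N](card_ord 2) -size_words.
by apply: uniq_leq_size => // w wF; rewrite mem_words (sF _ wF).
Qed.

(** A single length is required for each [e]; [achievable_family] upgrades this to all large
    lengths. *)
Definition achievable x s := forall e, 0 < e -> exists n F,
  (0 < n)%N /\ word_family n (n%:R * (x - e)) (n%:R * (x + e)) (n%:R * (s - e)) F.

Lemma achievable_le x s s' : s' <= s -> achievable x s -> achievable x s'.
Proof.
move=> ss H e e0; have [n [F [n0 HF]]] := H e e0; exists n, F; split => //.
by apply: word_family_weaken HF => //; apply: ler_wpM2l => //; lra.
Qed.

Lemma achievable_closed x s :
  (forall e, 0 < e -> exists x' s', [/\ `|x' - x| <= e, s - e <= s' & achievable x' s']) ->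
  achievable x s.
Proof.
move=> H e e0; have e2 : 0 < e / 2 by lra.
have [x' [s' [+ ss H']]] := H _ e2; rewrite ler_norml => /andP[x1 x2].
have [n [F [n0 HF]]] := H' _ e2; exists n, F; split => //.
by apply: word_family_weaken HF => //; apply: ler_wpM2l => //; lra.
Qed.

Lemma achievable_le_ln2 x s : achievable x s -> s <= ln 2.
Proof.
move=> H; apply/ler_addgt0Pr => e e0; have [n [F [n0 HF]]] := H e e0.
by have := word_family_size HF; rewrite ler_pM2l ?ltr0n//; lra.
Qed.

(** Concatenate [b * n2] copies of the first family with [a * n1] copies of the second. The total
    length is [n1 * n2 * (a + b)], and [a / (a + b)] approximates [l] with error at most
    [1 / (a + b)]. *)
Lemma achievable_convex x1 s1 x2 s2 l : 0 <= l -> l <= 1 ->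
  achievable x1 s1 -> achievable x2 s2 ->
  achievable ((1 - l) * x1 + l * x2) ((1 - l) * s1 + l * s2).
Proof.
move=> l0 l1 H1 H2 e e0; have e2 : 0 < e / 2 by lra.
have [n1 [F1 [n10 HF1]]] := H1 _ e2; have [n2 [F2 [n20 HF2]]] := H2 _ e2.
(* With [m < a + b] the rounding error, at most 1 in [A - l * (A + B)], costs at most
   [(A + B) * (e / 2)]. *)
have [m mD] := exists_natr_gt ((`|x2 - x1| + `|s2 - s1|) / (e / 2)).
rewrite ltr_pdivrMr// in mD.
have lm0 : 0 <= l * m%:R by rewrite mulr_ge0.
have lm0' : 0 <= (1 - l) * m%:R by rewrite mulr_ge0 ?subr_ge0.
have /andP[a1 a2] := truncn_itv lm0; have /andP[b1 b2] := truncn_itv lm0'.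
pose a := (Num.trunc (l * m%:R)).+1; pose b := (Num.trunc ((1 - l) * m%:R)).+1.
have aE : (Num.trunc (l * m%:R))%:R = a%:R - 1 :> R by rewrite /a -natr1 addrK.
have bE : (Num.trunc ((1 - l) * m%:R))%:R = b%:R - 1 :> R by rewrite /b -natr1 addrK.
rewrite -/a aE in a1 a2; rewrite -/b bE in b1 b2.
pose A : R := a%:R; pose B : R := b%:R; rewrite -/A in a1 a2; rewrite -/B in b1 b2.
have ab1 : A - l * (A + B) <= 1 by nra.
have ab2 : -1 <= A - l * (A + B) by nra.
have mAB : m%:R < A + B by lra.
have key y1 y2 : `|y2 - y1| <= `|x2 - x1| + `|s2 - s1| ->
    `|(A - l * (A + B)) * (y2 - y1)| <= (A + B) * (e / 2).
  move=> hy; rewrite normrM; apply: (@le_trans _ _ (1 * `|y2 - y1|)).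
    by apply: ler_wpM2r => //; rewrite ler_norml ab1 ab2.
  rewrite mul1r; apply: le_trans hy _; apply: ltW; apply: lt_trans mD _.
  by rewrite ltr_pM2r.
have := key x1 x2; rewrite lerDl normr_ge0 => /(_ isT); rewrite ler_norml => /andP[kx1 kx2].
have := key s1 s2; rewrite lerDr normr_ge0 => /(_ isT); rewrite ler_norml => /andP[ks1 ks2].
have [k kE] : exists k, (b * n2 = k.+1)%N by exists (b * n2).-1; rewrite prednK// muln_gt0.
have [k' kE'] : exists k, (a * n1 = k.+1)%N by exists (a * n1).-1; rewrite prednK// muln_gt0.
have [F1' {HF1}] := word_family_pow k HF1; rewrite -kE => HF1.
have [F2' {HF2}] := word_family_pow k' HF2; rewrite -kE' => HF2.
exists (b * n2 * n1 + a * n1 * n2)%N, [seq v ++ w | v <- F1', w <- F2']; split.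
  by rewrite addn_gt0 !muln_gt0 n10 n20.
apply: word_family_weaken (word_family_cat HF1 HF2); rewrite natrD !natrM -/A -/B.
- have -> : B * n2%:R * (n1%:R * (x1 - e / 2)) + A * n1%:R * (n2%:R * (x2 - e / 2)) =
    (n1%:R * n2%:R) * (B * (x1 - e / 2) + A * (x2 - e / 2)) by ring.
  have -> : B * n2%:R * n1%:R + A * n1%:R * n2%:R = n1%:R * n2%:R * (A + B) by ring.
  rewrite -mulrA; apply: ler_wpM2l; first by rewrite mulr_ge0.
  lra.
- have -> : B * n2%:R * (n1%:R * (x1 + e / 2)) + A * n1%:R * (n2%:R * (x2 + e / 2)) =
    (n1%:R * n2%:R) * (B * (x1 + e / 2) + A * (x2 + e / 2)) by ring.
  have -> : B * n2%:R * n1%:R + A * n1%:R * n2%:R = n1%:R * n2%:R * (A + B) by ring.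
  rewrite -[leRHS]mulrA; apply: ler_wpM2l; first by rewrite mulr_ge0.
  lra.
- have -> : B * n2%:R * (n1%:R * (s1 - e / 2)) + A * n1%:R * (n2%:R * (s2 - e / 2)) =
    (n1%:R * n2%:R) * (B * (s1 - e / 2) + A * (s2 - e / 2)) by ring.
  have -> : B * n2%:R * n1%:R + A * n1%:R * n2%:R = n1%:R * n2%:R * (A + B) by ring.
  rewrite -mulrA; apply: ler_wpM2l; first by rewrite mulr_ge0.
  lra.
Qed.

(* Words are extended on both sides by connecting words leading from the state 0 to the
   largest entry of the matrix and back. *)
Lemma word_family_of_norms n x u S F : uniq F -> (forall w, w \in F -> size w = n) ->
  (forall w, w \in F -> expR x <= wn w <= expR u) -> expR S <= (size F)%:R ->
  exists F', word_family (n + 2 * mixlen p q) (x - 2 * ln N%:R)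
    (u + 2 * (ln N%:R + (mixlen p q)%:R * ln 3)) S F'.
Proof.
set r := mixlen p q => uF sF wF cF.
have N0 : 0 < N%:R :> R by rewrite ltr0n addn_gt0 p_gt0.
have /choice[f Hf] w : exists f, [/\ size f.1 = r, size f.2 = r &
    wn w <= N%:R ^+ 2 * (size (lps (f.1 ++ w ++ f.2)))%:R].
  by have [v [v' H]] := @loops_connect R _ _ p_gt0 q_gt0 w; exists (v, v').
exists [seq (f w).1 ++ w ++ (f w).2 | w <- F]; split.
- rewrite map_inj_in_uniq// => w w' wF' wF2 /eqP.
  have [s1 s2 _] := Hf w; have [s1' s2' _] := Hf w'.
  rewrite eqseq_cat ?s1 ?s1'// eqseq_cat ?(sF _ wF') ?(sF _ wF2)//.
  by move=> /andP[_ /andP[/eqP]].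
- move=> _ /mapP[w wF' ->]; have [s1 s2 _] := Hf w.
  by rewrite !size_cat s1 s2 (sF _ wF'); lia.
- move=> _ /mapP[w wF' ->]; have [_ _ h] := Hf w.
  have /andP[/le_trans /(_ h) + _] := wF _ wF'.
  rewrite expRB expRM_natl lnK ?posrE// ler_pdivrMr ?exprn_gt0//.
  by rewrite [leRHS]mulrC.
- move=> _ /mapP[w wF' ->]; have [s1 s2 _] := Hf w; have /andP[_ h] := wF _ wF'.
  have hr v : size v = r -> wn v <= expR (ln N%:R + r%:R * ln 3).
    move=> vr; apply: le_trans (wnorm_le p_gt0 q_gt0 v) _.
    by rewrite vr expRD expRM_natl !lnK ?posrE.
  have w0 v : 0 <= wn v by apply: ltW; exact: wnorm_gt0.
  apply: le_trans (wnorm_cat p_gt0 q_gt0 _ _) _.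
  have -> : u + 2 * (ln N%:R + r%:R * ln 3) =
    (ln N%:R + r%:R * ln 3) + (u + (ln N%:R + r%:R * ln 3)) by ring.
  rewrite expRD; apply: ler_pM; rewrite ?hr//.
  apply: le_trans (wnorm_cat p_gt0 q_gt0 _ _) _.
  by rewrite expRD; apply: ler_pM; rewrite ?hr.
- by rewrite size_map.
Qed.

End Families.

Lemma bounded_cluster (R : realType) (u : nat -> R) (a b : R) :
  (forall n, a <= u n <= b) -> exists x, forall e M, 0 < e ->
    exists2 n, (M <= n)%N & `|u n - x| < e.
Proof.
move=> uab; have := @segment_compact R a b.
move=> /(_ (u @ \oo) _)[|x [_ xc]].
  by exists 0%N => // n _ /=; rewrite in_itv /=; exact: uab.
exists x => e M e0.
have [||_ [[n /= Mn <-] h]] := xc (u @` [set n | (M <= n)%N]) (ball x e).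
- by exists M => // n Mn; exists n.
- exact: nbhsx_ballx.
by exists n => //; move: h; rewrite /ball /= distrC.
Qed.

(** * Sources of achievable pairs, and the upper boundary of their set *)

Section Achievable.
Context {R : realType}.
Variables p q : nat.
Hypotheses (p_gt0 : (0 < p)%N) (q_gt0 : (0 < q)%N).
Local Notation N := (p + q)%N.
Local Notation wn := (@wnorm R p q).
Local Notation P := (@pressure R p q).
Local Notation K := (@normbound R p q).
Local Notation lps := (loops p q).
Local Notation r := (mixlen p q).
Implicit Types (b B t e : R) (F : seq (seq 'I_2)).

(** Common form of the two sources of achievable pairs: all words, with [b = P t] and the trivial
    bound [B = K]; and the words of typical levels, with [t = 0], [b = ln 2] and
    [B = alpha * ln 2]. *)
Definition heavy t b B := forall eta M, 0 < eta -> exists n F,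
  [/\ (M <= n)%N, uniq F, forall w, w \in F -> size w = n,
      forall w, w \in F -> wn w <= expR (n%:R * (B + eta)) &
      expR (n%:R * (b - eta)) <= \sum_(w <- F) wn w `^ t].

Lemma pigeonhole_bins (I : eqType) (J : seq I) (k : nat) (f : I -> 'I_k.+1) (y : I -> R) :
  exists j, \sum_(i <- J) y i <= k.+1%:R * \sum_(i <- J | f i == j) y i.
Proof.
apply: contrapT => H.
have lt_j j : k.+1%:R * \sum_(i <- J | f i == j) y i < \sum_(i <- J) y i.
  by rewrite ltNge; apply/negP => h; apply: H; exists j.
have : \sum_j (k.+1%:R * \sum_(i <- J | f i == j) y i) < \sum_(j < k.+1) \sum_(i <- J) y i.
  by apply: ltr_sum => //; apply/hasP; exists ord0; rewrite ?mem_index_enum.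
rewrite -mulr_sumr big_const_ord iter_addr addr0 -[ltRHS]mulr_natl.
have <- : \sum_(i <- J) y i = \sum_j \sum_(i <- J | f i == j) y i.
  exact: (partition_big f xpredT).
by rewrite ltxx.
Qed.

(** Cut the values of [ln (wn w) / n] into bins of width [eta]. Their number does not depend on [n],
    so one bin carries the moment up to a constant factor; [x] is its left end. Connecting words
    then turn norms into loops. *)
Lemma heavy_bin t b B e : 0 <= t -> heavy t b B -> 0 < e -> exists x n F,
  [/\ 0 <= x <= K, x <= B + e, (0 < n)%N &
      word_family p q n (n%:R * (x - e)) (n%:R * (x + e)) (n%:R * (b - t * x - e)) F].
Proof.
(* The count in the bin loses [2 * eta] from [b] and [t * eta] from the width of the bin, together
   [e / 2]. *)
move=> t0 H e0; pose eta := e / (2 * (2 + t)).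
have t2 : 0 < 2 * (2 + t) by lra.
have eta0 : 0 < eta by rewrite divr_gt0.
have etaE : (2 + t) * eta = e / 2 by rewrite /eta; field; lra.
have K0 : 0 <= K by exact: normbound_ge0.
have N0 : (0 < N)%N by rewrite addn_gt0 p_gt0.
have lnN : 0 <= ln N%:R :> R by rewrite ln_ge0// ler1n.
have ln3 : 0 <= ln 3 :> R by rewrite ln_ge0// ler1n.
have [kb kbE] : exists kb, Num.trunc (K / eta) = kb by exists (Num.trunc (K / eta)).
(* Total effect of the [2 * r] connecting letters on the three exponents, absorbed by the other
   [e / 2] for large [n]. *)
pose D0 := 2 * (r%:R * K) + 2 * ln N%:R + 2 * (ln N%:R + r%:R * ln 3) + 2 * (r%:R * `|b|).
have D00 : 0 <= D0 by rewrite /D0 !(addr_ge0, mulr_ge0).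
have lk0 : 0 <= ln kb.+1%:R :> R by rewrite ln_ge0// ler1n.
have [M0 MD] := exists_natr_gt (D0 / (e / 2) + ln kb.+1%:R / eta).
have [n [F [Mn uF sF nF cF]]] := H eta M0.+1 eta0.
have n0 : (0 < n)%N by exact: leq_trans Mn.
have n0R : 0 < n%:R :> R by rewrite ltr0n.
have nM : D0 / (e / 2) + ln kb.+1%:R / eta < n%:R.
  by apply: lt_trans MD _; rewrite ltr_nat.
have nD : D0 <= n%:R * (e / 2).
  rewrite -ler_pdivrMr; last by lra.
  have : 0 <= ln kb.+1%:R / eta by rewrite divr_ge0// ltW.
  lra.
have nk : ln kb.+1%:R <= n%:R * eta.
  rewrite -ler_pdivrMr//.
  have : 0 <= D0 / (e / 2) by rewrite divr_ge0// ltW// divr_gt0.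
  lra.
have neta : 0 < n%:R * eta by rewrite mulr_gt0.
have wn0 w : 0 < wn w by exact: wnorm_gt0.
have lw0 w : 0 <= ln (wn w) by rewrite ln_ge0// wnorm_ge1.
have lwK w : w \in F -> ln (wn w) <= n%:R * K.
  by move=> /sF sw; rewrite -sw; apply: ln_wnorm_le; rewrite ?sw.
pose f w : 'I_kb.+1 := inord (Num.trunc (ln (wn w) / (n%:R * eta))).
have [j Hj] := pigeonhole_bins F f (fun w => wn w `^ t).
pose Fj := [seq w <- F | f w == j]; pose x := j%:R * eta.
have x0 : 0 <= x by rewrite mulr_ge0// ltW.
have Fjx w : w \in Fj -> n%:R * x <= ln (wn w) <= n%:R * (x + eta).
  rewrite mem_filter => /andP[/eqP fw wF].
  have : Num.trunc (ln (wn w) / (n%:R * eta)) = j :> nat.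
    rewrite -fw inordK// ltnS -kbE; apply: le_truncn.
    rewrite ler_pdivrMr// mulrCA -!mulrA mulVf ?gt_eqF// mulr1 lwK//.
  have /truncn_itv : 0 <= ln (wn w) / (n%:R * eta) by rewrite divr_ge0// ltW.
  move=> + E; rewrite E -natr1 ler_pdivlMr// ltr_pdivrMr// => /andP[h1 h2].
  rewrite /x; apply/andP; split; [move: h1|move: (ltW h2)]; by congr (_ <= _); ring.
have cFj : expR (n%:R * (b - 2 * eta) - n%:R * (x + eta) * t) <= (size Fj)%:R.
  rewrite expRB ler_pdivrMr ?expR_gt0//.
  have h1 : \sum_(w <- F | f w == j) wn w `^ t <=
      (size Fj)%:R * expR (n%:R * (x + eta) * t).
    rewrite -big_filter -/Fj big_seq.
    apply: (@le_trans _ _ (\sum_(w <- Fj | w \in Fj) expR (n%:R * (x + eta) * t))).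
      apply: ler_sum => w /Fjx /andP[_ hw].
      rewrite -[leLHS]lnK ?posrE ?powR_gt0// ler_expR ln_powR mulrC.
      exact: ler_wpM2r.
    by rewrite -big_seq big_const_seq count_predT iter_addr addr0 [leRHS]mulr_natl.
  apply: le_trans h1.
  have k0 : 0 < kb.+1%:R :> R by [].
  rewrite -(ler_pM2l k0); apply: le_trans Hj; apply: le_trans cF.
  rewrite -[X in X * _ <= _]lnK ?posrE// -expRD ler_expR; lra.
have [w wFj] : exists w, w \in Fj.
  move: cFj; case: (Fj) => [|w ?]; last by exists w; rewrite mem_head.
  by rewrite leNgt expR_gt0.
have wF : w \in F by move: wFj; rewrite mem_filter => /andP[].
have /andP[hx1 hx2] := Fjx _ wFj.
have xK : x <= K by rewrite -(ler_pM2l n0R); apply: le_trans hx1 _; exact: lwK.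
have ee : eta <= e / 2 by rewrite -etaE; nra.
have xB : x <= B + e.
  have : x <= B + eta.
    rewrite -(ler_pM2l n0R); apply: le_trans hx1 _.
    by rewrite -ler_expR lnK ?posrE// nF.
  lra.
have sFj w' : w' \in Fj -> size w' = n by rewrite mem_filter => /andP[_ /sF].
have nFj w' : w' \in Fj -> expR (n%:R * x) <= wn w' <= expR (n%:R * (x + eta)).
  move=> /Fjx /andP[h1 h2].
  by rewrite -[wn w']lnK ?posrE// !ler_expR h1.
have uFj : uniq Fj := filter_uniq _ uF.
have [F' HF'] := @word_family_of_norms R p q p_gt0 q_gt0 n (n%:R * x) (n%:R * (x + eta))
  (n%:R * (b - 2 * eta) - n%:R * (x + eta) * t) Fj uFj sFj nFj cFj.
exists x, (n + 2 * r)%N, F'.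
have r0 : 0 <= r%:R :> R by [].
have rx : r%:R * x <= r%:R * K by rewrite ler_wpM2l.
have rx0 : 0 <= r%:R * x by rewrite mulr_ge0.
have re : 0 <= r%:R * e by rewrite mulr_ge0// ltW.
have rtx : 0 <= r%:R * t * x by apply: mulr_ge0 => //; exact: mulr_ge0.
have rb : r%:R * b <= r%:R * `|b| by rewrite ler_wpM2l// ler_norm.
have rb0 : 0 <= r%:R * `|b| by rewrite mulr_ge0.
have r3 : 0 <= r%:R * ln 3 :> R by rewrite mulr_ge0.
have rK : 0 <= r%:R * K by rewrite mulr_ge0.
have ne : n%:R * eta <= n%:R * (e / 2) by rewrite ler_pM2l.
have nte : n%:R * ((2 + t) * eta) = n%:R * (e / 2) by rewrite etaE.
rewrite /D0 in nD.
split; [by rewrite x0|exact: xB|by rewrite addn_gt0 n0|].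
rewrite natrD natrM; move: HF'; set L := n%:R * x - _; set U := _ + _; set S := _ - _.
apply: word_family_weaken; rewrite /L /U /S; lra.
Qed.

(** The rates found by [heavy_bin] for tolerances tending to 0 stay in [[0, K]]; a cluster point [x]
    works, with [s = b - t * x]. *)
Lemma achievable_heavy t b B : 0 <= t -> heavy t b B ->
  exists x s, [/\ achievable p q x s, b <= s + t * x & x <= B].
Proof.
move=> t0 H.
have /choice[u Hu] k : exists x, exists n F,
  [/\ 0 <= x <= K, x <= B + k.+1%:R^-1, (0 < n)%N &
      word_family p q n (n%:R * (x - k.+1%:R^-1)) (n%:R * (x + k.+1%:R^-1))
        (n%:R * (b - t * x - k.+1%:R^-1)) F].
  by apply: heavy_bin => //; rewrite invr_gt0.
have [x Hx] : exists x, forall e M, 0 < e -> exists2 n, (M <= n)%N & `|u n - x| < e.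
  by apply: (@bounded_cluster R u 0 K) => k; have [n [F []]] := Hu k.
have near_x e : 0 < e -> exists k, [/\ k.+1%:R^-1 < e & `|u k - x| < e].
  move=> e0; have [M Me] := exists_natr_gt e^-1.
  have [k Mk uk] := Hx e M e0; exists k; split => //.
  rewrite -[ltRHS]invrK ltf_pV2 ?posrE ?invr_gt0//.
  by apply: lt_le_trans Me _; rewrite ler_nat leqW.
exists x, (b - t * x); split; last 2 first.
- lra.
- apply/ler_addgt0Pr => e e0; have e2 : 0 < e / 2 by lra.
  have [k []] := near_x _ e2; have [n [F [_ + _ _]]] := Hu k.
  rewrite ltr_norml; move: (k.+1%:R^-1) => v uB ke /andP[h1 h2]; lra.
move=> e e0; have t2 : 0 < 2 + t by lra.
have e2 : 0 < e / (2 + t) by rewrite divr_gt0.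
have eE : (2 + t) * (e / (2 + t)) = e by field; lra.
have [k []] := near_x _ e2; have [n [F [_ _ n0]]] := Hu k.
rewrite ltr_norml; move: (k.+1%:R^-1) => v HF ke /andP[uk1 uk2].
set e' := e / (2 + t) in e2 eE ke uk1 uk2.
have te : 0 <= t * e' by rewrite mulr_ge0// ltW.
have tu : t * u k <= t * (x + e') by apply: ler_wpM2l => //; lra.
exists n, F; split => //; apply: word_family_weaken HF; apply: ler_wpM2l => //; lra.
Qed.

Lemma achievable_pressure t : 0 <= t -> exists x s, achievable p q x s /\ P t <= s + t * x.
Proof.
move=> t0; have [|x [s [H1 H2 _]]] := @achievable_heavy t (P t) K t0; last by exists x, s.
move=> eta M eta0; exists M.+1, (words 'I_2 M.+1); split => //.
- exact: words_uniq.
- by move=> w; rewrite mem_words => /eqP.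
- move=> w; rewrite mem_words => /eqP sw.
  rewrite -[leLHS]lnK ?posrE ?wnorm_gt0// ler_expR -sw.
  apply: le_trans (ln_wnorm_le _ _ _) _; rewrite ?sw// ler_wpM2l//; lra.
- rewrite -/(psum p q _ t) -[leRHS]lnK ?posrE ?psum_gt0// ler_expR.
  apply: le_trans (pressure_le_psum p_gt0 q_gt0 t0 (ltn0Sn M)).
  by rewrite ler_wpM2l//; lra.
Qed.

(* A supporting line at [x] of the convex set of achievable pairs; the point over [z < x] at
   maximal height [ln 2] makes its slope negative, so that only exponents [t > 0] occur. *)
Lemma achievable_lt_bmax a x y :
  (forall e, 0 < e -> exists2 z, z <= a + e & achievable p q z (ln 2)) ->
  a < x -> x < ln 2 * bmax p q -> y <= ln 2 ->
  (forall t, 0 < t -> y <= P t - t * x) ->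
  achievable p q x y.
Proof.
move=> Ha ax xb y2 yP.
have [x0 x0x H0] : exists2 x0, x0 < x & achievable p q x0 (ln 2).
  have e0 : 0 < (x - a) / 2 by lra.
  by have [z za Hz] := Ha _ e0; exists z => //; lra.
have l2 : 0 < ln 2 :> R by rewrite ln_gt0// ltr1n.
have [x1 [s1 [xx1 H1]]] : exists x1 s1, x < x1 /\ achievable p q x1 s1.
  (* Then [t * ln 2 * bmax] exceeds [t * x] by [2 * ln 2]. As [s1] is at most [ln 2], the pair
     reaching the pressure at [t] must lie to the right of [x]. *)
  pose t := 2 * ln 2 / (ln 2 * bmax p q - x).
  have t0 : 0 < t by rewrite divr_gt0 ?subr_gt0 ?mulr_gt0.
  have [x1 [s1 [H1 h]]] := achievable_pressure (ltW t0).
  exists x1, s1; split => //; have := achievable_le_ln2 H1.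
  have := bmax_le_pressure p_gt0 q_gt0 t0 => h1 h2.
  have tE : t * (ln 2 * bmax p q - x) = 2 * ln 2.
    by rewrite /t divfK// gt_eqF// subr_gt0.
  rewrite -(ltr_pM2l t0); lra.
have chord u su v sv : achievable p q u su -> achievable p q v sv -> u < x -> x < v ->
    achievable p q x ((su * (v - x) + sv * (x - u)) / (v - u)).
  move=> Hu Hv ux xv; pose l := (x - u) / (v - u).
  have vu : 0 < v - u by lra.
  have l0 : 0 <= l by apply: divr_ge0; lra.
  have l1 : l <= 1 by rewrite ler_pdivrMr//; lra.
  have := achievable_convex p_gt0 q_gt0 l0 l1 Hu Hv.
  have -> : (1 - l) * u + l * v = x by rewrite /l; field; lra.
  by have -> : (1 - l) * su + l * sv = (su * (v - x) + sv * (x - u)) / (v - u)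
    by rewrite /l; field; lra.
pose S := [set s | achievable p q x s].
have S0 : S !=set0 by exists ((ln 2 * (x1 - x) + s1 * (x - x0)) / (x1 - x0)); exact: chord.
have hS : has_sup S by split => //; exists (ln 2) => s; exact: achievable_le_ln2.
set m := sup S.
have Hm : achievable p q x m.
  apply: achievable_closed => e e0; have [s Ss sm] := sup_adherent e0 hS.
  by exists x, s; rewrite subrr normr0 (ltW e0) (ltW sm).
have leS s : achievable p q x s -> s <= m by move=> Hs; apply: ub_le_sup => //; case: hS.
have chord_le u su v sv : achievable p q u su -> achievable p q v sv -> u < x -> x < v ->
    (sv - m) / (v - x) <= (m - su) / (x - u).
  move=> Hu Hv ux xv; have := leS _ (chord _ _ _ _ Hu Hv ux xv).
  rewrite ler_pdivrMr; last by lra.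
  rewrite ler_pdivrMr ?subr_gt0// mulrAC ler_pdivlMr ?subr_gt0//; lra.
have [|mlt] := leP y m; first by move=> ym; exact: achievable_le Hm.
(* Slopes of the chords from the boundary point [(x, m)] to the right. By [chord_le] the slopes to
   the left bound them, so their supremum is the slope of a supporting line. *)
pose E := [set (v.2 - m) / (v.1 - x) | v in [set v : R * R | achievable p q v.1 v.2 /\ x < v.1]].
have E0 : E !=set0 by exists ((s1 - m) / (x1 - x)), (x1, s1).
have ubE u su : achievable p q u su -> u < x -> ubound E ((m - su) / (x - u)).
  by move=> Hu ux _ [[v sv] /= [Hv xv] <-]; exact: chord_le.
have hE : has_ubound E by exists ((m - ln 2) / (x - x0)); exact: ubE.
pose k := sup E.
have k0 : k < 0.
  apply: (@le_lt_trans _ _ ((m - ln 2) / (x - x0))).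
    by apply: ge_sup => //; exact: ubE.
  by rewrite pmulr_llt0 ?invr_gt0; lra.
have t0 : 0 < - k by lra.
(* The pair reaching the pressure at [- k] would lie strictly above the supporting line, because
   [m < y]. *)
have [u [su [Hu hu]]] := achievable_pressure (ltW t0).
have hy := yP _ t0.
have : su - m > k * (u - x) by lra.
have [ux|xu|ux] := ltgtP u x.
- have : k <= (m - su) / (x - u) by apply: ge_sup => //; exact: ubE.
  rewrite ler_pdivlMr ?subr_gt0//; lra.
- have : (su - m) / (u - x) <= k by apply: ub_le_sup => //; exists (u, su).
  rewrite ler_pdivrMr ?subr_gt0//; lra.
- rewrite ux subrr mulr0; rewrite ux in Hu; have := leS _ Hu; lra.
Qed.

(** Closedness reaches the end point [x = ln 2 * bmax p q]: the hypothesis on [y] passes to [x - d],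
    as [t * (x - d) <= t * x]. *)
Lemma achievable_le_bmax a x y :
  (forall e, 0 < e -> exists2 z, z <= a + e & achievable p q z (ln 2)) ->
  a < x -> x <= ln 2 * bmax p q -> y <= ln 2 ->
  (forall t, 0 < t -> y <= P t - t * x) ->
  achievable p q x y.
Proof.
move=> Ha ax xb y2 yP; apply: achievable_closed => e e0.
pose d := Num.min e ((x - a) / 2).
have d0 : 0 < d by rewrite lt_min e0 /=; lra.
have de : d <= e by rewrite /d ge_min lexx.
have dx : d <= (x - a) / 2 by rewrite /d ge_min lexx orbT.
exists (x - d), y; split; last 1 first.
- apply: achievable_lt_bmax Ha _ _ y2 _ => [||t t0]; try lra.
  apply: le_trans (yP t t0) _; rewrite lerD2l lerN2; apply: ler_wpM2l; lra.
- by rewrite addrAC subrr sub0r normrN ger0_norm// ltW.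
- lra.
Qed.

Lemma split_length (n c M m : nat) : (0 < n)%N -> (M + (c + n) + n <= m)%N ->
  exists j k, [/\ (j < n)%N, m = (k.+1 * n + (c + j))%N, (c + j <= c + n)%N & (M <= m)%N].
Proof.
move=> n0 mM; exists ((m - c) %% n)%N, ((m - c) %/ n).-1.
have jn : ((m - c) %% n < n)%N by rewrite ltn_mod.
have k0 : (0 < (m - c) %/ n)%N by rewrite divn_gt0//; lia.
rewrite prednK//; have := divn_eq (m - c) n; split => //; lia.
Qed.

(* Padding with zeros makes every large length available; the factor [01] later keeps the
   coded levels away from dyadic endpoints. *)
Lemma achievable_family x s : achievable p q x s -> forall e, 0 < e ->
  exists M, forall m, (M <= m)%N -> exists F,
    word_family p q m (m%:R * (x - e)) (m%:R * (x + e)) (m%:R * (s - e)) F /\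
    forall w, w \in F -> exists a b : seq _, w = (a ++ [:: zero2; one2] ++ b)%SEQ.
Proof.
move=> H e e0; have e2 : 0 < e / 2 by lra.
have [n [F [n0 HF]]] := H _ e2.
have [v vr pad0] := loops_pad p_gt0 q_gt0.
pose c0 := (2 + r + n)%N.
have K0 : 0 <= K by exact: normbound_ge0.
have [M0 HM0] := exists_natr_gt (c0%:R * (K + `|x| + `|s|) / (e / 2)).
rewrite ltr_pdivrMr// in HM0.
exists (M0 + c0 + n)%N => m mM.
have [j [k' [jn mE c0c mM0']]] := split_length n0 mM; pose k := k'.+1.
have [F1 HF1] := word_family_pow p_gt0 q_gt0 k' HF; rewrite -/k in HF1 mE.
(* The factor 01, the way back to state 0, and [j] zeros that adjust the length modulo [n]; each
   part carries a loop. *)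
pose w0 := ([:: zero2; one2] ++ v) ++ nseq j zero2.
have sw0 : size w0 = (2 + r + j)%N by rewrite !size_cat vr size_nseq.
have HF2 : word_family p q (2 + r + j) 0 ((2 + r + j)%:R * K) 0 [:: w0].
  split => //.
  - by move=> w; rewrite inE => /eqP->.
  - move=> w; rewrite inE => /eqP->; rewrite expR0 ler1n.
    apply: leq_trans (loops_cat p q _ _); rewrite muln_gt0 pad0 loops_zeros//.
  - move=> w; rewrite inE => /eqP->.
    have h0 : (0 < size w0)%N by rewrite sw0.
    by rewrite -[leLHS]lnK ?posrE ?wnorm_gt0// ler_expR -sw0; exact: ln_wnorm_le.
  - by rewrite expR0.
exists [seq v ++ w | v <- F1, w <- [:: w0]]; split; last first.
  move=> _ /allpairsP[[a w] /= [_ + ->]]; rewrite inE => /eqP->.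
  by exists a, (v ++ nseq j zero2); rewrite /w0 -!catA.
rewrite {1}mE; apply: word_family_weaken (word_family_cat p_gt0 q_gt0 HF1 HF2).
all: have {}c0c : (2 + r + j)%:R <= c0%:R :> R by rewrite ler_nat.
all: have cx := ler_wpM2r (normr_ge0 x) c0c.
all: have cs := ler_wpM2r (normr_ge0 s) c0c.
all: have cK := ler_wpM2r K0 c0c.
all: have mM0 : M0%:R * (e / 2) <= m%:R * (e / 2) by rewrite ler_pM2r// ler_nat.
all: have c00 : 0 <= (2 + r + j)%:R :> R by [].
all: have cx1 : `|(2 + r + j)%:R * x| <= (2 + r + j)%:R * `|x| by rewrite normrM ger0_norm.
all: have cs1 : `|(2 + r + j)%:R * s| <= (2 + r + j)%:R * `|s| by rewrite normrM ger0_norm.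
all: have ce : 0 <= (2 + r + j)%:R * e by rewrite mulr_ge0// ltW.
all: have mR : m%:R = k%:R * n%:R + (2 + r + j)%:R :> R by rewrite {1}mE natrD natrM.
all: set C := (2 + r + j)%:R in c0c cx cs cK c00 cx1 cs1 ce mR *.
all: have cK0 : 0 <= C * K by rewrite mulr_ge0.
all: have cx0 : 0 <= C * `|x| by rewrite mulr_ge0.
all: have cs0 : 0 <= C * `|s| by rewrite mulr_ge0.
all: rewrite ler_norml in cx1; rewrite ler_norml in cs1.
all: move: cx1 cs1 => /andP[cx1 cx2] /andP[cs1 cs2].
all: have kn : k%:R * n%:R = m%:R - C by lra.
all: rewrite ?addr0 ![k%:R * (n%:R * _)]mulrA kn; lra.
Qed.

(** Diagonal choice: [F m] satisfies [Q] with tolerance [1 / k.+1] for the largest possible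
    [k <= m], so that one sequence serves every [e]. The default [d] fills the indices without any
    such [k]. *)
Lemma choose_families (A : Type) (Q : nat -> R -> A -> Prop) (d : A) :
  (forall m e e' (F : A), e <= e' -> Q m e F -> Q m e' F) ->
  (forall e, 0 < e -> exists M, forall m, (M <= m)%N -> exists F : A, Q m e F) ->
  exists F : nat -> A, (forall m, F m = d \/ exists e, Q m e (F m)) /\
    forall e, 0 < e -> exists M, forall m, (M <= m)%N -> Q m e (F m).
Proof.
move=> Qle H.
pose good m k := `[< exists F : A, Q m k.+1%:R^-1 F >].
have /choice[F HF] m : exists F : A, (F = d \/ exists e, Q m e F) /\
    forall k, (k <= m)%N -> good m k -> Q m k.+1%:R^-1 F.
  have [[k0 Hk0]|nk] := pselect (exists k, ((k <= m)%N && good m k)); last first.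
    by exists d; split; [left|move=> k km gk; case: nk; exists k; rewrite km].
  have bnd k : (k <= m)%N && good m k -> (k <= m)%N by case/andP.
  have := ex_maxnP (ex_intro _ k0 Hk0) bnd.
  case=> k /andP[km /asboolP[F HF]] kmax.
  exists F; split; first by right; exists k.+1%:R^-1.
  move=> k1 k1m gk1; apply: Qle HF; rewrite lef_pV2 ?posrE// ler_nat ltnS.
  by apply: kmax; rewrite k1m.
exists F; split; first by move=> m; have [] := HF m.
move=> e e0; have [k ke] := exists_natr_gt e^-1.
have k0 : 0 < k.+1%:R^-1 :> R by rewrite invr_gt0.
have [M HM] := H _ k0.
exists (maxn M k) => m; rewrite geq_max => /andP[Mm km].
have [_ h] := HF m; apply: Qle (h k km _); last by apply/asboolP; exact: HM.
rewrite -[leRHS]invrK lef_pV2 ?posrE ?invr_gt0//; apply: ltW.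
by apply: lt_trans ke _; rewrite ltr_nat.
Qed.

End Achievable.

(** * Homogeneous Moran sets *)

(** Length of a code made of blocks of lengths 0, ..., [k - 1]. *)
Definition tri (k : nat) : nat := \sum_(i < k) i.

Lemma triS k : tri k.+1 = (tri k + k)%N.
Proof. by rewrite /tri big_ord_recr. Qed.

Lemma tri_pred_le k : (k.-1 <= tri k)%N.
Proof. by case: k => // k; rewrite triS leq_addl. Qed.

Section Growth.
Context {R : realType}.

Lemma triE k : (tri k)%:R = k%:R * (k%:R - 1) / 2 :> R.
Proof.
elim: k => [|k IH]; first by rewrite /tri big_ord0 !mul0r.
by rewrite triS natrD IH -natr1; field.
Qed.

(** The factors [expR (j * a)] multiply to [expR (tri k * a)]; [c] pays for the finitely many
    indices below [M]. *)
Lemma prod_growth_ge (m : nat -> R) (a : R) M : (forall j, 0 < m j) ->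
  (forall j, (M <= j)%N -> expR (j%:R * a) <= m j) ->
  exists2 c, 0 < c & forall k, c * expR ((tri k)%:R * a) <= \prod_(j < k) m j.
Proof.
move=> m0 mM.
have prod0 k : 0 < \prod_(j < k) m j by apply: prodr_gt0.
have [c c0 Hc] : exists2 c, 0 < c &
    forall k, (k <= M)%N -> c * expR ((tri k)%:R * a) <= \prod_(j < k) m j.
  elim: M {mM} => [|M [c c0 IH]].
    exists 1 => // k; rewrite leqn0 => /eqP->.
    by rewrite /tri !big_ord0 mul0r expR0 mulr1.
  pose c' := (\prod_(j < M.+1) m j) / expR ((tri M.+1)%:R * a).
  have c'0 : 0 < c' by rewrite divr_gt0 ?expR_gt0.
  exists (Num.min c c'); first by rewrite lt_min c0.
  move=> k; rewrite leq_eqVlt => /predU1P[->|kM].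
    apply: (@le_trans _ _ (c' * expR ((tri M.+1)%:R * a))).
      by rewrite ler_pM2r ?expR_gt0// ge_min lexx orbT.
    by rewrite divfK// gt_eqF// expR_gt0.
  apply: le_trans (IH k kM).
  by rewrite ler_pM2r ?expR_gt0// ge_min lexx.
exists c => // k; have [kM|/ltnW Mk] := leqP k M; first exact: Hc.
have -> : k = (M + (k - M))%N by rewrite subnKC.
elim: (k - M)%N => [|j IH]; first by rewrite addn0; exact: Hc.
rewrite addnS triS natrD mulrDl expRD mulrA big_ord_recr /=.
apply: ler_pM => //; rewrite ?mulr_ge0 ?expR_ge0 ?(ltW c0)//.
by apply: mM; rewrite leq_addr.
Qed.

Lemma prod_growth_le (m : nat -> R) (a : R) M : (forall j, 0 < m j) ->
  (forall j, (M <= j)%N -> m j <= expR (j%:R * a)) ->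
  exists2 c, 0 < c & forall k, \prod_(j < k) m j <= c * expR ((tri k)%:R * a).
Proof.
move=> m0 mM.
have [|j Mj|c c0 Hc] := @prod_growth_ge (fun j => (m j)^-1) (- a) M.
- by move=> j; rewrite invr_gt0.
- by rewrite mulrN expRN lef_pV2 ?posrE ?expR_gt0// mM.
exists c^-1; rewrite ?invr_gt0// => k.
have P0 : 0 < \prod_(j < k) m j by apply: prodr_gt0.
have := Hc k; rewrite prodfV mulrN expRN -[X in X / _]invrK -invfM.
by rewrite lef_pV2 ?posrE// mulr_gt0 ?expR_gt0// invr_gt0.
Qed.

(** The increment [k] is of lower order than [tri k], so consecutive scales are interchangeable at
    the price of [e]. The constant comes from completing the square in [k]. *)
Lemma tri_shift (e s : R) : 0 < e -> exists D, forall k,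
  s * (tri k.+1)%:R <= (s + e) * (tri k)%:R + D.
Proof.
move=> e0; exists ((e / 2 + s) ^+ 2 / (2 * e)) => k.
rewrite triS natrD triE; set x := k%:R.
rewrite -subr_ge0.
have -> : (s + e) * (x * (x - 1) / 2) + (e / 2 + s) ^+ 2 / (2 * e) - s * (x * (x - 1) / 2 + x)
  = e / 2 * (x - (e / 2 + s) / e) ^+ 2 by field; lra.
by rewrite mulr_ge0 ?sqr_ge0//; lra.
Qed.

End Growth.

(** * Mixed radix coding and the dimension of Moran sets *)

Section Moran.
Context {R : realType} {A : eqType}.
Variable F : nat -> seq (seq A).
Hypotheses (F_uniq : forall k, uniq (F k))
  (F_size : forall k w, w \in F k -> size w = k) (F_gt0 : forall k, (0 < size (F k))%N).

Definition moran_count (k : nat) : nat := \prod_(i < k) size (F i).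

(* Mixed radix expansion: [moran_cell k y] runs through [0, ..., moran_count k - 1] as
   [y] runs through [[0, 1[], and its last digit selects the block number [k - 1]. *)
Definition moran_cell k (y : R) : nat := Num.trunc ((moran_count k)%:R * y).

Definition moran_block k y : seq A :=
  nth [::] (F k) (moran_cell k.+1 y %% size (F k)).

Fixpoint moran_code k y : seq A :=
  if k is j.+1 then moran_code j y ++ moran_block j y else [::].

Lemma moran_count_gt0 k : (0 < moran_count k)%N.
Proof. by apply: prodn_gt0 => i; exact: F_gt0. Qed.

Lemma mem_moran_block k y : moran_block k y \in F k.
Proof. by rewrite mem_nth// ltn_mod F_gt0. Qed.

Lemma size_moran_code k y : size (moran_code k y) = tri k.
Proof.
elim: k => [|k IH]; first by rewrite /tri big_ord0.
by rewrite /= size_cat IH triS (F_size (mem_moran_block k y)).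
Qed.

Lemma moran_code_prefix k l y : (k <= l)%N ->
  exists t, moran_code l y = moran_code k y ++ t.
Proof.
move=> /subnKC <-; elim: (l - k)%N => [|j [t IH]]; first by exists [::]; rewrite addn0 cats0.
by exists (t ++ moran_block (k + j) y); rewrite addnS /= IH catA.
Qed.

Lemma moran_cell_div k y : 0 <= y -> (moran_cell k.+1 y %/ size (F k))%N = moran_cell k y.
Proof.
move=> y0; have z0 : 0 <= (moran_count k)%:R * y by rewrite mulr_ge0.
have /andP[h1 h2] := truncn_itv z0; rewrite -/(moran_cell k y) in h1 h2.
have m0 : 0 < (size (F k))%:R :> R by rewrite ltr0n.
have E : (moran_count k.+1)%:R * y = (size (F k))%:R * ((moran_count k)%:R * y).
  by rewrite /moran_count big_ord_recr natrM /= [X in X * y]mulrC mulrA.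
have z0' : 0 <= (moran_count k.+1)%:R * y by rewrite mulr_ge0.
set c := moran_cell k y in h1 h2 *.
have d1 : (size (F k) * c <= moran_cell k.+1 y)%N.
  by rewrite /moran_cell truncn_ge_nat// E natrM ler_pM2l.
have d2 : (moran_cell k.+1 y < size (F k) * c.+1)%N.
  by rewrite /moran_cell truncn_lt_nat// E natrM ltr_pM2l.
apply/eqP; rewrite eqn_leq -ltnS ltn_divLR// mulnC d2 /= leq_divRL// mulnC.
exact: d1.
Qed.

Lemma moran_code_inj k y y' : 0 <= y < 1 -> 0 <= y' < 1 ->
  moran_code k y = moran_code k y' -> moran_cell k y = moran_cell k y'.
Proof.
move=> y01 y01'; have /andP[y0 y1] := y01; have /andP[y0' y1'] := y01'.
elim: k => [_|k IH].
  by rewrite /moran_cell /moran_count !big_ord0 !mul1r !(@truncn_def _ _ 0%N).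
move=> /eqP; rewrite /= eqseq_cat ?size_moran_code// => /andP[/eqP/IH E /eqP Eb].
rewrite (divn_eq (moran_cell k.+1 y) (size (F k))).
rewrite (divn_eq (moran_cell k.+1 y') (size (F k))) !moran_cell_div// E.
congr (_ + _)%N; apply/eqP.
by rewrite -(nth_uniq [::] _ _ (F_uniq k)) ?ltn_mod ?F_gt0//; apply/eqP.
Qed.

(** By [moran_code_inj] all these [y] lie in one interval of the mixed radix partition. *)
Lemma lebesgue_code k w :
  (lebesgue_measure [set y : R | (0 <= y < 1)%R /\ moran_code k y = w]
     <= ((moran_count k)%:R^-1)%:E)%E.
Proof.
set S := [set y | _]; have c0 : 0 < (moran_count k)%:R :> R by rewrite ltr0n moran_count_gt0.
have [->|/set0P[y0 [y001 y0w]]] := eqVneq S set0; first by rewrite measure0 lee_fin invr_ge0 ltW.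
pose c := moran_cell k y0.
have /lebesgue_le/le_trans : S `<=` `[c%:R / (moran_count k)%:R, c.+1%:R / (moran_count k)%:R]%classic.
  move=> y [y01 yw]; have E := moran_code_inj y01 y001 (etrans yw (esym y0w)).
  rewrite /= in_itv /= /c -E ler_pdivrMr// ler_pdivlMr// ![y * _]mulrC.
  have /truncn_itv : 0 <= (moran_count k)%:R * y.
    by rewrite mulr_ge0//; case/andP: y01.
  by move=> /andP[-> /ltW].
apply; rewrite lebesgue_itvcc; last by rewrite ler_pM2r ?invr_gt0// ler_nat.
by rewrite -mulrBl -natr1 addrC addKr mul1r.
Qed.

(** A set of diameter at most [2 ^ - tri k] meets at most [K] codes, so it has mass at most
    [K / moran_count k]. A diameter between two consecutive scales is handled by [tri_shift]. *)
Lemma moran_dim (T : Type) (d : T -> T -> R) (g : R -> T) (E : set T) (b : R) (K : nat) :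
  (forall y, 0 <= y < 1 -> E (g y)) ->
  (forall k U, (diam d U <= (expR (- ((tri k)%:R * ln 2)))%:E)%E ->
     exists J : seq (seq A), (size J <= K)%N /\
       forall y, 0 <= y < 1 -> U (g y) -> moran_code k y \in J) ->
  (forall a, a < b * ln 2 -> exists M, forall j, (M <= j)%N ->
     expR (j%:R * a) <= (size (F j))%:R) ->
  (b%:E <= hausdorff_dim d E)%E.
Proof.
move=> gE cover growth; apply: hausdorff_dim_ge => s s0 sb.
have l2 : 0 < ln 2 :> R by rewrite ln_gt0// ltr1n.
(* The blocks grow at rate [s * ln 2 + 2 * h], strictly below [b * ln 2]; passing from [tri k] to
   [tri k.+1] costs one [h]. *)
pose h := (b - s) * ln 2 / 3.
have h0 : 0 < h by rewrite divr_gt0// mulr_gt0// subr_gt0.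
have hE : b * ln 2 = s * ln 2 + 3 * h by rewrite /h; field.
pose a := s * ln 2 + 2 * h.
have sl0 : 0 <= s * ln 2 by rewrite mulr_ge0// ltW.
have a0 : 0 < a by rewrite /a; lra.
have [M HM] : exists M, forall j, (M <= j)%N -> expR (j%:R * a) <= (size (F j))%:R.
  by apply: growth; rewrite hE /a; lra.
have [|c c0 Hc] := prod_growth_ge _ HM; first by move=> j; rewrite ltr0n.
have cnt_ge k : c * expR ((tri k)%:R * a) <= (moran_count k)%:R.
  by rewrite /moran_count natr_prod.
have c1 k : 0 < (moran_count k)%:R :> R by rewrite ltr0n moran_count_gt0.
have [D HD] := tri_shift (s * ln 2) h0.
pose C := K%:R * (c^-1 * expR D) + K%:R.
have C0 : 0 <= C by rewrite addr_ge0// !mulr_ge0 ?expR_ge0// invr_ge0 ltW.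
pose Y : set R := [set y | 0 <= y < 1].
have lamU k U : (diam d U <= (expR (- ((tri k)%:R * ln 2)))%:E)%E ->
    (lebesgue_measure (Y `&` g @^-1` U) <= (K%:R / (moran_count k)%:R)%:E)%E.
  move=> /cover[J [sJ HJ]].
  apply: (@le_trans _ _ ((size J)%:R * (moran_count k)%:R^-1)%:E); last first.
    by rewrite lee_fin ler_pM2r ?invr_gt0// ler_nat.
  apply: (@lebesgue_seq_le _ _ J _ (fun w => [set y : R | (0 <= y < 1)%R /\ moran_code k y = w])).
  - by rewrite invr_ge0 ltW.
  - by move=> y [Yy Uy]; exists (moran_code k y) => //; exact: HJ.
  - by move=> w; exact: lebesgue_code.
have lamK k : c^-1 * expR D * expR (- (s * ln 2 * (tri k.+1)%:R)) >= (moran_count k)%:R^-1.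
  have e1 : c * expR (s * ln 2 * (tri k.+1)%:R - D) <= (moran_count k)%:R.
    apply: le_trans (cnt_ge k); rewrite ler_pM2l// ler_expR.
    have h2 : 0 <= h * (tri k)%:R by rewrite mulr_ge0// ltW.
    have := HD k; rewrite /a; lra.
  rewrite -mulrA -expRD -[D - _]opprB expRN -invfM lef_pV2 ?posrE ?mulr_gt0 ?expR_gt0//.
have Ypos : (0 < lebesgue_measure Y)%E.
  rewrite (_ : Y = `[0, 1[%classic); last by apply/seteqP; split => y; rewrite /Y /= in_itv.
  by rewrite lebesgue_measure_itv /= lte_fin ltr01 sube0 lte_fin.
apply: (@mass_distribution _ _ d g Y E s 1 C) => // U U0 U1.
have [r /andP[r0 r1] dU] := diam_fin U1.
rewrite (gauge_diam s U0 dU) -EFinM.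
move: r0; rewrite le_eqVlt => /predU1P[r0|r0].
  (* A set of diameter 0 has gauge 1 if [s = 0]. Otherwise its gauge is 0 and its mass must vanish,
     which follows from the estimates at all scales. *)
  have [s00|s_neq0] := eqVneq s 0.
    rewrite s00 powRr0 mulr1; apply: le_trans (lamU 0%N _ _) _.
      by rewrite dU -r0 lee_fin expR_ge0.
    rewrite lee_fin /moran_count big_ord0 divr1 /C lerDr.
    by rewrite !mulr_ge0 ?expR_ge0// invr_ge0 ltW.
  rewrite -r0 powR0// mulr0; apply/lee_addgt0Pr => e e0; rewrite add0e.
  have [n Hn] := exists_natr_gt (K%:R / e / c / a).
  apply: le_trans (lamU n.+1 _ _) _; first by rewrite dU -r0 lee_fin expR_ge0.
  rewrite lee_fin ler_pdivrMr// mulrC -ler_pdivrMr//; apply: le_trans (cnt_ge _).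
  rewrite [leRHS]mulrC -ler_pdivrMr//; apply: le_trans (expR_ge1Dx _).
  apply: (@le_trans _ _ ((tri n.+1)%:R * a)); last by lra.
  rewrite -ler_pdivrMr//; apply: le_trans (ltW Hn) _; rewrite ler_nat.
  exact: (tri_pred_le n.+1).
(* For the least such [k] the diameter [r] is still at most [2 ^ - tri k]. *)
pose P k := expR (- ((tri k.+1)%:R * ln 2)) < r.
have exP : exists k, P k.
  have [n Hn] := exists_natr_gt ((- ln r) / ln 2).
  exists n; rewrite /P -[ltRHS]lnK ?posrE// ltr_expR ltrNl -ltr_pdivrMr//.
  apply: lt_le_trans Hn _; rewrite ler_nat; exact: (tri_pred_le n.+1).
have := ex_minnP exP; case=> k Pk kmin.
apply: le_trans (lamU k _ _) _.
  rewrite dU lee_fin; case: k Pk kmin => [|k] Pk kmin.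
    by rewrite /tri big_ord0 mul0r oppr0 expR0.
  by rewrite leNgt; apply/negP => /kmin; rewrite ltnn.
rewrite lee_fin /C mulrDl; apply: ler_wpDr; first by rewrite mulr_ge0// powR_ge0.
rewrite -mulrA; apply: ler_wpM2l => //; apply: le_trans (lamK k) _.
apply: ler_wpM2l; first by rewrite mulr_ge0 ?expR_ge0// invr_ge0 ltW.
rewrite -[leRHS]lnK ?posrE ?powR_gt0// ler_expR ln_powR.
have : - ((tri k.+1)%:R * ln 2) < ln r by rewrite -ltr_expR lnK ?posrE.
move=> /ltW/(ler_wpM2l s0); lra.
Qed.

End Moran.

(** * The gasket and its slices *)

Section Gasket.
Context {R : realType}.
Variables (p q : nat) (theta : R) (D : set (R * R)).
Hypotheses (p_gt0 : (0 < p)%N) (q_gt0 : (0 < q)%N).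
Hypothesis tan_theta : tan theta = Num.sqrt 3 * p%:R / (2 * q%:R + p%:R).
Hypothesis gasketD : is_sierpinski_gasket D.
Local Notation N := (p + q)%N.
Local Notation dig := (digit p q).
Local Notation val3 := (wval dig).

(* Ordered like the maps [ifs_map], hence the swap of [S1] and [S2]. *)
Definition gmap (k : 'I_3) : R * R -> R * R :=
  match val k with 0%N => @S0 R | 1%N => @S2 R | _ => @S1 R end.

Definition gword (c : seq 'I_3) (z : R * R) : R * R := foldr gmap z c.

(* Affine coordinates in which the three maps are [(u, v) |-> (u, v) / 2] followed by
   a translation by [0], [(0, 1 / 2)] and [(1 / 2, 0)]. *)
Definition ucoord (z : R * R) : R := z.1 - z.2 / Num.sqrt 3.
Definition vcoord (z : R * R) : R := 2 * z.2 / Num.sqrt 3.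
Definition udigit (k : 'I_3) : nat := (val k == 2%N).
Definition vdigit (k : 'I_3) : nat := (val k == 1%N).

(* The projection [proj theta], rescaled so that the gasket projects onto [[0, p + q]]. *)
Definition scoord (z : R * R) : R := q%:R + p%:R * ucoord z - q%:R * vcoord z.

(** Value of [proj theta] at the top vertex [(1/2, sqrt 3 / 2)], the upper end of the shadow.
    [level] sends it to 0, and the lower end [- scale * p / q], the projection of [(1, 0)], to
    [p + q]. *)
Definition scale : R := Num.sqrt 3 * q%:R / (2 * q%:R + p%:R).
Definition level (a : R) : R := q%:R * (1 - a / scale).

Let s3 : 0 < Num.sqrt 3 :> R. Proof. by rewrite sqrtr_gt0. Qed.
Let s3_ge1 : 1 <= Num.sqrt 3 :> R.
Proof. by rewrite -[leLHS]sqrtr1 ler_sqrt// ler1n. Qed.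
Let q0 : 0 < q%:R :> R. Proof. by rewrite ltr0n. Qed.
Let p0 : 0 < p%:R :> R. Proof. by rewrite ltr0n. Qed.

Lemma scale_gt0 : 0 < scale.
Proof. by rewrite divr_gt0 ?mulr_gt0 ?addr_gt0 ?mulr_gt0. Qed.

Lemma sub_level a b : `|a - b| = scale / q%:R * `|level a - level b|.
Proof.
have := scale_gt0 => k0.
have -> : level a - level b = - (q%:R / scale) * (a - b) by rewrite /level; field; lra.
rewrite normrM normrN (ger0_norm (ltW (divr_gt0 q0 k0))) mulrA.
by rewrite (_ : scale / q%:R * _ = 1) ?mul1r//; field; rewrite !gt_eqF.
Qed.

Lemma projE z : Defs.proj theta z = scale * (1 - scoord z / q%:R).
Proof.
rewrite /Defs.proj tan_theta /scale /scoord /ucoord /vcoord.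
field; rewrite !gt_eqF ?addr_gt0 ?mulr_gt0//.
Qed.

Lemma proj_eq z a : Defs.proj theta z = a <-> scoord z = level a.
Proof.
have k0 := scale_gt0; rewrite projE /level; split=> [<-|->]; first by field; rewrite !gt_eqF.
by field; rewrite !gt_eqF.
Qed.

Lemma sliceE a : slice D theta a = [set z | D z /\ scoord z = level a].
Proof.
apply/seteqP; split => [z [[x _ <-] Dz]|z [Dz /proj_eq pz]]; split => //.
  by apply/proj_eq; rewrite /Defs.proj /= addrK.
by exists z.1 => //; rewrite -pz /Defs.proj subrK; case: z {Dz pz}.
Qed.

Lemma ucoord_gmap k z : ucoord (gmap k z) = (ucoord z + (udigit k)%:R) / 2.
Proof.
rewrite /ucoord /gmap /udigit; case: k => -[|[|[|//]]] ? /=; rewrite /S0 /S1 /S2 /=;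
  field; rewrite gt_eqF//.
Qed.

Lemma vcoord_gmap k z : vcoord (gmap k z) = (vcoord z + (vdigit k)%:R) / 2.
Proof.
rewrite /vcoord /gmap /vdigit; case: k => -[|[|[|//]]] ? /=; rewrite /S0 /S1 /S2 /=;
  field; rewrite gt_eqF//.
Qed.

Lemma scoord_gmap k z : scoord (gmap k z) = (scoord z + (dig k)%:R) / 2.
Proof.
rewrite /scoord ucoord_gmap vcoord_gmap /udigit /vdigit /digit.
by case: k => -[|[|[|//]]] ? /=; rewrite ?natrD; field.
Qed.

Lemma coord_gword (f : R * R -> R) (g : 'I_3 -> nat) c z :
  (forall k z, f (gmap k z) = (f z + (g k)%:R) / 2) ->
  f (gword c z) = (f z + (wval g c)%:R) / 2 ^+ size c.
Proof.
move=> fg; elim: c => [|k c IH]; first by rewrite /= /wval /= addr0 expr0 divr1.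
rewrite /= fg IH wval_cons natrD natrM natrX exprS.
by field; rewrite expf_neq0.
Qed.

Lemma gasket_gmap k z : D z -> D (gmap k z).
Proof.
case: gasketD => _ _ DE Dz; rewrite DE /gmap.
by case: (val k) => [|[|?]]; [left; left|right|left; right]; exists z.
Qed.

Lemma gasket_gword c z : D z -> D (gword c z).
Proof. by move=> Dz; elim: c => //= k c IH; exact: gasket_gmap. Qed.

Lemma gasket_preim n z : D z -> exists c z', [/\ size c = n, D z' & z = gword c z'].
Proof.
elim: n z => [|n IH] z Dz; first by exists [::], z.
have [k [w [Dw zE]]] : exists k w, D w /\ z = gmap k w.
  case: gasketD => _ _ DE; move: Dz; rewrite {1}DE => -[[]|] [w Dw <-].
  - by exists ord0, w.
  - by exists ord_max, w.
  - by exists one3, w.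
have [c [z' [sc Dz' wE]]] := IH _ Dw.
by exists (k :: c), z'; rewrite /= sc zE wE.
Qed.

Lemma pow2_gt (x : R) : exists n : nat, x < 2 ^+ n.
Proof.
have [n xn] := exists_natr_gt x; exists n; apply: lt_le_trans xn _.
by rewrite -natrX ler_nat ltnW// ltn_expl.
Qed.

(** Self-similarity: writing a point as an image under a word of length [n] divides the unknown
    bound [B] by [2 ^ n], and the translation part lies in [[0, G * (1 - 2 ^ - n)]]. *)
Lemma coord_range (f : R * R -> R) (g : 'I_3 -> nat) (G : nat) :
  (forall k z, f (gmap k z) = (f z + (g k)%:R) / 2) -> (forall k, (g k <= G)%N) ->
  (exists B, forall z, D z -> `|f z| <= B) -> forall z, D z -> 0 <= f z <= G%:R.
Proof.
move=> fg gG [B HB].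
have wG c : (wval g c + G <= G * 2 ^ size c)%N.
  elim/last_ind: c => [|c k IH]; first by rewrite muln1.
  by rewrite wval_rcons size_rcons expnS; have h := gG k; clear -IH h; lia.
have key z e : D z -> 0 < e -> - e < f z /\ f z < G%:R + e.
  move=> Dz e0; have [n Hn] := pow2_gt (B / e).
  have [c [z' [sc Dz' ->]]] := gasket_preim n Dz.
  have t0 : 0 < 2 ^+ n :> R by rewrite exprn_gt0.
  rewrite ltr_pdivrMr// in Hn.
  have := HB _ Dz'; rewrite ler_norml => /andP[h1 h2].
  rewrite (coord_gword _ _ fg) sc ltr_pdivlMr// ltr_pdivrMr//.
  have : (wval g c + G)%:R <= (G * 2 ^ n)%:R :> R by rewrite -sc ler_nat.
  rewrite natrD natrM natrX => h3; have h4 : 0 <= (wval g c)%:R :> R by [].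
  have h5 : 0 <= G%:R :> R by [].
  by split; lra.
move=> z Dz; apply/andP; split; apply/ler_addgt0Pr => e e0; have [h1 h2] := key z e Dz e0.
  by lra.
by apply: ltW.
Qed.

Lemma gasket_cluster (u : nat -> R * R) : (forall n, D (u n)) ->
  exists2 z, D z & forall e M, 0 < e -> exists n,
    [/\ (M <= n)%N, `|z.1 - (u n).1| < e & `|z.2 - (u n).2| < e].
Proof.
move=> Du; case: gasketD => _ cD _.
have [|z [Dz zc]] := cD (u @ \oo) _; first by exists 0%N => // n _; exact: Du.
exists z => // e M e0.
have [||_ [[n /= Mn <-] [h1 h2]]] := zc (u @` [set n | (M <= n)%N]) (ball z e).
- by exists M => // n Mn; exists n.
- exact: nbhsx_ballx.
by exists n.
Qed.

Lemma gasket_bounded : exists B, forall z, D z -> `|z.1| <= B /\ `|z.2| <= B.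
Proof.
case: gasketD => _ /compact_bounded[B [_ HB]] _; exists (B + 1) => z Dz.
have : `|z| <= B + 1 := HB (B + 1) (ltr_pwDr ltr01 (lexx B)) z Dz.
by rewrite prod_normE ge_max => /andP[].
Qed.

Lemma ucoord_sub z w : `|ucoord z - ucoord w| <= `|z.1 - w.1| + `|z.2 - w.2|.
Proof.
rewrite /ucoord; have -> : z.1 - z.2 / Num.sqrt 3 - (w.1 - w.2 / Num.sqrt 3) =
  (z.1 - w.1) - (z.2 - w.2) / Num.sqrt 3 by rewrite mulrBl; ring.
apply: le_trans (ler_normB _ _) _; rewrite lerD2l normrM [`|(Num.sqrt 3)^-1|]gtr0_norm ?invr_gt0//.
by rewrite ler_piMr// invf_le1.
Qed.

Lemma vcoord_sub z w : `|vcoord z - vcoord w| <= 2 * `|z.2 - w.2|.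
Proof.
rewrite /vcoord -mulrBl -mulrBr normrM [`|(Num.sqrt 3)^-1|]gtr0_norm ?invr_gt0//.
by rewrite normrM ger0_norm// ler_piMr ?mulr_ge0// invf_le1.
Qed.

Lemma ucoord_range z : D z -> 0 <= ucoord z <= 1.
Proof.
apply: (@coord_range _ _ 1%N ucoord_gmap) => [k|]; first by rewrite /udigit; case: eqP.
have [B HB] := gasket_bounded; exists (B + B) => w /HB[h1 h2].
have := ucoord_sub w 0; rewrite /ucoord /= mul0r !subr0 => /le_trans; apply.
exact: lerD.
Qed.

Lemma vcoord_range z : D z -> 0 <= vcoord z <= 1.
Proof.
apply: (@coord_range _ _ 1%N vcoord_gmap) => [k|]; first by rewrite /vdigit; case: eqP.
have [B HB] := gasket_bounded; exists (2 * B) => w /HB[h1 h2].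
have := vcoord_sub w 0; rewrite /vcoord /= mulr0 mul0r !subr0 => /le_trans; apply.
by rewrite ler_pM2l.
Qed.

Lemma scoord_range z : D z -> 0 <= scoord z <= N%:R.
Proof.
apply: (coord_range scoord_gmap) => [k|].
  by rewrite /digit; case: (val k) => [|[|?]]; rewrite ?leq_addl.
exists (q%:R + p%:R + q%:R) => w Dw.
have /andP[u0 u1] := ucoord_range Dw; have /andP[v0 v1] := vcoord_range Dw.
have pu : 0 <= p%:R * ucoord w <= p%:R by rewrite mulr_ge0//= ler_piMr.
have qv : 0 <= q%:R * vcoord w <= q%:R by rewrite mulr_ge0//= ler_piMr.
rewrite /scoord ler_norml; apply/andP; split; lra.
Qed.

Lemma scoord_sub z w : `|scoord z - scoord w| <= N%:R * (2 * (`|z.1 - w.1| + `|z.2 - w.2|)).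
Proof.
rewrite /scoord.
have -> : q%:R + p%:R * ucoord z - q%:R * vcoord z - (q%:R + p%:R * ucoord w - q%:R * vcoord w) =
  p%:R * (ucoord z - ucoord w) - q%:R * (vcoord z - vcoord w) by ring.
apply: le_trans (ler_normB _ _) _; rewrite !normrM (ger0_norm (ltW p0)) (ger0_norm (ltW q0)).
rewrite natrD mulrDl; apply: lerD; rewrite ler_pM2l//.
  apply: le_trans (ucoord_sub _ _) _; have := normr_ge0 (z.1 - w.1).
  have := normr_ge0 (z.2 - w.2); lra.
by apply: le_trans (vcoord_sub _ _) _; rewrite ler_pM2l// lerDr.
Qed.

Lemma gasket_eq z w : ucoord z = ucoord w -> vcoord z = vcoord w -> z = w.
Proof.
case: z w => [z1 z2] [w1 w2]; rewrite /ucoord /vcoord /= => h1 h2.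
have E : z2 = w2.
  have : 2 * z2 / Num.sqrt 3 * (Num.sqrt 3 / 2) = 2 * w2 / Num.sqrt 3 * (Num.sqrt 3 / 2) by rewrite h2.
  have c (x : R) : 2 * x / Num.sqrt 3 * (Num.sqrt 3 / 2) = x by field; rewrite gt_eqF.
  by rewrite !c.
by rewrite E in h1 *; move/addIr: h1 => ->.
Qed.

Lemma dist2_coord z w : dist2 z w <= 2 * (`|ucoord z - ucoord w| + `|vcoord z - vcoord w|).
Proof.
have E2 : z.2 - w.2 = Num.sqrt 3 / 2 * (vcoord z - vcoord w).
  by rewrite /vcoord; field; rewrite gt_eqF.
have E1 : z.1 - w.1 = (ucoord z - ucoord w) + (vcoord z - vcoord w) / 2.
  by rewrite /ucoord /vcoord; field; rewrite gt_eqF.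
rewrite /dist2 E1 E2; set a := ucoord z - _; set b := vcoord z - _.
have -> : (Num.sqrt 3 / 2 * b) ^+ 2 = 3 / 4 * b ^+ 2.
  by rewrite !exprMn exprVn sqr_sqrtr//; congr (_ * _); field.
rewrite -[leRHS]ger0_norm ?mulr_ge0 ?addr_ge0// -sqrtr_sqr; apply: ler_wsqrtr.
have ha := real_normK (num_real a); have hb := real_normK (num_real b).
have hab : a * b <= `|a| * `|b| by rewrite -normrM ler_norm.
have := normr_ge0 a; have := normr_ge0 b; nra.
Qed.

Lemma coord_dist2 (z w : R * R) : `|z.1 - w.1| <= dist2 z w /\ `|z.2 - w.2| <= dist2 z w.
Proof.
rewrite /dist2 -!sqrtr_sqr; split; apply: ler_wsqrtr.
  by rewrite lerDl sqr_ge0.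
by rewrite lerDr sqr_ge0.
Qed.

Lemma dist2_gword c z w : D z -> D w -> dist2 (gword c z) (gword c w) <= 4 / 2 ^+ size c.
Proof.
move=> Dz Dw; apply: le_trans (dist2_coord _ _) _.
rewrite !(coord_gword _ _ ucoord_gmap) !(coord_gword _ _ vcoord_gmap) -!mulrBl.
have t0 : 0 < 2 ^+ size c :> R by rewrite exprn_gt0.
rewrite !normrM [`|(2 ^+ _)^-1|]gtr0_norm ?invr_gt0// -mulrDl mulrA ler_pM2r ?invr_gt0//.
have /andP[a1 a2] := ucoord_range Dz; have /andP[a3 a4] := ucoord_range Dw.
have /andP[b1 b2] := vcoord_range Dz; have /andP[b3 b4] := vcoord_range Dw.
have ha : `|ucoord z + (wval udigit c)%:R - (ucoord w + (wval udigit c)%:R)| <= 1.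
  by rewrite ler_norml; apply/andP; split; lra.
have hb : `|vcoord z + (wval vdigit c)%:R - (vcoord w + (wval vdigit c)%:R)| <= 1.
  by rewrite ler_norml; apply/andP; split; lra.
lra.
Qed.

(** By [gap] some triangle of generation [n] has all its levels within [N / 2 ^ n] of [x];
    compactness gives the point. *)
Lemma gasket_level x : 0 <= x <= N%:R -> exists2 z, D z & scoord z = x.
Proof.
move=> /andP[x0 xN]; have [[z0 Dz0] _ _] := gasketD.
have /choice[u Hu] n : exists z, D z /\ `|scoord z - x| <= N%:R / 2 ^+ n.
  have t0 : 0 < 2 ^+ n :> R by rewrite exprn_gt0.
  have N0 : (0 < N * 2 ^ n)%N by rewrite muln_gt0 addn_gt0 p_gt0 expn_gt0.
  have nx0 : 0 <= 2 ^+ n * x by rewrite mulr_ge0// ltW.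
  have [Y [YN Y1 Y2]] : exists Y : nat, [/\ (Y < N * 2 ^ n)%N, Y%:R <= 2 ^+ n * x &
      2 ^+ n * x <= Y.+1%:R].
    have /andP[h1 h2] := truncn_itv nx0.
    have [YN|YN] := ltnP (Num.trunc (2 ^+ n * x)) (N * 2 ^ n).
      by exists (Num.trunc (2 ^+ n * x)); split => //; exact: ltW.
    exists (N * 2 ^ n).-1; rewrite !prednK// leqnn; split => //.
      apply: le_trans h1; rewrite ler_nat; apply: leq_trans YN; exact: leq_pred.
    by rewrite natrM natrX mulrC ler_pM2r.
  have [c cn /andP[c1 c2]] := gap p_gt0 q_gt0 YN.
  exists (gword c z0); split; first exact: gasket_gword.
  rewrite (coord_gword _ _ scoord_gmap) cn.
  have -> : (scoord z0 + (val3 c)%:R) / 2 ^+ n - x =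
      (scoord z0 + (val3 c)%:R - 2 ^+ n * x) / 2 ^+ n by field; rewrite gt_eqF.
  rewrite normrM [`|(2 ^+ _)^-1|]gtr0_norm ?invr_gt0// ler_pM2r ?invr_gt0//.
  have /andP[s0 s1] := scoord_range Dz0.
  have c1' : (val3 c)%:R <= Y%:R :> R by rewrite ler_nat.
  have c2' : Y.+1%:R <= (val3 c)%:R + N%:R :> R by rewrite -natrD ler_nat.
  by rewrite ler_norml; apply/andP; split; lra.
have [z Dz Hz] := gasket_cluster (fun n => (Hu n).1).
exists z => //; apply/eqP; rewrite -subr_eq0 -normr_le0; apply/ler_addgt0Pr => e e0.
have N0 : 0 < N%:R :> R by rewrite ltr0n addn_gt0 p_gt0.
have [M HM] := pow2_gt (N%:R / (e / 2)).
have e8 : 0 < e / 8 / N%:R by rewrite !divr_gt0.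
have [n [Mn h1 h2]] := Hz _ M e8.
have h3 := (Hu n).2.
have h4 : N%:R / 2 ^+ n <= e / 2.
  rewrite ler_pdivrMr ?exprn_gt0// mulrC -ler_pdivrMr; last by lra.
  by apply: le_trans (ltW HM) _; rewrite ler_eXn2l// ltr1n.
have h5 := scoord_sub z (u n).
have h6 : N%:R * (2 * (`|z.1 - (u n).1| + `|z.2 - (u n).2|)) <= e / 2.
  have -> : e / 2 = N%:R * (2 * (e / 8 / N%:R + e / 8 / N%:R)) by field; rewrite gt_eqF ?addr_gt0.
  by rewrite ler_pM2l// ler_pM2l// lerD// ltW.
have -> : scoord z - x = (scoord z - scoord (u n)) + (scoord (u n) - x) by ring.
rewrite add0r; apply: le_trans (ler_normD _ _) _; lra.
Qed.

Lemma shadowE a : shadow D theta a <-> 0 <= level a <= N%:R.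
Proof.
split=> [[z Dz /proj_eq <-]|/gasket_level[z Dz /proj_eq za]]; first exact: scoord_range.
by exists z.
Qed.

End Gasket.

(** * Upper bounds *)

Lemma uvdigit_inj (c c' : seq 'I_3) : size c = size c' ->
  wval udigit c = wval udigit c' -> wval vdigit c = wval vdigit c' -> c = c'.
Proof.
elim/last_ind: c c' => [|c k IH] c'; first by case: c'.
elim/last_ind: c' => [|c' k' _]; rewrite !size_rcons// => -[sc].
rewrite !wval_rcons => Eu Ev.
have : (udigit k < 2)%N /\ (udigit k' < 2)%N by rewrite /udigit; split; case: eqP.
have : (vdigit k < 2)%N /\ (vdigit k' < 2)%N by rewrite /vdigit; split; case: eqP.
move=> [v1 v2] [u1 u2].
have [Eu1 Eu2] : wval udigit c = wval udigit c' /\ udigit k = udigit k' by lia.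
have [Ev1 Ev2] : wval vdigit c = wval vdigit c' /\ vdigit k = vdigit k' by lia.
rewrite (IH _ sc Eu1 Ev1); congr rcons; apply: val_inj; move: Eu2 Ev2.
by rewrite /udigit /vdigit; case: k {Eu Ev v1 u1} => -[|[|[|//]]] ?; case: k' {v2 u2} => -[|[|[|//]]].
Qed.

Section Covers.
Context {R : realType}.

Lemma near_window (a b k : nat) (x y r : R) : a%:R <= x <= a.+1%:R -> b%:R <= y <= b.+1%:R ->
  `|x - y| <= r -> r + 1 <= k%:R -> a \in iota (b - k) (2 * k).+1.
Proof.
move=> /andP[ax xa] /andP[yb by_]; rewrite ler_norml => /andP[xy1 xy2] rk.
rewrite -natr1 in xa; rewrite -natr1 in by_.
have h1 : (a <= b + k)%N by rewrite -(ler_nat R) natrD; lra.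
have h2 : (b <= a + k)%N by rewrite -(ler_nat R) natrD; lra.
by rewrite mem_iota; clear -h1 h2; lia.
Qed.

Lemma expR_pow2 n : expR (n%:R * ln 2) = 2 ^+ n :> R.
Proof. by rewrite expRM_natl lnK ?posrE. Qed.

Lemma expR_small (c B e : R) : 0 < c -> 0 < e -> exists M : nat, forall n, (M <= n)%N ->
  B * expR (- (n%:R * c)) <= e.
Proof.
move=> c0 e0; have [M HM] := exists_natr_gt (B / e / c).
exists M => n Mn; rewrite expRN ler_pdivrMr ?expR_gt0// mulrC -ler_pdivrMr//.
apply: le_trans (expR_ge1Dx _); apply: (@le_trans _ _ (n%:R * c)); last by lra.
by rewrite -ler_pdivrMr//; apply: le_trans (ltW HM) _; rewrite ler_nat.
Qed.

Lemma powR_scale (C s : R) n : 0 < C ->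
  (C / 2 ^+ n) `^ s = C `^ s * expR (- (n%:R * (s * ln 2))).
Proof.
move=> C0; rewrite powRM ?(ltW C0) ?invr_ge0//; congr (_ * _).
rewrite -expR_pow2 -expRN -[LHS]lnK ?posrE ?powR_gt0 ?expR_gt0//.
by rewrite ln_powR expRK; congr expR; ring.
Qed.

Variables (p q : nat) (theta : R) (D : set (R * R)).
Hypotheses (p_gt0 : (0 < p)%N) (q_gt0 : (0 < q)%N).
Hypothesis tan_theta : tan theta = Num.sqrt 3 * p%:R / (2 * q%:R + p%:R).
Hypothesis gasketD : is_sierpinski_gasket D.
Local Notation N := (p + q)%N.
Local Notation val3 := (wval (digit p q)).
Local Notation val2 := (wval bit).
Local Notation wn := (@wnorm R p q).
Local Notation P := (@pressure R p q).
Local Notation lev := (@level R p q).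

(** The coordinates are 2-Lipschitz, so the integer positions of the triangles met by [U] lie in two
    windows of size independent of [n], and the two positions determine the word by
    [uvdigit_inj]. *)
Lemma overlap (r : R) : exists K : nat, forall n U,
  (diam dist2 U <= (r / 2 ^+ n)%:E)%E -> exists J : seq (seq 'I_3),
    (size J <= K)%N /\ forall c z, size c = n -> D z -> U (gword c z) -> c \in J.
Proof.
have [k rk] := exists_natr_gt (2 * r + 1).
exists ((2 * k).+1 * (2 * k).+1)%N => n U /diam_fin[d /andP[d0 dr] dU].
have [[c0 [z0 [sc0 Dz0 Uz0]]]|H] :=
    pselect (exists c z, [/\ size c = n, D z & U (gword c z)]); last first.
  by exists [::]; split => // c z sc Dz Uz; case: H; exists c, z.
pose W (g : 'I_3 -> nat) := iota (wval g c0 - k) (2 * k).+1.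
pose J := [seq c <- words 'I_3 n | (wval udigit c \in W udigit) && (wval vdigit c \in W vdigit)].
exists J; split.
  have -> : ((2 * k).+1 * (2 * k).+1)%N = size [seq (x, y) | x <- W udigit, y <- W vdigit].
    by rewrite size_allpairs !size_iota.
  rewrite -(size_map (fun c => (wval udigit c, wval vdigit c))); apply: uniq_leq_size.
    rewrite map_inj_in_uniq ?filter_uniq ?words_uniq// => c c'.
    rewrite !mem_filter !mem_words => /andP[_ /eqP sc] /andP[_ /eqP sc'] [].
    by apply: uvdigit_inj; rewrite sc sc'.
  move=> _ /mapP[c + ->]; rewrite mem_filter => /andP[/andP[h1 h2] _].
  by apply/allpairsP; exists (wval udigit c, wval vdigit c).
move=> c z sc Dz Uz; rewrite mem_filter mem_words sc eqxx andbT.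
have dd : dist2 (gword c z) (gword c0 z0) <= r / 2 ^+ n.
  by apply: le_trans dr; rewrite -lee_fin -dU; exact: le_diam.
have [x1 x2] := coord_dist2 (gword c z) (gword c0 z0).
have t0 : 0 < 2 ^+ n :> R by rewrite exprn_gt0.
have win (f : R * R -> R) (g : 'I_3 -> nat) : (forall k z, f (gmap k z) = (f z + (g k)%:R) / 2) ->
    (forall z, D z -> 0 <= f z <= 1) ->
    `|f (gword c z) - f (gword c0 z0)| <= 2 * (r / 2 ^+ n) -> wval g c \in W g.
  move=> fg f01 hf.
  apply: (@near_window _ _ _ (2 ^+ n * f (gword c z)) (2 ^+ n * f (gword c0 z0)) (2 * r)).
  - rewrite (coord_gword _ _ fg) sc mulrC divfK ?gt_eqF//.
    by have /andP[h1 h2] := f01 _ Dz; rewrite -natr1; apply/andP; split; lra.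
  - rewrite (coord_gword _ _ fg) sc0 mulrC divfK ?gt_eqF//.
    by have /andP[h1 h2] := f01 _ Dz0; rewrite -natr1; apply/andP; split; lra.
  - rewrite -mulrBr normrM gtr0_norm// mulrC -ler_pdivlMr//.
    by rewrite -mulrA.
  - exact: ltW.
rewrite (win ucoord udigit (@ucoord_gmap R) (ucoord_range gasketD)) /=; last first.
  by apply: le_trans (ucoord_sub _ _) _; lra.
rewrite (win vcoord vdigit (@vcoord_gmap R) (vcoord_range gasketD))//.
by apply: le_trans (vcoord_sub _ _) _; lra.
Qed.

(** The cover consists of images of [D] under [gword c], of diameter at most [4 / 2 ^ n]; those
    meeting the slice have the level in their projection. *)
Lemma slice_null s a : 0 <= s ->
  (forall e (M : nat), 0 < e -> exists n (J : seq (seq 'I_3)), [/\ (M <= n)%N,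
     forall c, size c = n -> (val3 c)%:R <= 2 ^+ n * lev a <= (val3 c + N)%:R -> c \in J &
     (size J)%:R * (4 / 2 ^+ n) `^ s <= e]) ->
  hausdorff_measure dist2 s (slice D theta a) = 0%E.
Proof.
move=> s0 H; apply: hausdorff_null_finite => // r e r0 e0.
have [M HM] := pow2_gt (4 / r); rewrite ltr_pdivrMr// in HM.
have [n [J [Mn HJ cJ]]] := H e M e0.
have t0 : 0 < 2 ^+ n :> R by rewrite exprn_gt0.
exists (4 / 2 ^+ n), [seq gword c @` D | c <- [seq c <- J | size c == n]]; split.
- apply/andP; split; first by apply: divr_ge0 => //; exact: ltW.
  rewrite ler_pdivrMr// mulrC; apply: le_trans (ltW HM) _.
  by rewrite ler_pM2r// ler_eXn2l// ltr1n.
- move=> z; rewrite (sliceE D p_gt0 q_gt0 tan_theta) => -[Dz zl].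
  have [c [z' [sc Dz' zE]]] := gasket_preim gasketD n Dz.
  exists (gword c @` D); last by exists z'.
  apply: map_f; rewrite mem_filter sc eqxx; apply: HJ => //.
  rewrite -zl zE (coord_gword _ _ (@scoord_gmap R p q)) sc mulrC divfK ?gt_eqF//.
  have /andP[h1 h2] := scoord_range p q gasketD Dz'.
  by rewrite natrD; apply/andP; split; lra.
- move=> _ /mapP[c + ->]; rewrite mem_filter => /andP[/eqP sc _].
  apply: diam_le => [|_ _ [z Dz <-] [w Dw <-]]; first by rewrite divr_ge0// ltW.
  by rewrite -sc; exact: (dist2_gword gasketD).
apply: le_trans cJ; rewrite ler_wpM2r ?powR_ge0// ler_nat size_map size_filter.
exact: count_size.
Qed.

Definition level_words n (x : R) :=
  [seq c <- words 'I_3 n | (val3 c)%:R <= 2 ^+ n * x <= (val3 c + N)%:R].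

Lemma mem_level_words n x c : size c = n ->
  (val3 c)%:R <= 2 ^+ n * x <= (val3 c + N)%:R -> c \in level_words n x.
Proof. by move=> sc h; rewrite mem_filter h mem_words sc eqxx. Qed.

Lemma size_level_words n x X : X%:R < 2 ^+ n * x < X.+1%:R ->
  (size (level_words n x) <= tot p q n X)%N.
Proof.
move=> /andP[h1 h2]; rewrite size_filter /tot; apply: sub_count => c /andP[c1 c2].
have c3 := le_lt_trans c1 h2; have c4 := lt_le_trans h1 c2.
by rewrite ltr_nat ltnS in c3; rewrite ltr_nat in c4; rewrite c3 c4.
Qed.

(** If [2 ^ n * x] is an integer [X], it may be the right end of a window, which then contains the
    cell [X - 1] but not the cell [X]. *)
Lemma size_level_words2 n x : 0 <= x ->
  (size (level_words n x) <=
     tot p q n (Num.trunc (2 ^+ n * x)) + tot p q n (Num.trunc (2 ^+ n * x)).-1)%N.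
Proof.
move=> x0; have nx0 : 0 <= 2 ^+ n * x by rewrite mulr_ge0.
have /andP[h1 h2] := truncn_itv nx0; set X := Num.trunc _ in h1 h2 *.
rewrite size_filter /tot -count_predUI; apply: leq_trans (leq_addr _ _).
apply: sub_count => c /andP[c1 c2] /=.
have c3 := le_lt_trans c1 h2; have c4 := le_trans h1 c2.
rewrite ltr_nat in c3; rewrite ler_nat in c4.
clear -c3 c4 p_gt0; lia.
Qed.

(** Otherwise, at arbitrarily large [n], both cells next to the level have small counts, and covers
    by so few triangles make the measure of dimension [delta - e / 2] vanish. The bound [X + 2]
    allows [X] to be the cell just below that of the level. *)
Lemma slice_dim_large a delta e : shadow D theta a -> 0 < e -> e <= delta ->
  (delta%:E <= hausdorff_dim dist2 (slice D theta a))%E ->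
  exists M, forall n, (M <= n)%N -> exists X : nat, [/\ (X < N * 2 ^ n)%N,
    expR (n%:R * ((delta - e) * ln 2)) <= (tot p q n X)%:R &
    X%:R <= 2 ^+ n * lev a <= X%:R + 2].
Proof.
move=> /(shadowE p_gt0 q_gt0 tan_theta gasketD)/andP[l0 lN] e0 ed dimE; apply: contrapT => H.
have l2 : 0 < ln 2 :> R by rewrite ln_gt0// ltr1n.
have s0 : 0 < delta - e / 2 by lra.
suff /hausdorff_dim_le : hausdorff_measure dist2 (delta - e / 2) (slice D theta a) = 0%E.
  by move=> /(_ (ltW s0))/(le_trans dimE); rewrite lee_fin; lra.
apply: slice_null; first exact: ltW.
move=> e' M e'0.
have el : 0 < e / 2 * ln 2 by rewrite mulr_gt0//; lra.
have [M' HM'] := expR_small (2 * 4 `^ (delta - e / 2)) el e'0.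
have [n [Mn Hn]] : exists n, (maxn M M' <= n)%N /\ ~ exists X : nat, [/\ (X < N * 2 ^ n)%N,
    expR (n%:R * ((delta - e) * ln 2)) <= (tot p q n X)%:R &
    X%:R <= 2 ^+ n * lev a <= X%:R + 2].
  apply: contrapT => H'; apply: H; exists (maxn M M') => n Mn; apply: contrapT => Hn.
  by apply: H'; exists n.
move: Mn; rewrite geq_max => /andP[Mn M'n].
exists n, (level_words n (lev a)); split => //; first by move=> c; exact: mem_level_words.
have small X : X%:R <= 2 ^+ n * lev a <= X%:R + 2 ->
    (tot p q n X)%:R <= expR (n%:R * ((delta - e) * ln 2)).
  move=> hX; have [XN|XN] := ltnP X (N * 2 ^ n); last by rewrite tot_out// expR_ge0.
  by apply: ltW; rewrite ltNge; apply/negP => h; apply: Hn; exists X.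
have nx0 : 0 <= 2 ^+ n * lev a by rewrite mulr_ge0.
have /andP[h1 h2] := truncn_itv nx0; rewrite -natr1 in h2.
have sJ : (size (level_words n (lev a)))%:R <= 2 * expR (n%:R * ((delta - e) * ln 2)).
  apply: (@le_trans _ _ ((tot p q n (Num.trunc (2 ^+ n * lev a)))%:R +
     (tot p q n (Num.trunc (2 ^+ n * lev a)).-1)%:R)).
    by rewrite -natrD ler_nat size_level_words2.
  have -> (x : R) : 2 * x = x + x by ring.
  apply: lerD; apply: small; first by apply/andP; split; lra.
  move: h1 h2; case: (Num.trunc _) => [|k] h1 h2 /=; first by apply/andP; split; lra.
  by rewrite -natr1 in h1 h2; apply/andP; split; lra.
apply: le_trans (HM' n M'n); apply: (@le_trans _ _ (2 * expR (n%:R * ((delta - e) * ln 2)) *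
   (4 / 2 ^+ n) `^ (delta - e / 2))).
  by rewrite ler_wpM2r ?powR_ge0.
rewrite powR_scale// mulrACA -expRD.
by rewrite le_eqVlt; apply/orP; left; apply/eqP; congr (_ * expR _); field.
Qed.

Lemma level_cover_null (E : set R) (Xs : nat -> seq nat) (s b C : R) (M0 : nat) :
  0 <= s -> b < s * ln 2 ->
  (forall n, (M0 <= n)%N -> (size (Xs n))%:R <= C * expR (n%:R * b)) ->
  (forall n a, (M0 <= n)%N -> E a ->
     exists2 X, X \in Xs n & X%:R <= 2 ^+ n * lev a <= X%:R + 2) ->
  hausdorff_measure dist1 s E = 0%E.
Proof.
move=> s0 bs sXs EXs; apply: hausdorff_null_finite => // r e r0 e0.
have q0 : 0 < q%:R :> R by rewrite ltr0n.
(* Two levels sharing an index [X] come from values of [a] at distance at most [c / 2 ^ n]. *)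
pose c := scale p q / q%:R * 2 : R.
have c0 : 0 < c by rewrite mulr_gt0// divr_gt0// scale_gt0.
have [M HM] := pow2_gt (c / r); rewrite ltr_pdivrMr// in HM.
have d0 : 0 < s * ln 2 - b by rewrite subr_gt0.
have [M' HM'] := expR_small (C * c `^ s) d0 e0.
pose n := maxn (maxn M M') M0.
have [Mn [M'n M0n]] : (M <= n)%N /\ (M' <= n)%N /\ (M0 <= n)%N.
  by rewrite /n !leq_max !leqnn !orbT.
have t0 : 0 < 2 ^+ n :> R by rewrite exprn_gt0.
have cn0 : 0 <= c / 2 ^+ n by rewrite divr_ge0// ltW.
exists (c / 2 ^+ n), [seq [set a : R | (X%:R <= 2 ^+ n * lev a <= X%:R + 2)%R] | X <- Xs n]; split.
- rewrite cn0 ler_pdivrMr// mulrC; apply: le_trans (ltW HM) _.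
  by rewrite ler_pM2r// ler_eXn2l// ltr1n.
- move=> a /(EXs n a M0n)[X XX h].
  by exists [set a : R | (X%:R <= 2 ^+ n * lev a <= X%:R + 2)%R] => //; exact: map_f.
- move=> _ /mapP[X _ ->]; apply: diam_le => // x y /= /andP[x1 x2] /andP[y1 y2].
  rewrite /dist1 (sub_level p_gt0 q_gt0) /c -[leRHS]mulrA ler_pM2l; last first.
    by rewrite divr_gt0// scale_gt0.
  rewrite ler_pdivlMr// -[X in _ * X]gtr0_norm// -normrM ler_norml.
  by apply/andP; split; lra.
rewrite size_map; apply: le_trans (HM' n M'n).
apply: (@le_trans _ _ (C * expR (n%:R * b) * (c / 2 ^+ n) `^ s)).
  by rewrite ler_wpM2r ?powR_ge0// sXs.
rewrite powR_scale// mulrACA -expRD.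
by rewrite le_eqVlt; apply/orP; left; apply/eqP; congr (_ * expR _); ring.
Qed.

Lemma Gamma_le1 delta : (Gamma D theta delta <= 1%:E)%E.
Proof.
have l2 : 0 < ln 2 :> R by rewrite ln_gt0// ltr1n.
apply/lee_addgt0Pr => e e0; rewrite -EFinD; apply: hausdorff_dim_le; first by lra.
apply: (@level_cover_null _ (fun n => iota 0 (N * 2 ^ n)) _ (ln 2) N%:R 0%N).
- lra.
- by rewrite mulrDl mul1r ltrDl mulr_gt0.
- by move=> n _; rewrite size_iota natrM expR_pow2 natrX.
move=> n a _ [/(shadowE p_gt0 q_gt0 tan_theta gasketD)/andP[l0 lN] _].
have t0 : 0 < 2 ^+ n :> R by rewrite exprn_gt0.
have N0 : (0 < N * 2 ^ n)%N by rewrite muln_gt0 addn_gt0 p_gt0 expn_gt0.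
have nx0 : 0 <= 2 ^+ n * lev a by rewrite mulr_ge0.
have /andP[h1 h2] := truncn_itv nx0.
have [YN|YN] := ltnP (Num.trunc (2 ^+ n * lev a)) (N * 2 ^ n).
  exists (Num.trunc (2 ^+ n * lev a)); first by rewrite mem_iota.
  by rewrite -natr1 in h2; apply/andP; split; lra.
have e1 : (N * 2 ^ n).-1%:R + 1 = N%:R * 2 ^+ n :> R.
  by rewrite natr1 prednK// natrM natrX.
exists (N * 2 ^ n).-1; first by rewrite mem_iota /= add0n prednK.
have h3 : (N * 2 ^ n)%:R <= 2 ^+ n * lev a by apply: le_trans h1; rewrite ler_nat.
rewrite natrM natrX in h3.
have h4 : 2 ^+ n * lev a <= N%:R * 2 ^+ n by rewrite mulrC ler_pM2r.
by apply/andP; split; lra.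
Qed.

Lemma Gamma_le_legendre delta : delta <= bmax p q ->
  (Gamma D theta delta <= (legendre p q delta)%:E)%E.
Proof.
move=> db; have [d0|d0] := leP delta 0.
  by apply: le_trans (Gamma_le1 _) _; rewrite lee_fin legendre_ge1.
have l2 : 0 < ln 2 :> R by rewrite ln_gt0// ltr1n.
have L0 := legendre_ge0 p_gt0 q_gt0 db.
apply/lee_addgt0Pr => h h0; rewrite -EFinD; set s := legendre p q delta + h.
have s0 : 0 <= s by rewrite /s; lra.
apply: hausdorff_dim_le => //.
have [_ [t /= t0 <-] tL] : exists2 x : R, [set - delta * t + P t / ln 2 | t in [set t | 0 < t]] x &
    x < legendre p q delta + h / 2.
  apply: inf_adherent; first by lra.
  by split; [exact: legendre_nonempty|exists 0; exact: legendre_lb].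
pose e := Num.min delta (h / (8 * t)).
have e0 : 0 < e by rewrite lt_min d0 divr_gt0// mulr_gt0.
have ed : e <= delta by rewrite /e ge_min lexx.
have et : e * t <= h / 8.
  have : e <= h / (8 * t) by rewrite /e ge_min lexx orbT.
  move=> /(ler_wpM2r (ltW t0))/le_trans; apply.
  by rewrite le_eqVlt; apply/orP; left; apply/eqP; field; rewrite gt_eqF.
have e1 : 0 < h / 8 * ln 2 by rewrite mulr_gt0//; lra.
have [M1 HM1] := psum_le_pressure p_gt0 q_gt0 (ltW t0) e1.
(* The exponent that Chebyshev's inequality gives for the number of [big] words; it lies below
   [s * ln 2] by the choice of [t] and [e]. *)
pose b := P t + h / 8 * ln 2 - (delta - e) * ln 2 * t.
pose big n w := expR (n%:R * ((delta - e) * ln 2)) <= wn w.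
pose Xs n := [seq (2 ^ n * i + val2 w)%N | i <- iota 0 N, w <- [seq w <- words 'I_2 n | big n w]].
pose E M := [set a | forall n, (M <= n)%N -> exists2 X : nat, X \in Xs n &
  X%:R <= 2 ^+ n * lev a <= X%:R + 2].
(* The scale from which [slice_dim_large] applies depends on the level, hence a countable union. *)
apply: (@hausdorff_null_sub _ _ _ _ _ (\bigcup_M E M)).
  move=> a [Sa dimE]; have [M HM] := slice_dim_large Sa e0 ed dimE.
  exists M => // n Mn; have [X [XN hX X2]] := HM n Mn; exists X => //.
  have t2 : (0 < 2 ^ n)%N by rewrite expn_gt0.
  have [w sw wX] := @bit_word n (X %% 2 ^ n) (ltn_pmod _ t2).
  have XE : X = (2 ^ n * (X %/ 2 ^ n) + val2 w)%N by rewrite wX mulnC -divn_eq.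
  have iN : (X %/ 2 ^ n < N)%N by rewrite ltn_divLR.
  apply/allpairsP; exists (X %/ 2 ^ n, w)%N; split => //=; first by rewrite mem_iota.
  rewrite mem_filter mem_words sw eqxx andbT; apply: le_trans hX _.
  by rewrite {1}XE -{1 2}sw; exact: tot_le_wnorm.
apply: hausdorff_null_bigcup => M.
apply: (@level_cover_null _ Xs _ b N%:R (maxn M M1)) => //.
- have e4 : P t = P t / ln 2 * ln 2 by rewrite divfK// gt_eqF.
  rewrite /b {1}e4.
  have -> : P t / ln 2 * ln 2 + h / 8 * ln 2 - (delta - e) * ln 2 * t =
     (- delta * t + P t / ln 2 + h / 8 + e * t) * ln 2 by ring.
  by rewrite ltr_pM2r// /s; lra.
- move=> n; rewrite geq_max => /andP[_ M1n].
  rewrite size_allpairs size_iota natrM ler_wpM2l//.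
  set F := seq.filter _ _.
  rewrite /b mulrBr expRB ler_pdivlMr ?expR_gt0//.
  apply: (@le_trans _ _ (psum p q n t)); last first.
    by rewrite -[leLHS]lnK ?posrE ?psum_gt0 ?(ltW t0)// ler_expR HM1.
  apply: (@le_trans _ _ (\sum_(w <- F) wn w `^ t)).
    apply: (@le_trans _ _ (\sum_(w <- F | w \in F) expR (n%:R * ((delta - e) * ln 2 * t)))).
      by rewrite -big_seq big_const_seq count_predT iter_addr addr0 -[leRHS]mulr_natl.
    rewrite [leRHS]big_seq; apply: ler_sum => w; rewrite mem_filter => /andP[hw _].
    rewrite -[leRHS]lnK ?posrE ?powR_gt0 ?wnorm_gt0// ler_expR ln_powR.
    rewrite mulrA [leRHS]mulrC ler_wpM2r ?(ltW t0)//.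
    by rewrite -ler_expR lnK// posrE wnorm_gt0.
  rewrite /F big_filter /psum [leRHS](bigID (big n)) /= lerDl.
  by apply: sumr_ge0 => w _; exact: powR_ge0.
- by move=> n a; rewrite geq_max => /andP[Mn _]; exact.
Qed.

End Covers.

(** * Typical slices *)

Lemma hausdorff_dim_lebesgue (R : realType) (A : set R) :
  (0 < lebesgue_measure A)%E -> (1%:E <= hausdorff_dim (@dist1 R) A)%E.
Proof.
move=> A0; apply: hausdorff_dim_ge => s s0 s1.
apply: (@mass_distribution _ _ (@dist1 R) id A A s 1 2) => // U U0 U1.
have [r /andP[r0 r1] dU] := diam_fin U1.
rewrite (gauge_diam s U0 dU) -EFinM.
have [x Ux] := U0.
have /lebesgue_le/le_trans : A `&` id @^-1` U `<=` `[x - r, x + r]%classic.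
  move=> y [_ Uy]; rewrite /= in_itv /= -ler_distl.
  by rewrite -lee_fin -dU; exact: (@le_diam _ _ (@dist1 R)).
apply; rewrite lebesgue_itvcc ?lee_fin; last by lra.
have -> : x + r - (x - r) = 2 * r by ring.
rewrite ler_pM2l//; move: r0; rewrite le_eqVlt => /predU1P[<-|r0]; first exact: powR_ge0.
rewrite -[leRHS]lnK ?posrE ?powR_gt0// -[leLHS]lnK ?posrE// ler_expR ln_powR.
have : ln r <= 0 by rewrite ln_le0.
nra.
Qed.

Section Typical.
Context {R : realType}.
Variables (p q : nat) (theta : R) (D : set (R * R)) (alpha : R).
Hypotheses (p_gt0 : (0 < p)%N) (q_gt0 : (0 < q)%N).
Hypothesis tan_theta : tan theta = Num.sqrt 3 * p%:R / (2 * q%:R + p%:R).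
Hypothesis gasketD : is_sierpinski_gasket D.
Hypothesis alphaP : is_typical_slice_dim D theta alpha.
Local Notation N := (p + q)%N.
Local Notation val3 := (wval (digit p q)).
Local Notation val2 := (wval bit).
Local Notation wn := (@wnorm R p q).
Local Notation lev := (@level R p q).
Local Notation sc := (@scale R p q).
Local Notation lam := (@lebesgue_measure R).

Let q0 : 0 < q%:R :> R. Proof. by rewrite ltr0n. Qed.
Let sc0 : 0 < sc. Proof. exact: scale_gt0. Qed.
Let N0 : 0 < N%:R :> R. Proof. by rewrite ltr0n addn_gt0 p_gt0. Qed.
Let l2 : 0 < ln 2 :> R. Proof. by rewrite ln_gt0// ltr1n. Qed.

Lemma level_le a y : (lev a <= y) = (sc * (1 - y / q%:R) <= a).
Proof.
rewrite /level -ler_pdivlMl// lerBlDl -lerBlDr ler_pdivlMr// mulrC.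
by rewrite [q%:R^-1 * y]mulrC mulrC.
Qed.

Lemma level_ge a y : (y <= lev a) = (a <= sc * (1 - y / q%:R)).
Proof.
rewrite /level -ler_pdivrMl// lerBrDl -lerBrDr ler_pdivrMr// [q%:R^-1 * y]mulrC.
by rewrite [sc * _]mulrC.
Qed.

Lemma level_lt a y : (lev a < y) = (sc * (1 - y / q%:R) < a).
Proof. by rewrite !ltNge level_ge. Qed.

Definition shadow_itv : set R := `[sc * (1 - N%:R / q%:R), sc * (1 - 0 / q%:R)]%classic.

Lemma shadow_itvE a : shadow D theta a <-> shadow_itv a.
Proof.
by rewrite (shadowE p_gt0 q_gt0 tan_theta gasketD) level_le level_ge /shadow_itv /= in_itv /= andbC.
Qed.

Lemma lebesgue_shadow_itv : lam shadow_itv = (sc * N%:R / q%:R)%:E.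
Proof.
rewrite lebesgue_itvcc; last first.
  rewrite ler_pM2l// lerD2l lerN2 ler_pM2r ?invr_gt0//; exact: ltW.
by congr (_%:E); field; rewrite gt_eqF.
Qed.

Lemma typical_null : exists2 B : set R, lam B = 0%E & forall a, shadow D theta a -> ~ B a ->
  has_box_dim dist2 (slice D theta a) alpha%:E /\
  hausdorff_dim dist2 (slice D theta a) = alpha%:E.
Proof.
have [B [mB B0 sB]] := alphaP; exists B => // a Sa Ba.
by apply: contrapT => H; apply: Ba; apply: sB => /= /(_ Sa).
Qed.

Lemma lebesgue_typical :
  (0 < lam [set a | shadow D theta a /\ hausdorff_dim dist2 (slice D theta a) = alpha%:E])%E.
Proof.
have [B B0 HB] := typical_null; set G := [set a | _].
have : (lam shadow_itv <= lam B + lam G)%E.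
  apply: le_trans (lebesgueU _ _); apply: lebesgue_le => a /shadow_itvE Sa.
  have [Ba|Ba] := pselect (B a); [by left|right; split => //].
  by have [] := HB a Sa Ba.
rewrite B0 add0e; apply: lt_le_trans; rewrite lebesgue_shadow_itv lte_fin.
by rewrite divr_gt0// mulr_gt0.
Qed.

Lemma alpha_ge0 : 0 <= alpha.
Proof.
have [a [_ Ha]] : [set a | shadow D theta a /\
    hausdorff_dim dist2 (slice D theta a) = alpha%:E] !=set0.
  apply/set0P; apply/eqP => E; have := lebesgue_typical.
  by rewrite E measure0 ltxx.
by rewrite -lee_fin -Ha hausdorff_dim_ge0.
Qed.

(** Each triangle counted by [tot] contains a point of the slice, by [gasket_level], and a covering
    set meets at most [K] triangles. The successor avoids a division by 0. *)
Lemma covering_number_ge (a : R) (X n K : nat) :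
  (forall U, (diam dist2 U <= (1 / 2 ^+ n)%:E)%E -> exists J : seq (seq 'I_3),
    (size J <= K)%N /\ forall c z, size c = n -> D z -> U (gword c z) -> c \in J) ->
  X%:R <= 2 ^+ n * lev a <= X.+1%:R ->
  (((tot p q n X)%:R / K.+1%:R)%:E <= covering_number dist2 (1 / 2 ^+ n) (slice D theta a))%E.
Proof.
move=> HK /andP[X1 X2]; apply: le_ereal_inf_tmp => _ [m [U [EU dU]] <-].
rewrite lee_fin ler_pdivrMr// -natrM ler_nat.
have /choice[J HJ] i : exists J : seq (seq 'I_3), (size J <= K)%N /\
  forall c z, size c = n -> D z -> U i (gword c z) -> c \in J by exact: HK.
rewrite /tot -size_filter; set L := seq.filter _ _.
have LJ : {subset L <= flatten [seq J i | i <- enum 'I_m]}.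
  move=> c; rewrite mem_filter mem_words => /andP[/andP[c1 c2] /eqP scn].
  have t0 : 0 < 2 ^+ n :> R by rewrite exprn_gt0.
  have c1' : (val3 c)%:R <= X%:R :> R by rewrite ler_nat.
  have c2' : X.+1%:R <= (val3 c)%:R + N%:R :> R by rewrite -natrD ler_nat.
  have x0N : 0 <= 2 ^+ n * lev a - (val3 c)%:R <= N%:R by apply/andP; split; lra.
  have [z Dz zE] := gasket_level p_gt0 q_gt0 gasketD x0N.
  have /EU[i _ Ui] : slice D theta a (gword c z).
    rewrite (sliceE D p_gt0 q_gt0 tan_theta); split; first exact: gasket_gword.
    rewrite (coord_gword _ _ (@scoord_gmap R p q)) zE scn subrK mulrC mulKf// gt_eqF//.
  apply/flattenP; exists (J i); first by apply: map_f; rewrite mem_enum.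
  by have [_] := HJ i; apply; [exact: scn|exact: Dz|exact: Ui].
have uL : uniq L by rewrite filter_uniq ?words_uniq.
apply: leq_trans (uniq_leq_size uL LJ) _.
rewrite size_flatten /shape -map_comp sumnE big_map big_enum /=.
apply: (@leq_trans (\sum_(i < m) K)); first by apply: leq_sum => i _; have [] := HJ i.
by rewrite sum_nat_const card_ord leq_mul2l leqnSn orbT.
Qed.

Lemma box_dim_tot : exists K : nat, forall a e, shadow D theta a ->
  has_box_dim dist2 (slice D theta a) alpha%:E -> 0 < e ->
  exists M, forall n, (M <= n)%N ->
    (tot p q n (Num.trunc (2 ^+ n * lev a)))%:R <=
      K.+1%:R * expR (n%:R * (alpha * ln 2 + e)).
Proof.
have [K HK] := overlap gasketD 1; exists K => a e.
move=> /(shadowE p_gt0 q_gt0 tan_theta gasketD)/andP[l0 lN] box e0.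
have e'0 : 0 < e / ln 2 by rewrite divr_gt0.
have lt_e : (alpha%:E < (alpha + e / ln 2)%:E)%E by rewrite lte_fin ltrDl.
have /box := open_ereal_lt' lt_e.
move=> [d /= d0 Hd]; have [M HM] := pow2_gt d^-1.
exists M.+1 => n Mn; have t0 : 0 < 2 ^+ n :> R by rewrite exprn_gt0.
have n0 : 0 < n%:R :> R by rewrite ltr0n (leq_ltn_trans (leq0n M)).
have r0 : 0 < 1 / 2 ^+ n :> R by rewrite divr_gt0.
have rd : 1 / 2 ^+ n < d.
  rewrite ltr_pdivrMr// mulrC -ltr_pdivrMr// div1r; apply: lt_le_trans HM _.
  by rewrite ler_eXn2l ?ltr1n// ltnW.
have := Hd (1 / 2 ^+ n); rewrite /ball /= sub0r normrN gtr0_norm// => /(_ rd r0) /=.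
have nx0 : 0 <= 2 ^+ n * lev a by rewrite mulr_ge0// ltW.
have /andP[h1 h2] := truncn_itv nx0; set X := Num.trunc _ in h1 h2 *.
have X12 : X%:R <= 2 ^+ n * lev a <= X.+1%:R by rewrite h1 ltW.
have := covering_number_ge (HK n) X12; set cv := covering_number _ _ _ => hcv.
have lnr : - ln (1 / 2 ^+ n) = n%:R * ln 2 :> R.
  by rewrite div1r -expR_pow2 -expRN expRK opprK.
rewrite lnr => hlt.
have [->|tot0] := posnP (tot p q n X); first by rewrite mulr_ge0// expR_ge0.
have tK : 0 < (tot p q n X)%:R / K.+1%:R :> R by rewrite divr_gt0// ltr0n.
have : (((ln ((tot p q n X)%:R / K.+1%:R)) * (n%:R * ln 2)^-1)%:E < (alpha + e / ln 2)%:E)%E.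
  apply: le_lt_trans hlt; rewrite EFinM -lne_EFin//; apply: lee_wpmul2r.
    by rewrite lee_fin invr_ge0 mulr_ge0// ltW.
  by rewrite lee_lne// in_itv /= leey andbT ?lee_fin ?(le_trans _ hcv)// ?lee_fin ltW.
rewrite lte_fin ltr_pdivrMr ?mulr_gt0// => /ltW.
rewrite -(ler_expR (ln _)) lnK ?posrE// ler_pdivrMr// mulrC => /le_trans; apply.
rewrite ler_pM2l// ler_expR le_eqVlt; apply/orP; left; apply/eqP; field.
by rewrite gt_eqF.
Qed.

(** Half-open, so that a level of the shadow lies in exactly one cell of generation [n], that of
    index [Num.trunc (2 ^+ n * lev a)]. As [level] reverses the order, the open end is on the
    left. *)
Definition cell n (X : nat) : set R :=
  `]sc * (1 - (X.+1%:R / 2 ^+ n) / q%:R), sc * (1 - (X%:R / 2 ^+ n) / q%:R)]%classic.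

Lemma cellE n X a : cell n X a <-> X%:R <= 2 ^+ n * lev a < X.+1%:R.
Proof.
have t0 : 0 < 2 ^+ n :> R by rewrite exprn_gt0.
rewrite /cell /= in_itv /= -level_lt -level_ge ler_pdivrMr// ltr_pdivlMr//.
by rewrite [lev a * _]mulrC andbC.
Qed.

Lemma lebesgue_cell n X : lam (cell n X) = (sc / q%:R / 2 ^+ n)%:E.
Proof.
have t0 : 0 < 2 ^+ n :> R by rewrite exprn_gt0.
rewrite lebesgue_measure_itv /= lte_fin ltr_pM2l// ltrD2l ltrN2 ltr_pM2r ?invr_gt0//.
rewrite ltr_pM2r ?invr_gt0// ltr_nat ltnSn -EFinB; congr (_%:E); rewrite -natr1.
by field; rewrite !gt_eqF.
Qed.

(* Off a set of levels of small measure the box counts of the slices are bounded uniformly,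
   by continuity of Lebesgue measure from below; as the words of length [n] are equidistributed,
   most of them have small norm. *)
Lemma typical_heavy : heavy p q 0 (ln 2) (alpha * ln 2).
Proof.
(* Here [a] and [b] count the good and bad words, [x] and [y] the good and bad cells, [t] is [2 ^ n]
   and [n] stands for [N]. *)
have arith (a b x y t n : R) : a + b = t -> x + y = n * t + 1 -> b <= y -> 4 <= t ->
  (n - 2^-1) * t < x -> t / 4 <= a by lra.
move=> eta M1 eta0; have [K HK] := box_dim_tot.
have scq0 : 0 < sc / q%:R by exact: divr_gt0.
have e2 : 0 < eta / 2 by lra.
pose c := alpha * ln 2 + eta / 2.
pose good n X := ((tot p q n X)%:R <= K.+1%:R * expR (n%:R * c) :> R).
pose bad M := \bigcup_n \bigcup_X (if (M <= n)%N && ~~ good n X then cell n X else set0).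
pose Good M := shadow_itv `\` bad M.
have mbad M : measurable (bad M).
  apply: bigcupT_measurable => n; apply: bigcupT_measurable => X.
  by case: ifP => _ //; exact: measurable_itv.
have mGood M : measurable (Good M).
  by apply: measurableD => //; exact: measurable_itv.
have [B B0 HB] := typical_null.
have GoodP M a : Good M a -> forall n, (M <= n)%N -> good n (Num.trunc (2 ^+ n * lev a)).
  move=> [Sa nb] n Mn; apply/negPn/negP => ng; apply: nb; exists n => //.
  exists (Num.trunc (2 ^+ n * lev a)) => //; rewrite Mn ng /=.
  apply/cellE/truncn_itv; rewrite mulr_ge0//.
  by move/shadow_itvE: Sa => /(shadowE p_gt0 q_gt0 tan_theta gasketD)/andP[].
have cov : (lam shadow_itv <= lam (\bigcup_M Good M))%E.
  have : (lam shadow_itv <= lam B + lam (\bigcup_M Good M))%E.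
    apply: le_trans (lebesgueU _ _); apply: lebesgue_le => a Sa.
    have [Ba|Ba] := pselect (B a); [by left|right].
    have Sa' := (shadow_itvE a).2 Sa.
    have [box _] := HB a Sa' Ba; have [M HM] := HK a _ Sa' box e2.
    exists M => //; split => // -[n _ [X _]]; case: ifP => // /andP[Mn ng] /cellE hX.
    by move: ng; rewrite /good -(truncn_def hX) HM.
  by rewrite B0 add0e.
(* In the level coordinate the exceptional set has length below 1/2, so fewer than [2 ^ n / 2 + 1]
   cells are bad, against [2 ^ n] words. *)
have [M HM] : exists M, ((sc * N%:R / q%:R - sc / q%:R / 2)%:E < lam (Good M))%E.
  apply: contrapT => H.
  have hle M : (lam (Good M) <= (sc * N%:R / q%:R - sc / q%:R / 2)%:E)%E.
    by rewrite leNgt; apply/negP => h; apply: H; exists M.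
  have mU : measurable (\bigcup_M Good M) by exact: bigcupT_measurable.
  have nd : {homo Good : n m / (n <= m)%N >-> (n <= m)%O}.
    move=> n m nm; apply/subsetPset => a [Sa nb]; split => // -[k _ [X _]].
    case: ifP => // /andP[mk ng] ca; apply: nb; exists k => //; exists X => //.
    by rewrite (leq_trans nm mk) ng.
  have cv := nondecreasing_cvg_mu (mu := lam) mGood mU nd.
  have : (lim ((lam \o Good) n @[n --> \oo]) <= (sc * N%:R / q%:R - sc / q%:R / 2)%:E)%E.
    apply: lime_le; first by apply/cvg_ex; eexists; exact: cv.
    by exists 0%N => // n _; exact: hle.
  rewrite (cvg_lim _ cv)// => /(le_trans cov); rewrite lebesgue_shadow_itv lee_fin.
  have : 0 < sc / q%:R / 2 by rewrite divr_gt0.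
  lra.
have lnN : 0 <= ln (N%:R * K.+1%:R) :> R.
  rewrite ln_ge0// -natrM ler1n muln_gt0 addn_gt0 p_gt0//.
have [M2 HM2] := exists_natr_gt (ln (N%:R * K.+1%:R) / (eta / 2) + ln 4 / eta).
pose n := maxn (maxn M M2) (maxn M1 2).
have [Mn [M2n [M1n n2]]] : (M <= n)%N /\ (M2 <= n)%N /\ (M1 <= n)%N /\ (2 <= n)%N.
  by rewrite /n !leq_max !leqnn !orbT.
have t0 : 0 < 2 ^+ n :> R by rewrite exprn_gt0.
have nbig : ln (N%:R * K.+1%:R) / (eta / 2) + ln 4 / eta <= n%:R.
  by apply: le_trans (ltW HM2) _; rewrite ler_nat.
have ln4 : 0 <= ln 4 :> R by rewrite ln_ge0// ler1n.
have nb1 : ln (N%:R * K.+1%:R) <= n%:R * (eta / 2).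
  rewrite -ler_pdivrMr//; have : 0 <= ln 4 / eta by rewrite divr_ge0// ltW.
  lra.
have nb2 : ln 4 <= n%:R * eta.
  rewrite -ler_pdivrMr//.
  have : 0 <= ln (N%:R * K.+1%:R) / (eta / 2) by rewrite divr_ge0// ltW.
  lra.
pose I := iota 0 (N * 2 ^ n).+1.
pose gX := [seq X <- I | good n X].
have gX_le : (lam (Good M) <= ((size gX)%:R * (sc / q%:R / 2 ^+ n))%:E)%E.
  apply: (@lebesgue_seq_le _ _ gX _ (cell n)).
  - by rewrite ltW// divr_gt0.
  - move=> a Ga; have hg := GoodP M a Ga n Mn.
    have /andP[l0 lN] : 0 <= lev a <= N%:R.
      by case: Ga => /shadow_itvE/(shadowE p_gt0 q_gt0 tan_theta gasketD).
    have nx0 : 0 <= 2 ^+ n * lev a by rewrite mulr_ge0// ltW.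
    exists (Num.trunc (2 ^+ n * lev a)); last exact/cellE/truncn_itv.
    rewrite mem_filter hg mem_iota /= add0n ltnS.
    rewrite -(ler_nat R); apply: le_trans (_ : 2 ^+ n * lev a <= _).
      by have /andP[] := truncn_itv nx0.
    by rewrite natrM natrX mulrC ler_pM2r.
  - by move=> X; rewrite lebesgue_cell.
have gX_ge : (N%:R - 2^-1) * 2 ^+ n < (size gX)%:R :> R.
  have := lt_le_trans HM gX_le; rewrite lte_fin.
  have -> : sc * N%:R / q%:R - sc / q%:R / 2 =
    (N%:R - 2^-1) * 2 ^+ n * (sc / q%:R / 2 ^+ n) by field; rewrite !gt_eqF.
  by rewrite ltr_pM2r// divr_gt0.
pose goodw w := [forall i : 'I_N, good n (2 ^ n * i + val2 w)%N].
pose F := [seq w <- words 'I_2 n | goodw w].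
have sF w : w \in F -> size w = n.
  by rewrite mem_filter mem_words => /andP[_ /eqP].
have wF w : w \in F -> wn w <= expR (n%:R * (alpha * ln 2 + eta)).
  move=> wF; have sw := sF w wF; move: wF; rewrite mem_filter => /andP[/forallP hw _].
  rewrite (wnormE p_gt0 q_gt0) sw.
  apply: (@le_trans _ _ (\sum_(i < N) K.+1%:R * expR (n%:R * c))).
    by apply: ler_sum => i _; exact: hw.
  rewrite big_const_ord iter_addr addr0 -[leLHS]mulr_natl mulrA.
  rewrite -[X in X * _]lnK ?posrE ?mulr_gt0// -expRD ler_expR /c; lra.
(* A bad word has a bad cell over some state, and the residue of this cell modulo [2 ^ n] gives the
   word back. *)
have bad_le : (size [seq w <- words 'I_2 n | ~~ goodw w] <= size [seq X <- I | ~~ good n X])%N.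
  have /choice[f Hf] w : exists i : nat, ~~ goodw w -> (i < N)%N && ~~ good n (2 ^ n * i + val2 w)%N.
    have [gw|/forallPn[i hi]] := boolP (goodw w); first by exists 0%N.
    by exists i => _; rewrite ltn_ord.
  rewrite -(size_map (fun w => 2 ^ n * f w + val2 w)%N); apply: uniq_leq_size.
    rewrite map_inj_in_uniq ?filter_uniq ?words_uniq// => w w'.
    rewrite !mem_filter !mem_words => /andP[_ /eqP s1] /andP[_ /eqP s2] E.
    have h1 := wval_lt w bit_lt; have h2 := wval_lt w' bit_lt.
    rewrite s1 in h1; rewrite s2 in h2.
    have : ((2 ^ n * f w + val2 w) %% 2 ^ n = (2 ^ n * f w' + val2 w') %% 2 ^ n)%N by rewrite E.
    rewrite ![(2 ^ n * _)%N]mulnC !modnMDl !modn_small// => /(wval_inj bit_inj bit_lt).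
    by rewrite s1 s2; exact.
  move=> _ /mapP[w + ->]; rewrite !mem_filter mem_words => /andP[/Hf/andP[fN ->] /eqP sw].
  rewrite mem_iota /= add0n ltnS; have := wval_lt w bit_lt; rewrite sw => h.
  have h' : (2 ^ n * (f w).+1 <= N * 2 ^ n)%N by rewrite mulnC leq_mul2r fN orbT.
  by rewrite mulnS in h'; apply: leq_trans h'; rewrite addnC leq_add2r ltnW.
exists n, F; split => //; first by rewrite filter_uniq ?words_uniq.
have -> : \sum_(w <- F) wn w `^ 0 = (size F)%:R.
  by under eq_bigr do rewrite powRr0; rewrite big_const_seq count_predT iter_addr addr0.
have sizeF : (size F + size [seq w <- words 'I_2 n | ~~ goodw w] = 2 ^ n)%N.
  by rewrite !size_filter count_predC size_words card_ord.
have sizeX : (size gX + size [seq X <- I | ~~ good n X] = (N * 2 ^ n).+1)%N.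
  by rewrite !size_filter count_predC size_iota.
have F4 : 2 ^+ n / 4 <= (size F)%:R :> R.
  have e1 : (size F)%:R + (size [seq w <- words 'I_2 n | ~~ goodw w])%:R = 2 ^+ n :> R.
    by rewrite -natrD sizeF natrX.
  have e3 : (size gX)%:R + (size [seq X <- I | ~~ good n X])%:R = N%:R * 2 ^+ n + 1 :> R.
    by rewrite -natrD sizeX -natr1 natrM natrX.
  have e4 : (size [seq w <- words 'I_2 n | ~~ goodw w])%:R <=
    (size [seq X <- I | ~~ good n X])%:R :> R by rewrite ler_nat.
  have e5 : 4 <= 2 ^+ n :> R.
    have -> : 4 = 2 ^+ 2 :> R by ring.
    by rewrite ler_eXn2l// ltr1n.
  exact: (arith _ _ _ _ _ _ e1 e3 e4 e5 gX_ge).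
apply: le_trans F4; rewrite mulrBr expRB expR_pow2 ler_pM2l// lef_pV2 ?posrE ?expR_gt0//.
by rewrite -[leLHS]lnK ?posrE// ler_expR.
Qed.

Lemma typical_achievable e : 0 < e ->
  exists2 z, z <= alpha * ln 2 + e & achievable p q z (ln 2).
Proof.
move=> e0; have [x [s [Hx sx xa]]] := achievable_heavy p_gt0 q_gt0 (lexx 0) typical_heavy.
exists x; first by lra.
by apply: achievable_le Hx; rewrite mul0r addr0 in sx.
Qed.

End Typical.

(** * Lower bounds *)

Section CodeLimit.
Context {R : realType} {A : Type}.
Variables (g : A -> nat) (c : nat -> seq A).
Hypotheses (g_lt : forall a, (g a < 2)%N) (c_size : forall k, size (c k) = tri k)
  (c_prefix : forall k l, (k <= l)%N -> exists t, c l = c k ++ t).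

(** Nested dyadic intervals; [x] is the supremum of their left ends. *)
Lemma code_limit : exists x : R, forall k,
  (wval g (c k))%:R <= 2 ^+ tri k * x <= (wval g (c k)).+1%:R.
Proof.
pose V k : R := (wval g (c k))%:R / 2 ^+ tri k.
pose W k : R := (wval g (c k)).+1%:R / 2 ^+ tri k.
have t0 n : 0 < 2 ^+ n :> R by rewrite exprn_gt0.
have VW k : V k <= W k by rewrite ler_pM2r ?invr_gt0// ler_nat.
have mono k l : (k <= l)%N -> V k <= V l /\ W l <= W k.
  move=> kl; have [t ct] := c_prefix kl.
  have e : tri l = (tri k + size t)%N by rewrite -!c_size ct size_cat.
  have h : (wval g t < 2 ^ size t)%N by exact: wval_lt.
  have scale_up (n : nat) : n%:R / 2 ^+ tri k =
      (2 ^ size t * n)%:R / (2 ^+ tri k * 2 ^+ size t) :> R.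
    by rewrite natrM natrX; field; rewrite !gt_eqF.
  rewrite /V /W ct wval_cat e exprD !(scale_up (wval _ _)) !(scale_up (wval _ _).+1).
  rewrite !ler_pM2r ?invr_gt0 ?mulr_gt0// !ler_nat leq_addr; split => //.
  by rewrite mulnS -addnS addnC leq_add2r.
have VWkl k l : V k <= W l.
  have [/mono[h _]|/ltnW/mono[_ h]] := leqP k l; first exact: le_trans (VW l).
  exact: le_trans (VW k) h.
have ub : has_ubound (range V) by exists (W 0%N) => _ [k _ <-].
have V0 : range V !=set0 by exists (V 0%N), 0%N.
exists (sup (range V)) => k; apply/andP; split.
  by rewrite mulrC -ler_pdivrMr//; apply: ub_le_sup => //; exists k.
rewrite mulrC -ler_pdivlMr//; apply: ge_sup => // _ [l _ <-]; exact: VWkl.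
Qed.

End CodeLimit.

Section GasketPoints.
Context {R : realType}.
Variables (D : set (R * R)).
Hypothesis gasketD : is_sierpinski_gasket D.

Definition gpoint (u v : R) : R * R := (u + v / 2, Num.sqrt 3 * v / 2).

Let s3 : 0 < Num.sqrt 3 :> R. Proof. by rewrite sqrtr_gt0. Qed.

Lemma ucoord_gpoint u v : ucoord (gpoint u v) = u.
Proof. by rewrite /ucoord /gpoint /=; field; rewrite gt_eqF. Qed.

Lemma vcoord_gpoint u v : vcoord (gpoint u v) = v.
Proof. by rewrite /vcoord /gpoint /=; field; rewrite gt_eqF. Qed.

Lemma gasket_closed z :
  (forall e, 0 < e -> exists w, [/\ D w, `|ucoord z - ucoord w| <= e & `|vcoord z - vcoord w| <= e]) ->
  D z.
Proof.
move=> H; have /choice[w Hw] n : exists w, [/\ D w, `|ucoord z - ucoord w| <= n.+1%:R^-1 &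
    `|vcoord z - vcoord w| <= n.+1%:R^-1] by apply: H; rewrite invr_gt0.
have [|z' Dz' Hz'] := gasket_cluster gasketD (u := w); first by move=> n; have [] := Hw n.
have close (f : R * R -> R) : (forall n, `|f z - f (w n)| <= n.+1%:R^-1) ->
    (forall x y, `|f x - f y| <= 2 * (`|x.1 - y.1| + `|x.2 - y.2|)) -> f z = f z'.
  move=> fzw flip; apply/eqP; rewrite -subr_eq0 -normr_le0; apply/ler_addgt0Pr => e e0.
  have e8 : 0 < e / 8 by lra.
  have [M HM] := exists_natr_gt (e / 2)^-1.
  have [n [Mn h1 h2]] := Hz' _ M e8.
  have h3 := flip z' (w n); have h4 := fzw n.
  have h5 : n.+1%:R^-1 <= e / 2.
    rewrite -[leRHS]invrK lef_pV2 ?posrE ?invr_gt0 ?divr_gt0//; apply: le_trans (ltW HM) _.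
    by rewrite ler_nat leqW.
  have -> : f z - f z' = (f z - f (w n)) - (f z' - f (w n)) by ring.
  rewrite add0r; apply: le_trans (ler_normB _ _) _; move: h4 h5; move: (n.+1%:R^-1) => x; lra.
suff -> : z = z' by [].
apply: gasket_eq; apply: close.
- by move=> n; have [] := Hw n.
- move=> x y; apply: le_trans (ucoord_sub _ _) _.
  by have := normr_ge0 (x.1 - y.1); have := normr_ge0 (x.2 - y.2); lra.
- by move=> n; have [] := Hw n.
- move=> x y; apply: le_trans (vcoord_sub _ _) _.
  by have := normr_ge0 (x.1 - y.1); lra.
Qed.

(** The limits of the two binary coordinates define the point. Its preimage under [gword (c k)] is
    approximated by [gword t z0] with [t] a long continuation of [c k], so it lies in [D] because
    [D] is closed. *)
Lemma gasket_code (c : nat -> seq 'I_3) :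
  (forall k, size (c k) = tri k) ->
  (forall k l, (k <= l)%N -> exists t, c l = c k ++ t) ->
  exists z, forall k, exists2 w, D w & z = gword (c k) w.
Proof.
move=> c_size c_prefix.
have ud (k : 'I_3) : (udigit k < 2)%N by rewrite /udigit; case: eqP.
have vd (k : 'I_3) : (vdigit k < 2)%N by rewrite /vdigit; case: eqP.
have [u Hu] := @code_limit R _ udigit c ud c_size c_prefix.
have [v Hv] := @code_limit R _ vdigit c vd c_size c_prefix.
have t0 n : 0 < 2 ^+ n :> R by rewrite exprn_gt0.
exists (gpoint u v) => k.
pose wu := 2 ^+ tri k * u - (wval udigit (c k))%:R.
pose wv := 2 ^+ tri k * v - (wval vdigit (c k))%:R.
exists (gpoint wu wv); last first.
  apply: gasket_eq.
    rewrite (coord_gword _ _ (@ucoord_gmap R)) !ucoord_gpoint c_size /wu subrK.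
    by rewrite mulrC mulKf// gt_eqF.
  rewrite (coord_gword _ _ (@vcoord_gmap R)) !vcoord_gpoint c_size /wv subrK.
  by rewrite mulrC mulKf// gt_eqF.
have [[z0 Dz0] _ _] := gasketD.
apply: gasket_closed => e e0.
have [M HM] := pow2_gt e^-1.
pose l := (maxn k (M + tri k).+1)%N.
have [t ct] := c_prefix k l (leq_maxl _ _).
have st : (tri k + size t)%N = tri l by rewrite -!c_size ct size_cat.
have Mt : (M <= size t)%N.
  have h : (M + tri k <= tri l)%N.
    apply: leq_trans (tri_pred_le l); rewrite -ltnS prednK; first exact: leq_maxr.
    exact: leq_trans (leq_maxr _ _).
  by rewrite -st addnC leq_add2l in h.
have te : (2 ^+ size t)^-1 <= e.
  rewrite -[leRHS]invrK lef_pV2 ?posrE ?invr_gt0//; apply: le_trans (ltW HM) _.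
  by rewrite ler_eXn2l// ltr1n.
have close x (f : R * R -> R) (g : 'I_3 -> nat) :
    (forall k z, f (gmap k z) = (f z + (g k)%:R) / 2) -> 0 <= f z0 <= 1 ->
    (wval g (c l))%:R <= 2 ^+ tri l * x <= (wval g (c l)).+1%:R ->
    `|2 ^+ tri k * x - (wval g (c k))%:R - f (gword t z0)| <= e.
  move=> fg /andP[f0 f1] /andP[]; rewrite ct wval_cat -st -(@natr1 R (_ + _)) natrD natrM natrX exprD.
  move=> h1 h2; apply: le_trans te; rewrite (coord_gword _ _ fg).
  have -> : 2 ^+ tri k * x - (wval g (c k))%:R - (f z0 + (wval g t)%:R) / 2 ^+ size t =
    (2 ^+ tri k * 2 ^+ size t * x - 2 ^+ size t * (wval g (c k))%:R - f z0 - (wval g t)%:R)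
      / 2 ^+ size t by field; rewrite gt_eqF.
  rewrite normrM [`|(_ ^+ _)^-1|]gtr0_norm ?invr_gt0// ler_piMl ?invr_ge0 ?(ltW (t0 _))//.
  by rewrite ler_norml; apply/andP; split; lra.
exists (gword t z0); split; first exact: gasket_gword.
  by rewrite ucoord_gpoint; apply: close (@ucoord_gmap R) (ucoord_range gasketD Dz0) (Hu l).
by rewrite vcoord_gpoint; apply: close (@vcoord_gmap R) (vcoord_range gasketD Dz0) (Hv l).
Qed.

End GasketPoints.

Fixpoint concat (A : Type) (b : nat -> seq A) (k : nat) : seq A :=
  if k is j.+1 then concat b j ++ b j else [::].

Lemma size_concat (A : Type) (b : nat -> seq A) k : (forall j, size (b j) = j) ->
  size (concat b k) = tri k.
Proof.
move=> sb; elim: k => [|k IH]; first by rewrite /tri big_ord0.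
by rewrite /= size_cat IH triS sb.
Qed.

Lemma concat_prefix (A : Type) (b : nat -> seq A) k l : (k <= l)%N ->
  exists t, concat b l = concat b k ++ t.
Proof.
move=> /subnKC <-; elim: (l - k)%N => [|j [t IH]]; first by exists [::]; rewrite addn0 cats0.
by exists (t ++ b (k + j)%N); rewrite addnS /= IH catA.
Qed.

Lemma moran_codeE (R : realType) (A : eqType) (F : nat -> seq (seq A)) k (y : R) :
  moran_code F k y = concat (fun j => moran_block F j y) k.
Proof. by elim: k => //= k ->. Qed.

(* A word containing [01] does not start an extremal dyadic subinterval. *)
Lemma wval_mixed (a b : seq 'I_2) : let w := (a ++ [:: zero2; one2] ++ b)%SEQ in
  (0 < wval bit w)%N /\ (wval bit w + 1 < 2 ^ size w)%N.
Proof.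
move=> w; rewrite /w !wval_cat !size_cat /= !expnD !expnS expn0 /=.
rewrite (_ : wval bit [:: zero2; one2] = 1%N)// muln1.
have := wval_lt a bit_lt; have := wval_lt b bit_lt.
have : (0 < 2 ^ size b)%N by rewrite expn_gt0.
move: (wval bit a) (wval bit b) (2 ^ size a)%N (2 ^ size b)%N => x y s t; nia.
Qed.

(** * The dimension of a slice whose level is coded by blocks of a prescribed rate *)

Section Slice.
Context {R : realType}.
Variables (p q : nat) (theta : R) (D : set (R * R)).
Hypotheses (p_gt0 : (0 < p)%N) (q_gt0 : (0 < q)%N).
Hypothesis tan_theta : tan theta = Num.sqrt 3 * p%:R / (2 * q%:R + p%:R).
Hypothesis gasketD : is_sierpinski_gasket D.
Local Notation N := (p + q)%N.
Local Notation val3 := (wval (digit p q)).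
Local Notation val2 := (wval bit).
Local Notation wn := (@wnorm R p q).
Local Notation lev := (@level R p q).

Variables (b : nat -> seq 'I_2) (a delta : R).
Hypotheses (b_size : forall j, size (b j) = j) (b_loops : forall j, (0 < size (loops p q (b j)))%N)
  (levelP : forall k, (val2 (concat b k))%:R <= 2 ^+ tri k * lev a <= (val2 (concat b k)).+1%:R)
  (b_growth : forall e, 0 < e -> exists M, forall j, (M <= j)%N ->
     [/\ expR (j%:R * (delta * ln 2 - e)) <= (size (loops p q (b j)))%:R,
         wn (b j) <= expR (j%:R * (delta * ln 2 + e)) &
         exists u v, b j = (u ++ [:: zero2; one2] ++ v)%SEQ]).

Let t0 n : 0 < 2 ^+ n :> R. Proof. by rewrite exprn_gt0. Qed.
Let l2 : 0 < ln 2 :> R. Proof. by rewrite ln_gt0// ltr1n. Qed.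

(** A later block contains 01, which by [wval_mixed] keeps the level off both ends of its dyadic
    interval. Hence [size_level_words] applies with a single cell. *)
Lemma level_interior k :
  (val2 (concat b k))%:R < 2 ^+ tri k * lev a < (val2 (concat b k)).+1%:R.
Proof.
have [M HM] := b_growth (@ltr01 R).
pose j := maxn k M; have [kj Mj] : (k <= j)%N /\ (M <= j)%N.
  by rewrite /j !leq_max !leqnn orbT.
have [_ _ [u [v bj]]] := HM j Mj; have [t ct] := concat_prefix b kj.
have cj : concat b j.+1 = concat b k ++ ((t ++ u) ++ [:: zero2; one2] ++ v).
  by rewrite (_ : concat b j.+1 = concat b j ++ b j)// ct bj -!catA.
have [r0 r1] := wval_mixed (t ++ u) v; set r := ((_ ++ _) ++ _)%SEQ in cj r0 r1.
have st : tri j.+1 = (tri k + size r)%N.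
  by rewrite -!(size_concat _ b_size) cj size_cat.
have := levelP j.+1; rewrite cj wval_cat st exprD => /andP[h1 h2].
set X := val2 (concat b k) in h1 h2 *.
have e1 : (2 ^ size r * X)%:R < 2 ^+ tri k * 2 ^+ size r * lev a.
  by apply: lt_le_trans h1; rewrite ltr_nat -[X in (X < _)%N]addn0 ltn_add2l.
have e2 : 2 ^+ tri k * 2 ^+ size r * lev a < (2 ^ size r * X.+1)%:R.
  apply: le_lt_trans h2 _; rewrite ltr_nat mulnS addnC -addSn ltn_add2r.
  by rewrite -addn1.
rewrite natrM natrX [_ * 2 ^+ size r]mulrC -mulrA ltr_pM2l// in e1.
rewrite natrM natrX [_ * 2 ^+ size r]mulrC -mulrA ltr_pM2l// in e2.
by rewrite e1 e2.
Qed.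

Lemma wnorm_concat k : wn (concat b k) <= wn [::] * \prod_(j < k) wn (b j).
Proof.
elim: k => [|k IH]; first by rewrite big_ord0 mulr1.
rewrite /= big_ord_recr /= mulrA; apply: le_trans (wnorm_cat p_gt0 q_gt0 _ _) _.
by rewrite ler_pM2r// wnorm_gt0.
Qed.

Lemma slice_dim_le : 0 <= delta -> (hausdorff_dim dist2 (slice D theta a) <= delta%:E)%E.
Proof.
move=> d0; apply/lee_addgt0Pr => e e0; rewrite -EFinD.
have s0 : 0 <= delta + e by lra.
apply: hausdorff_dim_le => //; apply: (slice_null p_gt0 q_gt0 tan_theta gasketD) => // e' M e'0.
have h0 : 0 < e * ln 2 / 2 by rewrite divr_gt0// mulr_gt0.
have [M1 HM1] := b_growth h0.
have [|j Mj|C C0 HC] := @prod_growth_le R (fun j => wn (b j)) (delta * ln 2 + e * ln 2 / 2) M1.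
- by move=> j; exact: wnorm_gt0.
- by have [_ + _] := HM1 j Mj.
have [M2 HM2] := expR_small (wn [::] * C * 4 `^ (delta + e)) h0 e'0.
pose k := (maxn M M2).+1.
have tk : (maxn M M2 <= tri k)%N by exact: (tri_pred_le k).
rewrite geq_max in tk; have /andP[Mk M2k] := tk.
exists (tri k), (level_words p q (tri k) (lev a)); split => //.
  by move=> c; exact: mem_level_words.
have sJ : (size (level_words p q (tri k) (lev a)))%:R <=
    wn [::] * C * expR ((tri k)%:R * (delta * ln 2 + e * ln 2 / 2)).
  apply: (@le_trans _ _ (tot p q (tri k) (val2 (concat b k)))%:R).
    by rewrite ler_nat; apply: size_level_words (level_interior k).
  have N0 : (0 < N)%N by rewrite addn_gt0 p_gt0.
  have := @tot_le_wnorm R p q p_gt0 q_gt0 (concat b k) 0%N N0.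
  rewrite muln0 add0n size_concat// => /le_trans; apply.
  apply: le_trans (wnorm_concat k) _; rewrite -mulrA ler_pM2l ?wnorm_gt0//.
apply: le_trans (HM2 _ M2k).
apply: (@le_trans _ _ (wn [::] * C * expR ((tri k)%:R * (delta * ln 2 + e * ln 2 / 2)) *
    (4 / 2 ^+ tri k) `^ (delta + e))).
  by rewrite ler_wpM2r ?powR_ge0.
rewrite powR_scale// mulrACA -expRD.
by rewrite le_eqVlt; apply/orP; left; apply/eqP; congr (_ * expR _); field.
Qed.

(** Choosing for each block [b j] any of its loops gives a Moran set inside the slice: all its codes
    have the same value as [concat b k], so all its points have the level of [a]. *)
Lemma slice_dim_ge : (delta%:E <= hausdorff_dim dist2 (slice D theta a))%E.
Proof.
pose F j := loops p q (b j).
have uF j : uniq (F j) by exact: loops_uniq.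
have sF j c : c \in F j -> size c = j by rewrite mem_loops b_size => /andP[/eqP].
have prefix (y : R) k l : (k <= l)%N -> exists t, moran_code F l y = moran_code F k y ++ t.
  by exact: moran_code_prefix.
have sc k (y : R) : size (moran_code F k y) = tri k by exact: size_moran_code.
have valc k (y : R) : val3 (moran_code F k y) = val2 (concat b k).
  elim: k => [//|k IH]; rewrite /= !wval_cat IH.
  have : moran_block F k y \in F k by exact: mem_moran_block.
  by rewrite mem_loops => /andP[/eqP-> /eqP->].
have /choice[g Hg] (y : R) : exists z, forall k, exists2 w, D w & z = gword (moran_code F k y) w.
  by apply: (@gasket_code _ _ gasketD (fun k => moran_code F k y)) => [k|k l]; [exact: sc|exact: prefix].
have [K HK] := overlap gasketD 1.
apply: (@moran_dim _ _ F uF sF b_loops _ dist2 g _ delta K).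
- move=> y _; rewrite (sliceE D p_gt0 q_gt0 tan_theta).
  have [w0 Dw0 gw0] := Hg y 0%N; split; first by rewrite gw0.
  have N0 : 0 <= N%:R :> R by [].
  apply/eqP; rewrite -subr_eq0 -normr_le0; apply/ler_addgt0Pr => e e0; rewrite add0r.
  have [M HM] := pow2_gt ((N%:R + 1) / e).
  have [w Dw gw] := Hg y M.+1.
  have /andP[s0 s1] := scoord_range p q gasketD Dw.
  have /andP[h1 h2] := levelP M.+1; rewrite -natr1 in h2.
  rewrite gw (coord_gword _ _ (@scoord_gmap R p q)) sc valc.
  set X := (val2 _)%:R in h1 h2 *; set T := 2 ^+ tri M.+1 in h1 h2 *.
  have T0 : 0 < T by exact: t0.
  have -> : (scoord p q w + X) / T - lev a = (scoord p q w + X - T * lev a) / T.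
    by field; rewrite gt_eqF.
  rewrite normrM [`|T^-1|]gtr0_norm ?invr_gt0// ler_pdivrMr//.
  have : N%:R + 1 <= e * T.
    rewrite mulrC -ler_pdivrMr//; apply: le_trans (ltW HM) _.
    by rewrite /T ler_eXn2l// ?ltr1n//; exact: (tri_pred_le M.+1).
  apply: le_trans; rewrite ler_norml; apply/andP; split; lra.
- move=> k U; rewrite expRN expR_pow2 -div1r => /HK[J [sJ HJ]]; exists J; split => // y _ Uy.
  have [w Dw gw] := Hg y k; rewrite gw in Uy; exact: HJ (sc k y) Dw Uy.
move=> x xd; have e0 : 0 < delta * ln 2 - x by lra.
have [M HM] := b_growth e0; exists M => j Mj.
by have [+ _ _] := HM j Mj; rewrite opprB addrC subrK.
Qed.

End Slice.

(** * A Moran set of levels *)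

Section LowerBound.
Context {R : realType}.
Variables (p q : nat) (theta : R) (D : set (R * R)).
Hypotheses (p_gt0 : (0 < p)%N) (q_gt0 : (0 < q)%N).
Hypothesis tan_theta : tan theta = Num.sqrt 3 * p%:R / (2 * q%:R + p%:R).
Hypothesis gasketD : is_sierpinski_gasket D.
Local Notation N := (p + q)%N.
Local Notation val2 := (wval bit).
Local Notation wn := (@wnorm R p q).
Local Notation lev := (@level R p q).

Lemma chi_ge delta l : 0 <= delta -> achievable p q (delta * ln 2) (l * ln 2) ->
  (l%:E <= chi D theta delta)%E.
Proof.
move=> d0 Hach; have q0 : 0 < q%:R :> R by rewrite ltr0n.
have sc0 : 0 < scale p q :> R by exact: scale_gt0.
pose Q m e F := word_family p q m (m%:R * (delta * ln 2 - e)) (m%:R * (delta * ln 2 + e))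
    (m%:R * (l * ln 2 - e)) F /\
  forall w, w \in F -> exists u v, w = (u ++ [:: zero2; one2] ++ v)%SEQ.
have [||F0 [F0P F0Q]] := @choose_families R _ Q [::].
- move=> m e e' F ee [HF1 HF2]; split => //.
  by apply: word_family_weaken HF1; apply: ler_wpM2l => //; lra.
- by move=> e e0; exact: achievable_family Hach e e0.
have Qnil m e : ~ Q m e [::].
  by move=> [[_ _ _ _]]; rewrite leNgt expR_gt0.
(* Lengths without a family get the word of zeros, which has a loop; every block is then
   nonempty. *)
pose F m := if F0 m is [::] then [:: nseq m zero2] else F0 m.
have FE m e : Q m e (F0 m) -> F m = F0 m.
  by rewrite /F; case: (F0 m) => // /Qnil.
have FQ e : 0 < e -> exists M, forall m, (M <= m)%N -> Q m e (F m).
  by move=> /F0Q[M HM]; exists M => m /HM h; rewrite (FE m e h).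
have FP m : F m = [:: nseq m zero2] \/ exists e, Q m e (F m).
  have [E|[e He]] := F0P m; first by left; rewrite /F E.
  by right; exists e; rewrite (FE m e He).
have uF m : uniq (F m) by have [->|[e [[]]]] := FP m.
have sF m w : w \in F m -> size w = m.
  have [->|[e [[_ + _ _ _] _]]] := FP m; last exact.
  by rewrite inE => /eqP->; rewrite size_nseq.
have F_gt0 m : (0 < size (F m))%N.
  have [->//|[e]] := FP m.
  by case: (F m) => // /Qnil.
have lF m w : w \in F m -> (0 < size (loops p q w))%N.
  have [->|[e [[_ _ + _ _] _]] wF] := FP m; first by rewrite inE => /eqP->; exact: loops_zeros.
  by move=> /(_ w wF)/(lt_le_trans (expR_gt0 _)); rewrite ltr0n.
pose b (y : R) j := moran_block F j y.
have bF y j : b y j \in F j by exact: mem_moran_block.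
have sb y j : size (b y j) = j by exact: sF (bF y j).
have /choice[x Hx] y : exists x : R, forall k,
    (val2 (concat (b y) k))%:R <= 2 ^+ tri k * x <= (val2 (concat (b y) k)).+1%:R.
  apply: code_limit bit_lt _ _ => [k|k j]; [exact: size_concat|exact: concat_prefix].
pose g y : R := scale p q * (1 - x y / q%:R).
have levg y : lev (g y) = x y.
  by rewrite /level /g; field; rewrite !gt_eqF.
have l2 : 0 < ln 2 :> R by rewrite ln_gt0// ltr1n.
(* A distance [2 ^ - tri k] between values of [a] is [q / scale] in units of level cells; the 1 is
   required by [near_window]. *)
have [kK HkK] := exists_natr_gt (q%:R / scale p q + 1 : R).
apply: (@moran_dim _ _ F uF sF F_gt0 _ (@dist1 R) g _ l (2 * kK).+1).
- move=> y _; split.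
    apply/(shadowE p_gt0 q_gt0 tan_theta gasketD); rewrite levg.
    have := Hx y 0%N; rewrite /tri big_ord0 expr0 mul1r /= => /andP[-> h] /=.
    by apply: le_trans h _; rewrite ler1n addn_gt0 p_gt0.
  have growth e : 0 < e -> exists M, forall j, (M <= j)%N ->
     [/\ expR (j%:R * (delta * ln 2 - e)) <= (size (loops p q (b y j)))%:R,
         wn (b y j) <= expR (j%:R * (delta * ln 2 + e)) &
         exists u v, b y j = (u ++ [:: zero2; one2] ++ v)%SEQ].
    move=> /FQ[M HM]; exists M => j /HM[[_ _ h1 h2 _] h3].
    by split; [exact: h1|exact: h2|exact: h3].
  have lb j : (0 < size (loops p q (b y j)))%N by exact: lF (bF y j).
  have levP k : (val2 (concat (b y) k))%:R <= 2 ^+ tri k * lev (g y) <=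
      (val2 (concat (b y) k)).+1%:R by rewrite levg.
  apply/eqP; rewrite eq_le; apply/andP; split.
    exact: (slice_dim_le p_gt0 q_gt0 tan_theta gasketD (sb y) levP growth d0).
  exact: (slice_dim_ge p_gt0 q_gt0 tan_theta gasketD (sb y) lb levP growth).
- move=> k U; rewrite expRN expR_pow2 => dU.
  have [[y0 [y001 Uy0]]|H] := pselect (exists y0, 0 <= y0 < 1 /\ U (g y0)); last first.
    by exists [::]; split => // y y01 Uy; case: H; exists y.
  pose W := iota (val2 (moran_code F k y0) - kK) (2 * kK).+1.
  exists [seq w <- words 'I_2 (tri k) | val2 w \in W]; split.
    rewrite -[X in (_ <= X)%N](size_iota (val2 (moran_code F k y0) - kK)%N) -/W.
    rewrite -(size_map val2); apply: uniq_leq_size.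
      rewrite map_inj_in_uniq ?filter_uniq ?words_uniq// => w w'.
      rewrite !mem_filter !mem_words => /andP[_ /eqP sw] /andP[_ /eqP sw'].
      by apply: (wval_inj bit_inj bit_lt); rewrite sw sw'.
    by move=> _ /mapP[w + ->]; rewrite mem_filter => /andP[].
  move=> y y01 Uy; rewrite mem_filter mem_words (size_moran_code sF F_gt0) eqxx andbT.
  have := Hx y k; have := Hx y0 k; rewrite /b -!moran_codeE => h0 h1.
  apply: near_window h1 h0 _ (ltW HkK).
  have t0 : 0 < 2 ^+ tri k :> R by rewrite exprn_gt0.
  have : dist1 (g y) (g y0) <= (2 ^+ tri k)^-1.
    by rewrite -lee_fin; apply: le_trans dU; exact: le_diam.
  rewrite /dist1 (sub_level p_gt0 q_gt0) !levg => hd.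
  rewrite -mulrBr normrM gtr0_norm//.
  have e1 : `|x y - x y0| = q%:R / scale p q * (scale p q / q%:R * `|x y - x y0|).
    by field; rewrite !gt_eqF.
  have qs0 : 0 <= q%:R / scale p q :> R by rewrite ltW// divr_gt0.
  rewrite e1 mulrCA ler_piMr//.
  by rewrite mulrC -ler_pdivlMr// div1r.
move=> c cl; have e0 : 0 < l * ln 2 - c by lra.
have [M HM] := FQ _ e0; exists M => j /HM[[_ _ _ _ +] _].
by rewrite opprB addrC subrK.
Qed.

End LowerBound.

(** Up to [bmax] one has [chi <= Gamma <= legendre], and [chi_ge] closes the chain above [alpha]. At
    [alpha] the levels of that dimension have positive outer measure, so [chi] is 1. Monotonicity
    and continuity are inherited from [legendre]. *)
Theorem theorem1p9 (R : realType) (p q : nat) (theta alpha : R)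
    (Delta : set (R * R))
    (p_gt0 : (0 < p)%N) (q_gt0 : (0 < q)%N) (pq_coprime : gcdn p q = 1%N)
    (theta_gt0 : 0 < theta) (theta_lt : theta < pi / 3)
    (tan_theta : tan theta = Num.sqrt 3 * p%:R / (2 * q%:R + p%:R))
    (gasketDelta : is_sierpinski_gasket Delta)
    (alphaP : is_typical_slice_dim Delta theta alpha) :
  [/\ forall delta : R, alpha < delta -> delta <= bmax p q ->
        Gamma Delta theta delta = pressure_transform p q delta,
      forall delta : R, delta <= alpha -> Gamma Delta theta delta = 1%E,
      {in `]-oo, bmax p q] &, forall x y : R, x <= y ->
        (Gamma Delta theta y <= Gamma Delta theta x)%E} &
      {within `]-oo, bmax p q], continuous (Gamma Delta theta)}]
  /\
  [/\ forall delta : R, alpha <= delta -> delta <= bmax p q ->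
        chi Delta theta delta = pressure_transform p q delta,
      {in `[alpha, bmax p q] &, forall x y : R, x <= y ->
        (chi Delta theta y <= chi Delta theta x)%E} &
      {within `[alpha, bmax p q], continuous (chi Delta theta)}].
Proof.
have l2 : 0 < ln 2 :> R by rewrite ln_gt0// ltr1n.
have a0 := alpha_ge0 p_gt0 q_gt0 tan_theta gasketDelta alphaP.
set b := bmax p q; set L := @legendre R p q.
have chi_Gamma delta : (chi Delta theta delta <= Gamma Delta theta delta)%E.
  by apply: hausdorff_dim_sub => a [Sa Ha]; split => //=; rewrite Ha.
have Gamma_le delta : delta <= b -> (Gamma Delta theta delta <= (L delta)%:E)%E.
  exact: Gamma_le_legendre.
have Gamma1 delta : delta <= alpha -> Gamma Delta theta delta = 1%E.
  move=> da; apply/eqP; rewrite eq_le (Gamma_le1 p_gt0 q_gt0 tan_theta gasketDelta)/=.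
  apply: le_trans (hausdorff_dim_lebesgue _) _.
    exact: lebesgue_typical p_gt0 q_gt0 tan_theta gasketDelta alphaP.
  by apply: hausdorff_dim_sub => a [Sa Ha]; split => //=; rewrite Ha lee_fin.
(* Squeezed between [Gamma = 1] and the general bound [legendre_le1]. *)
have L1 delta : delta <= b -> delta <= alpha -> L delta = 1.
  move=> db da; apply/eqP; rewrite eq_le (legendre_le1 p_gt0 q_gt0 db)/= -lee_fin.
  by rewrite -(Gamma1 delta da) Gamma_le.
have chiE delta : alpha <= delta -> delta <= b -> chi Delta theta delta = (L delta)%:E.
  move=> ad db; apply/eqP; rewrite eq_le (le_trans (chi_Gamma _) (Gamma_le _ db))/=.
  have [da|ad'] := eqVneq alpha delta.
    rewrite -da in db *; rewrite L1//; apply: hausdorff_dim_lebesgue.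
    exact: lebesgue_typical p_gt0 q_gt0 tan_theta gasketDelta alphaP.
  have {}ad : alpha < delta by rewrite lt_neqAle ad'.
  apply: (chi_ge p_gt0 q_gt0 tan_theta gasketDelta); first exact: le_trans (ltW ad).
  apply: (@achievable_le_bmax _ _ _ p_gt0 q_gt0 (alpha * ln 2)).
  - exact: typical_achievable p_gt0 q_gt0 tan_theta gasketDelta alphaP.
  - by rewrite ltr_pM2r.
  - by rewrite mulrC ler_pM2l.
  - by rewrite ler_piMl ?(ltW l2)// legendre_le1.
  - move=> t t0; rewrite -ler_pdivlMr//; apply: le_trans (legendre_le p_gt0 q_gt0 db t0) _.
    rewrite le_eqVlt; apply/orP; left; apply/eqP; field; exact: lt0r_neq0.
have GammaE delta : delta <= b -> Gamma Delta theta delta = (L delta)%:E.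
  move=> db; have [da|ad] := leP delta alpha; first by rewrite Gamma1// L1.
  apply/eqP; rewrite eq_le Gamma_le//= -(chiE delta (ltW ad) db).
  exact: chi_Gamma.
have Lcont := @legendre_continuous R p q p_gt0 q_gt0.
have cont (f : R -> \bar R) (A : set R) : A `<=` `]-oo, b]%classic ->
    (forall x, A x -> f x = (L x)%:E) -> {within A, continuous f}.
  move=> Ab fL; apply/subspace_continuousP => x Ax.
  have Lx : L y @[y --> within A (nbhs x)] --> L x.
    by move/subspace_continuousP : (continuous_subspaceW Ab Lcont); exact.
  suff : f y @[y --> within A (nbhs x)] --> (L x)%:E by rewrite -(fL x Ax).
  apply: cvg_EFin.
    by rewrite near_withinE; apply: nearW => y Ay; rewrite fL.
  apply: cvg_trans Lx; apply: near_eq_cvg.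
  by rewrite near_withinE; apply: nearW => y Ay /=; rewrite fL.
have mono (f : R -> \bar R) (A : {pred R}) : {subset A <= `]-oo, b]} ->
    (forall x, x \in A -> f x = (L x)%:E) ->
    {in A &, forall x y : R, x <= y -> (f y <= f x)%E}.
  move=> Ab fL x y xA yA xy; rewrite !fL// lee_fin; apply: legendre_nonincr => //.
  by have := Ab y yA; rewrite in_itv.
split; split.
- by move=> delta _ db; rewrite GammaE// pressure_transformE.
- exact: Gamma1.
- by apply: mono => // x; rewrite in_itv /= => /GammaE.
- by apply: cont => // x; rewrite /= in_itv /= => /GammaE.
- by move=> delta ad db; rewrite chiE// pressure_transformE.
- apply: mono => x; rewrite !in_itv /= => /andP[ax xb] //; exact: chiE.
- apply: cont => x; rewrite /= !in_itv /= => /andP[ax xb] //; exact: chiE.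
Qed.
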